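(* Suppose that the asymptotic covariance matrix $\Sigma^2$ is positive definite. Let $B\subset\mathbb R^d$ be a (sufficiently small) closed ball around the origin such that the Hessian $D^2\Lambda(t)$ is positive definite for every $t\in B$, and set $\Lambda^*(x)=\sup_{t\in B}\left(t\cdot x-\Lambda(t)\right)$ for $x\in\mathbb R^d$. Then for $\mathbb P$-a.e. $\omega\in\Omega$: (i) for any closed set $A\subset\mathbb R^d$, $$\limsup_{n\to\infty}\frac1n\log\mu_\omega(\{S_ng(\omega,\cdot)/n\in A\})\le-\inf_{x\in A}\Lambda^*(x);$$ (ii) there exists a closed ball $B_0\subset\mathbb R^d$ around the origin, which does not depend on $\omega$, such that for any open subset $A$ of $B_0$, $$\liminf_{n\to\infty}\frac1n\log\mu_\omega(\{S_ng(\omega,\cdot)/n\in A\})\ge-\inf_{x\in A}\Lambda^*(x).$$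
   Context: Base: $(\Omega,\mathcal F,\mathbb P)$ is a probability space, $\Omega$ a Borel subset of a separable complete metric space, and $\sigma:\Omega\to\Omega$ is a homeomorphism that is an invertible ergodic $\mathbb P$-preserving transformation. Variation: $(X,\mathcal G)$ is a measurable space with a probability measure $m$ and a functional $\mathrm{var}:L^1(X,m)\to[0,\infty]$ such that: (V1) $\mathrm{var}(th)=|t|\mathrm{var}(h)$; (V2) $\mathrm{var}(g+h)\le\mathrm{var}(g)+\mathrm{var}(h)$; (V3) $\|h\|_{L^\infty}\le C_{\mathrm{var}}(\|h\|_1+\mathrm{var}(h))$ for a constant $1\le C_{\mathrm{var}}<\infty$; (V4) for any $C>0$ the set $\{h:X\to\mathbb R:\|h\|_1+\mathrm{var}(h)\le C\}$ is $L^1(m)$-compact; (V5) $\mathrm{var}(1_X)<\infty$; (V6) $\{h:X\to\mathbb R_+:\|h\|_1=1,\ \mathrm{var}(h)<\infty\}$ is $L^1(m)$-dense in $\{h:X\to\mathbb R_+:\|h\|_1=1\}$; (V7) if $\mathrm{ess\,inf} f>0$ then $\mathrm{var}(1/f)\le\mathrm{var}(f)/(\mathrm{ess\,inf} f)^2$; (V8) $\mathrm{var}(fg)\le\|f\|_{L^\infty}\mathrm{var}(g)+\|g\|_{L^\infty}\mathrm{var}(f)$; (V9) for $M>0$, measurable $f:X\to\overline B_{\mathbb R^d}(0,M)$ and $C^1$ $h:\overline B_{\mathbb R^d}(0,M)\to\mathbb C$, $\mathrm{var}(h\circ f)\le\sup\{\|Dh(P)\|:P\in\overline B_{\mathbb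 R^d}(0,M)\}\,\mathrm{var}(f)$, where for vector-valued $f$, $\mathrm{var}(f)=\max_i\mathrm{var}(f^i)$. $\mathcal B=\{h\in L^1(X,m):\mathrm{var}(h)<\infty\}$ (complex-valued functions) is a Banach space with norm $\|h\|_{\mathcal B}=\|h\|_1+\mathrm{var}(h)$. Cocycle: $T_\omega:X\to X$, $\omega\in\Omega$, are nonsingular ($m\circ T_\omega^{-1}\ll m$), $T_\omega^{(n)}=T_{\sigma^{n-1}\omega}\circ\cdots\circ T_\omega$, $\tau(\omega,x)=(\sigma\omega,T_\omega x)$. The transfer operator $\mathcal L_\omega$ is defined by $\int(\mathcal L_\omega\phi)\psi\,dm=\int\phi\,(\psi\circ T_\omega)\,dm$ ($\phi\in L^1,\psi\in L^\infty$), and $\mathcal L_\omega^{(n)}=\mathcal L_{\sigma^{n-1}\omega}\circ\cdots\circ\mathcal L_\omega$. The cocycle is assumed admissible: (C1) $\omega\mapsto\mathcal L_\omega\in L(\mathcal B)$ is continuous on each of countably many Borel sets whose union is $\Omega$; (C2) there is $K>0$ with $\|\mathcal L_\omega f\|_{\mathcal B}\le K\|f\|_{\mathcal B}$ for all $f\in\mathcal B$ and a.e. $\omega$; (C3) there are $N\in\mathbb N$ and measurable $\alpha^N,\beta^N:\Omega\to(0,\infty)$ with $\int\log\alpha^N\,d\mathbb P<0$ and $\|\mathcal L_\omega^{(N)}f\|_{\mathcal B}\le\alpha^N(\omega)\|f\|_{\mathcal B}+\beta^N(\omega)\|f\|_1$ for all $f\in\mathcal B$, a.e. $\omega$; (C4)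 there are $K',\lambda>0$ with $\|\mathcal L_\omega^{(n)}f\|_{\mathcal B}\le K'e^{-\lambda n}\|f\|_{\mathcal B}$ for all $n\ge0$, $f\in\mathcal B$ with $\int f\,dm=0$, a.e. $\omega$; (C5) there are $N\in\mathbb N$, $c>0$ such that for each $a>0$ and all sufficiently large $n$, $\mathrm{ess\,inf}\,\mathcal L_\omega^{(Nn)}f\ge c\|f\|_1$ for a.e. $\omega$ and all $f\in\mathcal B$ with $f\ge0$, $\mathrm{var}(f)\le a\int f\,dm$. Invariant measure: $v^0:\Omega\times X\to\mathbb R^+$ is the unique measurable map with $v_\omega^0=v^0(\omega,\cdot)\in\mathcal B$, $\int v_\omega^0dm=1$, $\mathcal L_\omega v_\omega^0=v_{\sigma\omega}^0$ for a.e. $\omega$; $d\mu_\omega=v_\omega^0\,dm$. Observable: $g=(g^1,\dots,g^d):\Omega\times X\to\mathbb R^d$ is measurable, $\|g\|_{L^\infty(\Omega\times X)}<\infty$, $\mathrm{ess\,sup}_\omega\max_i\mathrm{var}(g^i(\omega,\cdot))<\infty$, and $\int g^i(\omega,\cdot)\,d\mu_\omega=0$ for a.e. $\omega$ and all $i$. $S_ng(\omega,x)=\sum_{i=0}^{n-1}g(\sigma^i\omega,T_\omega^{(i)}x)$. Covariance: $\Sigma^2$ is the positive semi-definite $d\times d$ matrix with $\Sigma^2=\lim_{n\to\infty}\frac1n\mathrm{Cov}_{\mu_\omega}(S_ng(\omega,\cdot))$ for a.e. $\omega$ (this limit exists). Twisted cocycle: for $\theta\in\mathbb C^d$, $\mathcal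 L_\omega^\theta f=\mathcal L_\omega(e^{\theta\cdot g(\omega,\cdot)}f)$ on $\mathcal B$, $\mathcal L_\omega^{\theta,(n)}=\mathcal L_{\sigma^{n-1}\omega}^\theta\circ\cdots\circ\mathcal L_\omega^\theta$, and $\Lambda(\theta)=\lim_{n\to\infty}\frac1n\log\|\mathcal L_\omega^{\theta,(n)}\|$ (a.e. constant) is the top Lyapunov exponent. $\Lambda$ is of class $C^2$ near $0$ with Hessian $D^2\Lambda(0)=\Sigma^2$ (Hessian in the real variables $\theta\in\mathbb R^d$). *)

(* Defs.v *)
From HB Require Import structures.
From mathcomp Require Import all_boot all_order all_algebra.
From mathcomp Require Import complex.
From mathcomp Require Import all_classical all_reals all_analysis.
From mathcomp Require Import ess_sup_inf.

Set Implicit Arguments.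
Unset Strict Implicit.
Unset Printing Implicit Defensive.

Import Order.TTheory GRing.Theory Num.Theory.
Import numFieldNormedType.Exports.

Local Open Scope classical_set_scope.
Local Open Scope ring_scope.
Local Open Scope complex_scope.

Definition cabs (R : realType) (z : R[i]) : R :=
  Num.sqrt (complex.Re z ^+ 2 + complex.Im z ^+ 2).

Definition cexp (R : realType) (z : R[i]) : R[i] :=
  (expR (complex.Re z) * cos (complex.Im z))
    +i* (expR (complex.Re z) * sin (complex.Im z)).

Definition dotp (K : nzRingType) (d : nat) (u v : 'rV[K]_d) : K :=
  \sum_(i < d) u ord0 i * v ord0 i.

Definition rV_complex (R : realType) (d : nat) (t : 'rV[R]_d) : 'rV[R[i]]_d :=
  map_mx (fun a : R => a%:C) t.

(* The library norm on ['rV[R]_d] is the max norm; balls of R^d are taken for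
   the Euclidean norm. *)
Definition eucl_closed_ball (R : realType) (d : nat) (r : R) : set 'rV[R]_d :=
  [set t | Num.sqrt (dotp t t) <= r].

Definition posdef (R : realType) (d : nat) (A : 'M[R]_d) : Prop :=
  A^T = A /\ forall u : 'rV[R]_d, u != 0 -> 0 < (u *m A *m u^T) ord0 ord0.

Definition partial (R : realType) (d : nat) (i : 'I_d)
    (f : 'rV[R]_d -> R) (t : 'rV[R]_d) : R :=
  'D_(delta_mx ord0 i) f t.

Definition hessian (R : realType) (d : nat)
    (f : 'rV[R]_d -> R) (t : 'rV[R]_d) : 'M[R]_d :=
  \matrix_(i, j) partial i (partial j f) t.

Definition C1_on (R : realType) (d : nat) (U : set 'rV[R]_d)
    (f : 'rV[R]_d -> R) : Prop :=
  [/\ open U,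
      forall t, U t -> {for t, continuous f} &
      forall (i : 'I_d) t, U t ->
        derivable f t (delta_mx ord0 i) /\ {for t, continuous (partial i f)}].

Definition C2_on (R : realType) (d : nat) (U : set 'rV[R]_d)
    (f : 'rV[R]_d -> R) : Prop :=
  C1_on U f /\ forall i : 'I_d, C1_on U (partial i f).

(* A_(s^(n-1) w) o ... o A_w *)
Fixpoint cocycle_iter (W Y : Type) (s : W -> W) (A : W -> Y -> Y)
    (n : nat) (w : W) (y : Y) : Y :=
  if n is k.+1 then A (iter k s w) (cocycle_iter s A k w y) else y.

(* [Omega] is identified with its image under [iota], a Borel subset of a
   separable complete metric space; its topology is the one induced by [iota].
   The sigma-algebra of [Omega] contains the Borel sets, and may be larger
   (e.g. a completion). *)
Record borel_sample_space (R : realType) dO (Omega : measurableType dO)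
    (E : metricType R) (iota : Omega -> E) : Prop := {
  sample_complete : forall F : set_system E, ProperFilter F -> cauchy F ->
    exists p : E, F --> p ;
  sample_separable : exists2 D : set E, countable D & dense D ;
  sample_inj : injective iota ;
  sample_borel : <<s @open E >> (range iota) ;
  sample_open : forall U : set Omega,
    @open (initial_topology iota) U -> measurable U }.

Record ergodic_homeo (R : realType) dO (Omega : measurableType dO)
    (E : metricType R) (iota : Omega -> E) (P : probability Omega R)
    (sigma : Omega -> Omega) : Prop := {
  homeo : exists2 sigma' : Omega -> Omega,
    cancel sigma sigma' /\ cancel sigma' sigma &
    [/\ continuous (sigma : initial_topology iota -> initial_topology iota),
        continuous (sigma' : initial_topology iota -> initial_topology iota),
        measurable_fun setT sigma & measurable_fun setT sigma'] ;
  preserving : forall A, measurable A -> P (sigma @^-1` A) = P A ;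
  ergodic : forall A, measurable A -> sigma @^-1` A = A ->
    P A = 0%E \/ P A = 1%E }.

(* Elements of L^1(X, m) are represented by functions; everything below is
   insensitive to modification on an m-null set (for [var] this is
   [var_ae_eq]). *)
Section function_space.
Context {R : realType} {dX : measure_display} {X : measurableType dX}.
Variable m : probability X R.
Implicit Types f h : X -> R[i].

Definition cmeasurable f : Prop :=
  measurable_fun setT (fun x => complex.Re (f x)) /\
  measurable_fun setT (fun x => complex.Im (f x)).

Definition L1 f : Prop :=
  m.-integrable setT (fun x => (complex.Re (f x))%:E) /\
  m.-integrable setT (fun x => (complex.Im (f x))%:E).

Definition L1norm f : \bar R := (\int[m]_x (cabs (f x))%:E)%E.

Definition Linfnorm f : \bar R := ess_sup m (fun x => (cabs (f x))%:E).

Definition Linf f : Prop := cmeasurable f /\ (Linfnorm f < +oo)%E.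

Definition cintegral f : R[i] :=
  (\int[m]_x complex.Re (f x)) +i* (\int[m]_x complex.Im (f x)).

Definition cae_eq f h : Prop := {ae m, forall x, f x = h x}.

Definition L1_open (U : set (X -> R[i])) : Prop :=
  forall f, L1 f -> U f ->
  exists2 e : R, 0 < e & forall h, L1 h -> (L1norm (h \- f)%R < e%:E)%E -> U h.

Definition L1_compact (K : set (X -> R[i])) : Prop :=
  forall F : set (set (X -> R[i])), (forall U, F U -> L1_open U) ->
  K `<=` \bigcup_(U in F) U ->
  exists2 G : set (set (X -> R[i])),
    finite_set G /\ G `<=` F & K `<=` \bigcup_(U in G) U.

Variable var : (X -> R[i]) -> \bar R.

Definition inB f : Prop := L1 f /\ (var f < +oo)%E.

Definition Bnorm f : \bar R := (L1norm f + var f)%E.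

Definition opnorm (A : (X -> R[i]) -> (X -> R[i])) : \bar R :=
  ereal_sup [set Bnorm (A f) | f in [set f | inB f /\ (Bnorm f <= 1)%E]].

Definition var_vec (d : nat) (f : X -> 'rV[R]_d) : \bar R :=
  \big[Order.max/0%E]_(i < d) var (fun x => (f x ord0 i)%:C).

End function_space.

(* |Dh(p)| for h : R^d -> C, as the norm of a linear map from R^d with the max
   norm, the norm for which var f = max_i var f^i is the variation of a
   vector-valued f.  It dominates the Euclidean operator norm, so [var_comp]
   stated with it is implied by the one for the Euclidean operator norm.  The
   latter cannot be required when d >= 2: with f = (u, ..., u) and
   h(x) = (sum_i x_i) / sqrt d it forces var u = 0 for all bounded u. *)
Definition Dnorm (R : realType) (d : nat) (h : 'rV[R]_d -> R[i])
    (p : 'rV[R]_d) : \bar R :=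
  ereal_sup [set (cabs ((\sum_(i < d) u ord0 i
                           * partial i (fun q => complex.Re (h q)) p)
                        +i* (\sum_(i < d) u ord0 i
                           * partial i (fun q => complex.Im (h q)) p)))%:E
            | u in [set u : 'rV[R]_d | forall i, `|u ord0 i| <= 1]].

Record is_variation (R : realType) dX (X : measurableType dX)
    (m : probability X R) (d : nat) (var : (X -> R[i]) -> \bar R) : Prop := {
  var_ge0 : forall f, L1 m f -> (0 <= var f)%E ;
  var_ae_eq : forall f h, L1 m f -> L1 m h -> cae_eq m f h -> var f = var h ;
  var_scale : forall (t : R[i]) h, L1 m h ->
    var (fun x => t * h x) = ((cabs t)%:E * var h)%E ;
  var_triangle : forall g h, L1 m g -> L1 m h -> (var (g \+ h)%R <= var g + var h)%E ;
  var_Linf : exists2 C : R, 1 <= C & forall h, L1 m h ->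
    (Linfnorm m h <= C%:E * (L1norm m h + var h))%E ;
  var_compact : forall C : R, 0 < C ->
    L1_compact m [set h | L1 m h /\ (forall x, complex.Im (h x) = 0) /\
                          (L1norm m h + var h <= C%:E)%E] ;
  var_one : (var (fun _ => 1%R) < +oo)%E ;
  var_dense : forall h, L1 m h -> (forall x, 0 <= h x) -> L1norm m h = 1%E ->
    forall e : R, 0 < e -> exists2 k,
      [/\ L1 m k, forall x, 0 <= k x, L1norm m k = 1%E & (var k < +oo)%E] &
      (L1norm m (k \- h)%R < e%:E)%E ;
  var_inv : forall (f : X -> R) (a : R), L1 m (fun x => (f x)%:C) ->
    ess_inf m (fun x => (f x)%:E) = a%:E -> 0 < a ->
    (var (fun x => ((f x)^-1)%R%:C) <= (a ^- 2)%R%:E * var (fun x => (f x)%:C))%E ;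
  (* an unbounded function has infinite variation by [var_Linf] *)
  var_mul : forall f g, Linf m f -> Linf m g ->
    (var (f \* g)%R <= Linfnorm m f * var g + Linfnorm m g * var f)%E ;
  var_comp : forall (M : R) (f : X -> 'rV[R]_d) (h : 'rV[R]_d -> R[i])
      (U : set 'rV[R]_d), 0 < M ->
    (forall i, measurable_fun setT (fun x => f x ord0 i)) ->
    (forall x, eucl_closed_ball M (f x)) ->
    eucl_closed_ball M `<=` U ->
    C1_on U (fun q => complex.Re (h q)) ->
    C1_on U (fun q => complex.Im (h q)) ->
    (var (h \o f)
      <= ereal_sup [set Dnorm h p | p in eucl_closed_ball M] * var_vec var f)%E ;
  var_complete : forall u : nat -> X -> R[i], (forall n, inB m var (u n)) ->
    (forall e : R, 0 < e -> exists n0, forall n k, (n0 <= n)%N -> (n0 <= k)%N ->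
      (Bnorm m var (u n \- u k)%R <= e%:E)%E) ->
    exists2 f, inB m var f &
      (fun n => Bnorm m var (u n \- f)%R) @ \oo --> 0%E }.

Definition nonsingular (R : realType) dX (X : measurableType dX)
    (m : probability X R) (T : X -> X) : Prop :=
  measurable_fun setT T /\
  forall A, measurable A -> m A = 0%E -> m (T @^-1` A) = 0%E.

Definition is_transfer (R : realType) dX (X : measurableType dX)
    (m : probability X R) (T : X -> X) (L : (X -> R[i]) -> (X -> R[i])) : Prop :=
  forall phi, L1 m phi -> L1 m (L phi) /\
    forall psi, Linf m psi ->
      cintegral m (fun x => L phi x * psi x) =
      cintegral m (fun x => phi x * psi (T x)).

Record admissible (R : realType) dO (Omega : measurableType dO)
    (E : metricType R) (iota : Omega -> E) (P : probability Omega R)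
    (sigma : Omega -> Omega) dX (X : measurableType dX) (m : probability X R)
    (var : (X -> R[i]) -> \bar R)
    (L : Omega -> (X -> R[i]) -> (X -> R[i])) : Prop := {
  adm_piecewise_continuous : (forall w, (opnorm m var (L w) < +oo)%E) /\
    exists2 F : nat -> set Omega,
      (forall k, <<s @open (initial_topology iota) >> (F k)) /\
      \bigcup_k F k = setT &
      forall k w, F k w ->
        (fun w' => opnorm m var (fun f => L w' f \- L w f))
          @ within (F k) (nbhs (w : initial_topology iota)) --> 0%E ;
  adm_bounded : exists2 K : R, 0 < K & {ae P, forall w, forall f, inB m var f ->
    (Bnorm m var (L w f) <= K%:E * Bnorm m var f)%E} ;
  adm_lasota_yorke : exists N : nat, exists alpha beta : Omega -> R,
    [/\ (0 < N)%N,
        [/\ measurable_fun setT alpha, measurable_fun setT beta,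
            forall w, 0 < alpha w & forall w, 0 < beta w],
        (* the integral of log alpha is well defined in [-oo, +oo[ *)
        (\int[P]_w (Num.max (ln (alpha w)) 0)%:E < +oo)%E,
        (\int[P]_w (ln (alpha w))%:E < 0)%E &
        {ae P, forall w, forall f, inB m var f ->
          (Bnorm m var (cocycle_iter sigma L N w f)
            <= (alpha w)%:E * Bnorm m var f + (beta w)%:E * L1norm m f)%E}] ;
  adm_decay : exists K' lambda : R,
    [/\ 0 < K', 0 < lambda &
        {ae P, forall w, forall (n : nat) f, inB m var f -> cintegral m f = 0 ->
          (Bnorm m var (cocycle_iter sigma L n w f)
            <= (K' * expR (- lambda * n%:R))%:E * Bnorm m var f)%E}] ;
  adm_min_expanding : exists (N : nat) (c : R), [/\ (0 < N)%N, 0 < c &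
    forall a : R, 0 < a -> exists n0 : nat, forall n, (n0 <= n)%N ->
      {ae P, forall w, forall f, inB m var f ->
        {ae m, forall x, 0 <= f x} ->
        (var f <= (a * \int[m]_x complex.Re (f x))%:E)%E ->
        (c%:E * L1norm m f <= ess_inf m (fun x =>
          (complex.Re (cocycle_iter sigma L (N * n) w f x))%:E))%E}] }.

Record equivariant_density (R : realType) dO (Omega : measurableType dO)
    (P : probability Omega R) (sigma : Omega -> Omega)
    dX (X : measurableType dX) (m : probability X R)
    (var : (X -> R[i]) -> \bar R)
    (L : Omega -> (X -> R[i]) -> (X -> R[i])) (v0 : Omega * X -> R) : Prop := {
  density_measurable : measurable_fun setT v0 ;
  density_ge0 : forall z, 0 <= v0 z ;
  density_equivariant : {ae P, forall w,
    [/\ inB m var (fun x => (v0 (w, x))%:C),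
        (\int[m]_x (v0 (w, x))%:E)%E = 1%E &
        cae_eq m (L w (fun x => (v0 (w, x))%:C))
                 (fun x => (v0 (sigma w, x))%:C)]} }.

Definition mu_of (R : realType) dX (X : measurableType dX)
    (m : probability X R) W (v0 : W * X -> R) (w : W) (A : set X) : \bar R :=
  (\int[m]_(x in A) (v0 (w, x))%:E)%E.

Definition mean_of (R : realType) dX (X : measurableType dX)
    (m : probability X R) W (v0 : W * X -> R) (w : W) (f : X -> R) : R :=
  \int[m]_x (f x * v0 (w, x)).

Definition cov_of (R : realType) dX (X : measurableType dX)
    (m : probability X R) W (v0 : W * X -> R) (w : W) (f h : X -> R) : R :=
  mean_of m v0 w (fun x => (f x - mean_of m v0 w f) * (h x - mean_of m v0 w h)).

Record observable (R : realType) dO (Omega : measurableType dO)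
    (P : probability Omega R) dX (X : measurableType dX) (m : probability X R)
    (var : (X -> R[i]) -> \bar R) (v0 : Omega * X -> R)
    (d : nat) (g : Omega * X -> 'rV[R]_d) : Prop := {
  obs_measurable : forall i, measurable_fun setT (fun z => g z ord0 i) ;
  obs_bounded : (ess_sup (P \x m)%E (fun z => `|g z|%:E) < +oo)%E ;
  obs_var : (ess_sup P (fun w => var_vec var (fun x => g (w, x))) < +oo)%E ;
  obs_centered : {ae P, forall w, forall i,
    mean_of m v0 w (fun x => g (w, x) ord0 i) = 0} }.

Definition birkhoff_sum (R : realType) W X (sigma : W -> W) (T : W -> X -> X)
    (d : nat) (g : W * X -> 'rV[R]_d) (n : nat) (w : W) (x : X) : 'rV[R]_d :=
  \sum_(i < n) g (iter i sigma w, cocycle_iter sigma T i w x).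

Definition is_asymptotic_covariance (R : realType) dO (Omega : measurableType dO)
    (P : probability Omega R) (sigma : Omega -> Omega)
    dX (X : measurableType dX) (m : probability X R) (T : Omega -> X -> X)
    (v0 : Omega * X -> R) (d : nat) (g : Omega * X -> 'rV[R]_d)
    (Sigma2 : 'M[R]_d) : Prop :=
  {ae P, forall w, forall i j,
    (fun n : nat => n%:R^-1 *
       cov_of m v0 w (fun x => birkhoff_sum sigma T g n w x ord0 i)
                     (fun x => birkhoff_sum sigma T g n w x ord0 j))
      @ \oo --> Sigma2 i j}.

Definition twisted (R : realType) W X (L : W -> (X -> R[i]) -> (X -> R[i]))
    (d : nat) (g : W * X -> 'rV[R]_d) (theta : 'rV[R[i]]_d)
    (w : W) (f : X -> R[i]) : X -> R[i] :=
  L w (fun x => cexp (dotp theta (rV_complex (g (w, x)))) * f x).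

(* [Lam] may take the value -oo. *)
Definition is_top_lyapunov (R : realType) dO (Omega : measurableType dO)
    (P : probability Omega R) (sigma : Omega -> Omega)
    dX (X : measurableType dX) (m : probability X R)
    (var : (X -> R[i]) -> \bar R)
    (L : Omega -> (X -> R[i]) -> (X -> R[i]))
    (d : nat) (g : Omega * X -> 'rV[R]_d) (Lam : 'rV[R[i]]_d -> \bar R) : Prop :=
  forall theta, {ae P, forall w,
    (fun n : nat => ((n%:R^-1 : R)%:E *
       lne (opnorm m var (cocycle_iter sigma (twisted L g theta) n w)))%E)
      @ \oo --> Lam theta}.

Definition Lam_real (R : realType) (d : nat) (Lam : 'rV[R[i]]_d -> \bar R)
    (t : 'rV[R]_d) : R :=
  fine (Lam (rV_complex t)).

Definition posdef_hessian_ball (R : realType) (d : nat) (Lam : 'rV[R[i]]_d -> \bar R)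
    (r : R) : Prop :=
  (exists U : set 'rV[R]_d,
    [/\ eucl_closed_ball r `<=` U,
        forall t, U t -> Lam (rV_complex t) \is a fin_num &
        C2_on U (Lam_real Lam)]) /\
  forall t, eucl_closed_ball r t -> posdef (hessian (Lam_real Lam) t).

Definition rate (R : realType) (d : nat) (Lam : 'rV[R[i]]_d -> \bar R)
    (r : R) (x : 'rV[R]_d) : \bar R :=
  ereal_sup [set (dotp t x - Lam_real Lam t)%:E | t in eucl_closed_ball r].

(* Main.v *)
Require Import Defs.
From HB Require Import structures.
From mathcomp Require Import all_boot all_order all_algebra.
From mathcomp Require Import finmap complex.
From mathcomp Require Import all_classical all_reals all_analysis.
From mathcomp Require Import ess_sup_inf measurable_realfun.
From mathcomp Require Import ring lra zify.

Set Implicit Arguments.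
Unset Strict Implicit.
Unset Printing Implicit Defensive.

Import Order.TTheory GRing.Theory Num.Theory.
Import numFieldNormedType.Exports.

Local Open Scope classical_set_scope.
Local Open Scope ring_scope.
Local Open Scope complex_scope.

(** The theorem is a Gaertner-Ellis theorem for the quenched measures
    [mu_w = v0 (w, _) m]: large deviation estimates for [S_n / n] on a ball
    follow once, for almost every [w], the moments
    [mgf n t = \int expR (dotp t (S_n x)) d mu_w] grow like
    [expR (n * Lam t)].

    Upper growth ([vmgf_upper]).  By duality the moment is the integral of the
    twisted iterate [L^{t,(n)} v0_w], hence at most a constant times the operator
    norm, whose exponential rate is [Lam t] by definition.

    Lower growth ([opnorm_le_rmgf], [vmgf_lower]).  For small real [t] the
    operator norm is controlled by the moment.  Exponential decay on functions of
    mean zero gives, for one fixed block length [N0], an inequality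
    |L^(N0) f|_B <= |f|_B / 8 + C |f|_1 ([lasota_yorke]), uniform in [w].  The
    twisted operators are positive perturbations of the untwisted ones
    ([multiplier_small], [twisted_perturbation]), so their blocks contract by 1/4
    up to the L1 norm.  By positivity the L1 norm of [L^{t,(n)} f] is at most a
    multiple of [rmgf n t = \int expR (dotp t (S_n x)) dm], and over one block
    [rmgf] loses at most a factor 2, less than the contraction gains.  By induction
    on the blocks the operator norm is at most a multiple of [rmgf].  Finally [mu_w]
    and [m] give comparable moments: the minorization applied to [v0_w] itself
    bounds the density from below at a later time depending on [w]
    ([ae_density_lower]), and the first finitely many summands of [S_n] are
    bounded.

    Both growth statements hold almost surely for all rational [t] at once, and
    extend to real [t] since the moments are Lipschitz in [t] on the exponential
    scale and [Lam] is continuous ([moment_rates]).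

    Given the moments, (i) is Chernoff's bound with a finite cover of a compact set
    by half-spaces ([ldp_upper]).  For (ii), a point [x] which is the gradient of
    [Lam] at some [t0] near 0 is typical for the measure tilted by [t0]
    ([ldp_lower_point]).  Every small [x] is such a gradient ([gradient_onto_ball]):
    centering gives [Lam >= 0 = Lam 0], so the Hessian makes [Lam] positive on a
    small sphere, and [Lam t - dotp t x] is minimised inside it. *)

(** * Row vectors and Euclidean balls *)

Lemma continuous_sumR (R : realType) (T : topologicalType) n (F : 'I_n -> T -> R) :
  (forall i, continuous (F i)) -> continuous (fun y : T => \sum_(i < n) F i y).
Proof.
move=> cF z; elim: n F cF => [|n IH] F cF.
  have -> : (fun y : T => \sum_(i < 0) F i y) = cst 0.
    by apply/funext => y; rewrite big_ord0.
  exact: cst_continuous.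
have -> : (fun y : T => \sum_(i < n.+1) F i y) =
    (fun y => \sum_(i < n) F (widen_ord (leqnSn n) i) y) + F ord_max.
  by apply/funext => y; rewrite big_ord_recr.
by apply: continuousD; [apply: IH => i; exact: cF|exact: cF].
Qed.

Section row_vectors.
Variables (R : realType) (d : nat).
Implicit Types u v x t : 'rV[R]_d.

(** The L1 norm of the parameter pairs with the sup norm of the observable. *)
Definition nrm1 v : R := \sum_(i < d) `|v ord0 i|.

Lemma nrm1_ge0 v : 0 <= nrm1 v.
Proof. by apply: sumr_ge0 => i _. Qed.

Lemma coord_le_norm x i : `|x ord0 i| <= `|x|.
Proof.
rewrite [leRHS]mx_normrE.
by apply: (le_bigmax _ (fun ij => `|x ij.1 ij.2|) (ord0, i)).
Qed.

Lemma norm_le_coord x (e : R) : 0 <= e -> (forall i, `|x ord0 i| <= e) -> `|x| <= e.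
Proof.
move=> e0 xe; rewrite [leLHS]mx_normrE; apply/bigmax_leP; split => // -[i j] _ /=.
by rewrite ord1.
Qed.

Lemma norm_lt_coord x (e : R) : 0 < e -> (forall i, `|x ord0 i| < e) -> `|x| < e.
Proof.
move=> e0 xe; rewrite [ltLHS]mx_normrE; apply/bigmax_ltP; split => // -[i j] _ /=.
by rewrite ord1.
Qed.

Lemma nrm1_le_norm x : nrm1 x <= d%:R * `|x|.
Proof.
apply: (@le_trans _ _ (\sum_(i < d) `|x|)).
  by apply: ler_sum => i _; exact: coord_le_norm.
by rewrite sumr_const card_ord mulr_natl.
Qed.

Lemma dotp_le u v (M : R) : (forall i, `|v ord0 i| <= M) -> `|dotp u v| <= nrm1 u * M.
Proof.
move=> vM; rewrite /dotp /nrm1 mulr_suml (le_trans (ler_norm_sum _ _ _))//.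
by apply: ler_sum => i _; rewrite normrM ler_wpM2l.
Qed.

Lemma dotpDl u v x : dotp (u + v) x = dotp u x + dotp v x.
Proof. by rewrite /dotp -big_split; apply: eq_bigr => i _; rewrite mxE mulrDl. Qed.

Lemma dotpDr u v x : dotp x (u + v) = dotp x u + dotp x v.
Proof. by rewrite /dotp -big_split; apply: eq_bigr => i _; rewrite mxE mulrDr. Qed.

Lemma dotpBl u v x : dotp (u - v) x = dotp u x - dotp v x.
Proof. by rewrite /dotp -sumrB; apply: eq_bigr => i _; rewrite !mxE mulrBl. Qed.

Lemma dotpBr u v x : dotp x (u - v) = dotp x u - dotp x v.
Proof. by rewrite /dotp -sumrB; apply: eq_bigr => i _; rewrite !mxE mulrBr. Qed.

Lemma dotpZl (a : R) u v : dotp (a *: u) v = a * dotp u v.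
Proof. by rewrite /dotp mulr_sumr; apply: eq_bigr => i _; rewrite mxE mulrA. Qed.

Lemma dotpZr (a : R) u v : dotp u (a *: v) = a * dotp u v.
Proof. by rewrite /dotp mulr_sumr; apply: eq_bigr => i _; rewrite mxE mulrCA. Qed.

Lemma dotp0 u : dotp u 0 = 0.
Proof. by rewrite /dotp big1// => i _; rewrite mxE mulr0. Qed.

Lemma dot0p u : dotp 0 u = 0.
Proof. by rewrite /dotp big1// => i _; rewrite mxE mul0r. Qed.

Lemma dotp_delta i u : dotp (delta_mx ord0 i) u = u ord0 i.
Proof.
rewrite /dotp (bigD1 i)//= big1 ?addr0 => [|j ji]; rewrite mxE eqxx/=.
  by rewrite eqxx mul1r.
by rewrite (negbTE ji) mul0r.
Qed.

Lemma dotp_continuousr u : continuous (dotp u : 'rV[R]_d -> R).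
Proof.
apply: continuous_sumR => i.
by move=> x; apply: continuousM; [exact: cst_continuous|exact: coord_continuous].
Qed.

Lemma dotp_continuousl u : continuous ((dotp (K := R) (d := d))^~ u : 'rV[R]_d -> R).
Proof.
apply: continuous_sumR => i.
by move=> x; apply: continuousM; [exact: coord_continuous|exact: cst_continuous].
Qed.

Definition enorm u : R := Num.sqrt (dotp u u).

Lemma enormZ (a : R) u : enorm (a *: u) = `|a| * enorm u.
Proof.
by rewrite /enorm dotpZl dotpZr mulrA -expr2 sqrtrM ?sqr_ge0// sqrtr_sqr.
Qed.

Lemma enorm_ge0 u : 0 <= enorm u. Proof. exact: sqrtr_ge0. Qed.

Lemma coord_le_enorm u i : `|u ord0 i| <= enorm u.
Proof.
rewrite /enorm -sqrtr_sqr ler_wsqrtr// expr2 /dotp (bigD1 i)//= lerDl.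
by apply: sumr_ge0 => j _; rewrite -expr2 sqr_ge0.
Qed.

Lemma enorm_le u (M : R) : 0 <= M -> (forall i, `|u ord0 i| <= M) -> enorm u <= d%:R * M.
Proof.
move=> M0 uM; rewrite -[leRHS]ger0_norm ?mulr_ge0// -sqrtr_sqr ler_wsqrtr//.
apply: (@le_trans _ _ (\sum_(i < d) M ^+ 2)).
  by apply: ler_sum => i _; rewrite -expr2 -real_normK ?num_real// lerXn2r// ?nnegrE.
rewrite sumr_const card_ord -[leLHS]mulr_natl exprMn ler_wpM2r ?sqr_ge0//.
by rewrite -natrX ler_nat; case: (d) => // n; rewrite expnS expn1 leq_pmulr.
Qed.

Lemma enorm_continuous : continuous (enorm : 'rV[R]_d -> R).
Proof.
move=> x; apply: (@continuous_comp _ _ _ (fun u => dotp u u) Num.sqrt).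
  move: x; apply: continuous_sumR => i.
  by move=> x; apply: continuousM; exact: coord_continuous.
exact: sqrt_continuous.
Qed.

Lemma eucl_closed_ball_closed (r : R) : closed (eucl_closed_ball r : set 'rV[R]_d).
Proof.
apply: (@closed_comp _ _ (enorm : 'rV[R]_d -> R) [set y | y <= r]).
  by move=> x _; exact: enorm_continuous.
exact: closed_le.
Qed.

Lemma eucl_closed_ball_compact (r : R) : compact (eucl_closed_ball r : set 'rV[R]_d).
Proof.
apply: bounded_closed_compact; last exact: eucl_closed_ball_closed.
exists `|r|; split; first exact: num_real.
move=> y ry x xr; apply: norm_le_coord => [|i].
  by rewrite (le_trans _ (ltW ry)).
rewrite (le_trans (coord_le_enorm _ _))// (le_trans xr)// (le_trans (ler_norm _))//.
exact: ltW.
Qed.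

End row_vectors.

(** * Directional derivatives of C1 functions *)

Section C1_calculus.
Variables (R : realType) (d : nat).
Implicit Types (f : 'rV[R]_d -> R) (U : set 'rV[R]_d) (p v w : 'rV[R]_d).

Lemma is_derive_line f p v (s : R) : derivable f (s *: v + p) v ->
  is_derive s 1 (fun s => f (s *: v + p)) ('D_v f (s *: v + p)).
Proof.
move=> df.
have E : (fun h : R => h^-1 *: (((fun s => f (s *: v + p)) \o shift s) (h *: 1) -
                           f (s *: v + p))) =
    (fun h => h^-1 *: ((f \o shift (s *: v + p)) (h *: v) - f (s *: v + p))).
  by apply/funext => h /=; rewrite [h%:A]mulr1 scalerDl addrA.
by split; rewrite /derivable /derive E.
Qed.

Lemma partial_MVT f p i (a : R) :
  (forall s : R, `|s| <= `|a| -> derivable f (s *: delta_mx ord0 i + p) (delta_mx ord0 i)) ->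
  exists2 c : R, `|c| <= `|a| &
    f (a *: delta_mx ord0 i + p) - f p = a * partial i f (c *: delta_mx ord0 i + p).
Proof.
move=> df.
pose phi (s : R) := f (s *: delta_mx ord0 i + p).
pose dphi (s : R) := partial i f (s *: delta_mx ord0 i + p).
have D (s : R) : `|s| <= `|a| -> is_derive s 1 phi (dphi s).
  by move=> /df; exact: is_derive_line.
have C (s : R) : `|s| <= `|a| -> {for s, continuous phi}.
  by move=> /D [/derivable1_diffP/differentiable_continuous].
have C' (A : set R) : (forall s, A s -> `|s| <= `|a|) -> {within A, continuous phi}.
  by move=> AA; apply: continuous_in_subspaceT => s /set_mem /AA /C.
have -> : f p = phi 0 by rewrite /phi scale0r add0r.
have [a0|a0] := leP 0 a.
  have [s||c] := @MVT_segment _ phi dphi 0 a a0.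
  - by rewrite in_itv/= => /andP[s0 sa]; apply: D; rewrite !ger0_norm// ltW.
  - apply: C' => s /=; rewrite in_itv/= => /andP[s0 sa].
    by rewrite !ger0_norm.
  - rewrite in_itv/= subr0 mulrC => /andP[c0 ca] E.
    by exists c => //; rewrite !ger0_norm.
have [s||c] := @MVT_segment _ phi dphi a 0 (ltW a0).
- by rewrite in_itv/= => /andP[s0 sa]; apply: D; rewrite !ltr0_norm// lerN2 ltW.
- apply: C' => s /=; rewrite in_itv/= => /andP[s0 sa].
  by rewrite (ltr0_norm a0) ler0_norm// lerN2.
- rewrite in_itv/= sub0r mulrN mulrC => /andP[c0 ca] E.
  exists c; first by rewrite (ltr0_norm a0) ler0_norm// lerN2.
  by rewrite -[RHS]opprK -E opprB.
Qed.

(* The path from 0 to w along the coordinate axes *)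
Let trunc (k : nat) w : 'rV[R]_d := \row_(i < d) if (i < k)%N then w ord0 i else 0.

Let truncS w (k : 'I_d) : trunc k.+1 w = w ord0 k *: delta_mx ord0 k + trunc k w.
Proof.
apply/rowP => i; rewrite !mxE eqxx/= ltnS leq_eqVlt.
have [->|ik] := eqVneq i k; first by rewrite eqxx/= ltnn addr0 mulr1.
by rewrite (_ : (i == k :> nat) = false) ?mulr0 ?add0r//; exact/negbTE.
Qed.

(** Change the coordinates one at a time: each step is governed by the mean value
    theorem along its axis, and the partial derivatives are continuous. *)
Lemma C1_on_increment U f p : C1_on U f -> U p -> forall e : R, 0 < e ->
  exists2 dl : R, 0 < dl & forall w, `|w| < dl ->
    `|f (w + p) - f p - \sum_(i < d) w ord0 i * partial i f p| <= e * nrm1 w.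
Proof.
move=> [oU _ fU] Up e e0.
have nU : \forall q \near p, U q by apply: open_nbhs_nbhs.
have nP : \forall q \near p, forall i : 'I_d, `|partial i f q - partial i f p| <= e.
  apply: (@filter_forall _ _ (fun i q => `|partial i f q - partial i f p| <= e) (nbhs p) (nbhs_filter p)) => i; have [_ cp] := fU i p Up.
  by move/cvgrPdist_le: cp => /(_ e e0); apply: filterS => q; rewrite distrC.
have /nbhs_ballP[dl dl0 B] : nbhs p
    (fun q => U q /\ forall i : 'I_d, `|partial i f q - partial i f p| <= e).
  exact: filterI.
exists dl => // w wdl.
have near k c (kd : (k < d)%N) : `|c| <= `|w ord0 (Ordinal kd)| ->
    ball p dl (c *: delta_mx ord0 (Ordinal kd) + (trunc k w + p)).
  move=> cw; rewrite mx_norm_ball /ball_/= addrA opprD addrCA subrr addr0.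
  rewrite normrN; apply: le_lt_trans wdl; apply: norm_le_coord => // i.
  rewrite !mxE eqxx/=; have [->|ik] := eqVneq i (Ordinal kd).
    by rewrite /= ltnn addr0 mulr1 (le_trans cw)// coord_le_norm.
  by rewrite mulr0 add0r; case: ifP => _; rewrite ?normr0// coord_le_norm.
have E : f (w + p) - f p =
    \sum_(k < d) (f (trunc k.+1 w + p) - f (trunc k w + p)).
  rewrite -(big_mkord xpredT (fun k => f (trunc k.+1 w + p) - f (trunc k w + p))).
  rewrite telescope_sumr//; congr (f (_ + p) - f _).
    by apply/rowP => i; rewrite mxE ltn_ord.
  by apply/rowP => i; rewrite !mxE ltn0 add0r.
rewrite E -sumrB (le_trans (ler_norm_sum _ _ _))// /nrm1 mulr_sumr.
apply: ler_sum => k _; rewrite truncS.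
case: k => k kd /=; rewrite -(addrA (_ *: _)).
have [s sw|c cw ->] := @partial_MVT f (trunc k w + p) (Ordinal kd) (w ord0 (Ordinal kd)).
  have [Us _] := B _ (near _ _ _ sw).
  by have [] := fU (Ordinal kd) _ Us.
have [_ /(_ (Ordinal kd)) H] := B _ (near _ _ _ cw).
by rewrite -mulrBr normrM mulrC ler_wpM2r.
Qed.

(** Continuity of the partial derivatives makes the directional derivative exist
    and depend linearly on the direction. *)
Lemma C1_on_is_derive U f p v : C1_on U f -> U p ->
  is_derive p v f (\sum_(i < d) v ord0 i * partial i f p).
Proof.
move=> fC Up.
suff L : (fun h => h^-1 *: ((f \o shift p) (h *: v) - f p)) @ 0^'
    --> \sum_(i < d) v ord0 i * partial i f p.
  by split; [apply/cvg_ex; eexists; exact: L|exact/cvg_lim].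
apply/cvgrPdist_le => e e0.
have n0 : 0 < nrm1 v + 1 by rewrite ltr_wpDl// nrm1_ge0.
have [dl dl0 H] := C1_on_increment fC Up (divr_gt0 e0 n0).
have vp : 0 < `|v| + 1 by rewrite ltr_wpDl.
apply/nbhs_ballP; exists (dl / (`|v| + 1)) => /=; first exact: divr_gt0.
move=> h; rewrite /ball/= sub0r normrN => hd h0.
have /H : `|h *: v| < dl.
  rewrite normrZ (@le_lt_trans _ _ (`|h| * (`|v| + 1)))//.
    by rewrite ler_wpM2l// lerDl.
  by rewrite -ltr_pdivlMr.
have -> : \sum_(i < d) (h *: v) ord0 i * partial i f p =
    h * \sum_(i < d) v ord0 i * partial i f p.
  by rewrite mulr_sumr; apply: eq_bigr => i _; rewrite mxE mulrA.
have -> : nrm1 (h *: v) = `|h| * nrm1 v.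
  by rewrite /nrm1 mulr_sumr; apply: eq_bigr => i _; rewrite mxE normrM.
set S := \sum_(i < d) _ => le.
rewrite -(ler_pM2l (_ : 0 < `|h|)) ?normr_gt0// -normrM mulrBr.
have -> : h * (h^-1 *: ((f \o shift p) (h *: v) - f p)) = f (h *: v + p) - f p.
  by rewrite /= -[_ *: _]/(_ * _) mulVKf.
rewrite distrC (le_trans le)// mulrCA ler_wpM2l// mulrAC ler_pdivrMr//.
by rewrite ler_pM2l// lerDl.
Qed.

End C1_calculus.
(** * Small vectors are gradients *)

Section gradient_onto.
Variables (R : realType) (d : nat).
Implicit Types (f : 'rV[R]_d -> R) (U : set 'rV[R]_d) (t x : 'rV[R]_d).

(** Along the ray through [t], [f] has a strictly increasing derivative, which
    vanishes at 0 because 0 minimises [f]. *)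
Lemma posdef_hessian_gt0 f U (r : R) t : C2_on U f ->
  eucl_closed_ball r `<=` U ->
  (forall t, eucl_closed_ball r t -> posdef (hessian f t)) ->
  f 0 = 0 -> (forall t, eucl_closed_ball r t -> 0 <= f t) ->
  eucl_closed_ball r t -> t != 0 -> 0 < f t.
Proof.
move=> [fC1 fC2] rU Hpos f0 fge0 rt t0.
have rst s : `|s| <= 1 -> eucl_closed_ball r (s *: t + 0).
  rewrite addr0 => s1; rewrite /eucl_closed_ball/= -/(enorm _) enormZ.
  by rewrite (le_trans _ rt)// ler_piMl// enorm_ge0.
pose phi (s : R) := f (s *: t + 0).
pose psi (s : R) := \sum_(i < d) t ord0 i * partial i f (s *: t + 0).
pose chi (s : R) := (t *m hessian f (s *: t + 0) *m t^T) ord0 ord0.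
have Dphi (s : R) : `|s| <= 1 -> is_derive s 1 phi (psi s).
  move=> s1; have [D E] := C1_on_is_derive t fC1 (rU _ (rst s s1)).
  by have := is_derive_line D; rewrite E.
have Dpsi (s : R) : `|s| <= 1 -> is_derive s 1 psi (chi s).
  move=> s1.
  have -> : psi = \sum_(i < d) (t ord0 i *: (fun s : R => partial i f (s *: t + 0))).
    by apply/funext => u; rewrite fct_sumE.
  have Di i : is_derive s 1 (t ord0 i *: (fun s : R => partial i f (s *: t + 0)))
      (t ord0 i *: \sum_(j < d) t ord0 j * partial j (partial i f) (s *: t + 0)).
    have [D E] := C1_on_is_derive t (fC2 i) (rU _ (rst s s1)).
    by apply: is_deriveZ; have := is_derive_line D; rewrite E.
  have := is_derive_sum Di; congr (is_derive _ _ _ _).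
  rewrite /chi mxE; apply: eq_bigr => i _; rewrite !mxE mulrC; congr (_ * _).
  by apply: eq_bigr => j _; rewrite !mxE.
have chi0 (s : R) : `|s| <= 1 -> 0 < chi s.
  by move=> s1; have [_ /(_ _ t0)] := Hpos _ (rst s s1).
have cont (h dh : R -> R) (b : R) : 0 <= b <= 1 ->
    (forall s : R, `|s| <= 1 -> is_derive s 1 h (dh s)) ->
    {within `[0, b], continuous h}.
  move=> /andP[b0 b1] dH; apply: continuous_in_subspaceT => s.
  move/set_mem; rewrite /= in_itv/= => /andP[s0 sb].
  have /dH : `|s| <= 1 by rewrite ger0_norm// (le_trans sb).
  by move=> [/derivable1_diffP/differentiable_continuous].
have le1 (s b : R) : b <= 1 -> s \in `]0, b[ -> `|s| <= 1.
  move=> b1; rewrite in_itv/= => /andP[s0 sb].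
  by rewrite ger0_norm ?ltW// (lt_le_trans sb).
have psi0 : psi 0 = 0.
  have [] := @derive1_at_min R phi (-1) 1 0.
  - by rewrite (@le_trans _ _ 0).
  - by move=> s; rewrite in_itv/= -ltr_norml => /ltW/Dphi[].
  - by rewrite in_itv/= ltrN10 ltr01.
  - move=> s; rewrite in_itv/= -ltr_norml => /ltW s1.
    by rewrite {1}/phi scale0r addr0 f0 fge0//; exact: rst.
  have [_ ->] // : is_derive (0 : R) 1 phi (psi 0) by apply: Dphi; rewrite normr0.
have psigt0 (s : R) : 0 < s -> s <= 1 -> 0 < psi s.
  move=> s0 s1.
  have [||c cs] := @MVT _ psi chi 0 s s0.
  - by move=> u us; apply: Dpsi; exact: le1 us.
  - by apply: cont Dpsi; rewrite (ltW s0) s1.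
  rewrite psi0 !subr0 => ->; rewrite mulr_gt0// chi0//; exact: le1 cs.
have [||c c1] := @MVT _ phi psi 0 1 ltr01.
- by move=> u us; apply: Dphi; exact: le1 us.
- by apply: cont Dphi; rewrite lexx ler01.
rewrite {2}/phi scale0r addr0 f0 !subr0 mulr1 /phi scale1r addr0 => ->.
by move: c1; rewrite in_itv/= => /andP[? /ltW ?]; apply: psigt0.
Qed.

(** Minimising [f t - dotp t x] over a small ball: on its sphere [f] is bounded
    below by a positive constant, so for small [x] the minimiser is interior and
    the gradient of [f] there is [x]. *)
Lemma gradient_onto_ball f U (r rho : R) : C2_on U f ->
  eucl_closed_ball r `<=` U ->
  (forall t, eucl_closed_ball r t -> posdef (hessian f t)) ->
  f 0 = 0 -> (forall t, eucl_closed_ball r t -> 0 <= f t) ->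
  0 < rho -> rho <= r ->
  exists2 r0 : R, 0 < r0 & forall x, eucl_closed_ball r0 x ->
    exists2 t, enorm t < rho & forall i, partial i f t = x ord0 i.
Proof.
move=> fC2 rU Hpos f0 fge0 rho0 rhor.
have rr t : enorm t <= rho -> eucl_closed_ball r t.
  by move=> tr; exact: le_trans tr rhor.
have fcont t : eucl_closed_ball r t -> {for t, continuous f}.
  by have [[_ cf _] _] := fC2; move=> /rU /cf.
have [c c0 fc] : exists2 c : R, 0 < c & forall t, enorm t = rho -> c <= f t.
  have [ne|] := pselect ([set t : 'rV[R]_d | enorm t = rho] !=set0); last first.
    by move=> e; exists 1 => // t te; exfalso; apply: e; exists t.
  have [||t tS tmin] := compact_EVT_min ne (f := f).
  - apply: (@subclosed_compact _ _ (eucl_closed_ball rho)).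
    + apply: (@closed_comp _ _ (@enorm R d) [set y | y = rho]).
        by move=> x _; exact: enorm_continuous.
      exact: closed_eq.
    + exact: eucl_closed_ball_compact.
    + by move=> t /= te; rewrite /eucl_closed_ball/= -/(enorm t) te.
  - apply: continuous_in_subspaceT => t /set_mem /= te.
    by apply: fcont; apply: rr; rewrite te.
  exists (f t); last by move=> u ue; apply: tmin; rewrite inE.
  move: tS; rewrite inE /= => te.
  apply: (posdef_hessian_gt0 fC2 rU) => //; first by apply: rr; rewrite te.
  apply/eqP => t0; move: te rho0; rewrite t0 /enorm dotp0 sqrtr0 => <-.
  by rewrite ltxx.
pose r0 := c / (2 * (d%:R * rho + 1)).
have D0 : 0 < d%:R * rho + 1 by rewrite ltr_wpDl// mulr_ge0// ltW.
have r00 : 0 < r0 by rewrite divr_gt0// mulr_gt0.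
exists r0 => // x xr0.
pose F t := f t - dotp t x.
have Fcont t : enorm t <= rho -> {for t, continuous F}.
  move=> tr; apply: continuousB; first by apply: fcont; exact: rr.
  exact: dotp_continuousl.
have [|||t0 t0in tmin] := @compact_EVT_min _ _ F (eucl_closed_ball rho).
- by exists 0; rewrite /eucl_closed_ball/= dotp0 sqrtr0 ltW.
- exact: eucl_closed_ball_compact.
- by apply: continuous_in_subspaceT => t /set_mem; exact: Fcont.
move: t0in; rewrite inE => t0in.
have t0rho : enorm t0 < rho.
  rewrite lt_neqAle t0in andbT; apply/eqP => e.
  have /tmin : (0 : 'rV[R]_d) \in eucl_closed_ball rho.
    by rewrite inE /eucl_closed_ball/= dotp0 sqrtr0 ltW.
  rewrite /F f0 dot0p subr0 subr_le0 => h.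
  have h1 := le_trans (fc _ e) h.
  have h2 : `|dotp t0 x| <= nrm1 t0 * r0.
    by apply: dotp_le => i; apply: le_trans xr0; exact: coord_le_enorm.
  have h3 : nrm1 t0 <= d%:R * rho.
    apply: (@le_trans _ _ (\sum_(i < d) rho)).
      by apply: ler_sum => i _; rewrite -e coord_le_enorm.
    by rewrite sumr_const card_ord mulr_natl.
  have h4 : c <= d%:R * rho * r0.
    apply: (le_trans h1); apply: (le_trans (ler_norm _)); apply: (le_trans h2).
    by rewrite ler_wpM2r// ltW.
  suff : d%:R * rho * r0 < c by rewrite ltNge h4.
  apply: (@lt_trans _ _ ((d%:R * rho + 1) * r0)).
    by rewrite ltr_pM2r// ltrDl.
  have -> : (d%:R * rho + 1) * r0 = c / 2.
    by rewrite /r0; field; rewrite gt_eqF.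
  by rewrite ltr_pdivrMr// ltr_pMr// ltr1n.
exists t0 => // i.
have nb : \forall s \near (0 : R), enorm (s *: delta_mx ord0 i + t0) < rho.
  have cs : {for 0, continuous (fun s : R => enorm (s *: delta_mx ord0 i + t0))}.
    apply: (@continuous_comp _ _ _ (fun s : R => s *: delta_mx ord0 i + t0)); last first.
      exact: enorm_continuous.
    by apply: continuousD; [exact: scalel_continuous|exact: cst_continuous].
  apply: (cvgr_lt _ cs); by rewrite scale0r add0r.
have /nbhs_ballP[eta eta0 B] := nb.
have Beta (s : R) : s \in `](- eta), eta[ -> enorm (s *: delta_mx ord0 i + t0) <= rho.
  rewrite in_itv/= -ltr_norml => se; apply/ltW/B.
  by rewrite /ball/= sub0r normrN.
pose phi (s : R) := f (s *: delta_mx ord0 i + t0) - s * x ord0 i.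
have Dphi (s : R) : s \in `](- eta), eta[ ->
    is_derive s 1 phi (partial i f (s *: delta_mx ord0 i + t0) - x ord0 i).
  move=> /Beta /rr /rU Us; apply: is_deriveB.
    by apply: is_derive_line; have [[_ _ /(_ i _ Us)[]]] := fC2.
  have -> : (fun s : R => s * x ord0 i) = (x ord0 i \*: id)%R.
    by apply/funext => u /=; rewrite mulrC.
  have := @is_deriveZ _ _ _ (@id R) (x ord0 i) s 1 1 _.
  by rewrite [_ *: 1]mulr1; apply.
have i0 : 0 \in `](- eta), eta[ by rewrite in_itv/= oppr_lt0 eta0.
have [_ E1] := Dphi 0 i0.
have [] := @derive1_at_min R phi (- eta) eta 0.
- by rewrite (@le_trans _ _ 0) ?oppr_le0 ?ltW.
- by move=> s /Dphi[].
- by [].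
- move=> s sI; have := tmin (s *: delta_mx ord0 i + t0).
  rewrite inE => /(_ (Beta s sI)).
  rewrite /F dotpDl dotpZl dotp_delta opprD addrA -lerBlDr opprK subrK.
  by rewrite /phi scale0r add0r mul0r subr0.
move=> _; rewrite E1 scale0r add0r => /eqP; rewrite subr_eq0 => /eqP.
exact.
Qed.

End gradient_onto.
(** * Exponential growth rates *)

Section ereal_helpers.
Variable R : realType.
Implicit Types (x y : \bar R) (u p : (\bar R)^nat) (a b : R).
Local Open Scope ereal_scope.

Lemma le_ereal_real x y : (forall a, a%:E < x -> a%:E <= y) -> x <= y.
Proof.
move=> H; rewrite leNgt; apply/negP => yx.
case: x yx H => [r| |]; case: y => [s| |] //= sr H.
- by move: sr (H ((s + r) / 2)%R); rewrite !lte_fin lee_fin => sr h; have := h ltac:(lra); lra.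
- by have := H (r - 1)%R; rewrite lte_fin => /(_ ltac:(lra)).
- by have := H (s + 1)%R; rewrite ltry lee_fin => /(_ isT); lra.
- by have := H 0%R; rewrite ltry => /(_ isT).
Qed.

Lemma limn_esup_le u x : (\forall n \near \oo, u n <= x) -> limn_esup u <= x.
Proof.
move=> ux; apply: ge_ereal_inf.
exists (ereal_sup (u @` [set n | u n <= x])); first by exists [set n | u n <= x].
by apply: ge_ereal_sup => _ [n /= un <-].
Qed.

Lemma limn_einf_ge u x : (\forall n \near \oo, x <= u n) -> x <= limn_einf u.
Proof.
move=> xu; rewrite /limn_einf leeNr; apply: limn_esup_le.
by apply: filterS xu => n; rewrite leeN2.
Qed.

(** Subexponential factors are absorbed in an arbitrarily small change of rate. *)
Lemma near_ln_div (C e : R) : (0 < e)%R ->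
  \forall n \near \oo, (ln C <= n%:R * e)%R.
Proof.
move=> e0; near=> n; rewrite -ler_pdivrMr//.
by apply: ltW; near: n; exact: nbhs_infty_gtr.
Unshelve. all: by end_near. Qed.

Lemma growth_esup_le p (C a : R) : (0 < C)%R ->
  (forall e : R, (0 < e)%R ->
     \forall n \near \oo, p n <= (C * expR (n%:R * (a + e)))%:E) ->
  limn_esup (fun n => (n%:R^-1 : R)%:E * lne (p n)) <= a%:E.
Proof.
move=> C0 H; apply/lee_addgt0Pr => e e0.
have e2 : (0 < e / 2)%R by rewrite divr_gt0.
apply: limn_esup_le.
near=> n.
have n0 : (0 < n%:R :> R)%R by rewrite ltr0n; near: n; exact: nbhs_infty_gt.
have pn : p n <= (C * expR (n%:R * (a + e / 2)))%:E by near: n; exact: H.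
have Cn : (ln C <= n%:R * (e / 2))%R by near: n; exact: near_ln_div.
have [p0|p0] := leP (p n) 0.
  by rewrite le0_lneNy// mulrNy gtr0_sg ?invr_gt0// mul1e leNye.
have D0 : (0 < C * expR (n%:R * (a + e / 2)))%R by rewrite mulr_gt0// expR_gt0.
have : lne (p n) <= lne (C * expR (n%:R * (a + e / 2)))%:E.
  by rewrite lee_lne// in_itv/= leey ltW// lte_fin.
rewrite lne_EFin// lnM ?posrE ?expR_gt0// expRK => le.
apply: (@le_trans _ _ ((n%:R^-1)%:E * (ln C + n%:R * (a + e / 2))%:E)).
  by rewrite lee_pmul2l// lte_fin invr_gt0.
rewrite -EFinM -EFinD lee_fin ler_pdivrMl//; lra.
Unshelve. all: by end_near. Qed.

Lemma growth_einf_ge p (a : R) :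
  (forall e : R, (0 < e)%R ->
     \forall n \near \oo, (expR (n%:R * (a - e)))%:E <= p n) ->
  a%:E <= limn_einf (fun n => (n%:R^-1 : R)%:E * lne (p n)).
Proof.
move=> H; apply/lee_subgt0Pr => e e0; apply: limn_einf_ge.
near=> n.
have n0 : (0 < n%:R :> R)%R by rewrite ltr0n; near: n; exact: nbhs_infty_gt.
have pn : (expR (n%:R * (a - e)))%:E <= p n by near: n; exact: H.
have : lne (expR (n%:R * (a - e)))%:E <= lne (p n).
  rewrite lee_lne// in_itv/= leey ?lee_fin ?expR_ge0//.
  by rewrite (le_trans _ pn)// lee_fin expR_ge0.
rewrite lne_EFin ?expR_gt0// expRK => le.
apply: (@le_trans _ _ ((n%:R^-1)%:E * (n%:R * (a - e))%:E)).
  by rewrite -EFinM mulKf// gt_eqF.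
by rewrite lee_pmul2l// lte_fin invr_gt0.
Unshelve. all: by end_near. Qed.

End ereal_helpers.

(** * Rational vectors and Borel measurability *)

Section rational_vectors.
Variables (R : realType) (d : nat).

Definition rat_vec (q : 'rV[rat]_d) : 'rV[R]_d := map_mx ratr q.

Lemma rat_vec_dense (t : 'rV[R]_d) (e : R) : 0 < e ->
  exists q, `|rat_vec q - t| < e.
Proof.
move=> e0.
have H i : exists q : rat, `|ratr q - t ord0 i| < e.
  have [|q] := @rat_in_itvoo R (t ord0 i - e) (t ord0 i + e); first by lra.
  by rewrite in_itv/= => qe; exists q; rewrite ltr_distl.
have [f fe] := choice H.
exists (\row_i f i); apply: norm_lt_coord => // i.
by rewrite !mxE fe.
Qed.

(** Only the coordinates of [Y] are known to be measurable; an open set is the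
    countable union of the rational boxes that it contains. *)
Lemma measurable_open_preimage dX (X : measurableType dX) (Y : X -> 'rV[R]_d)
    (A : set 'rV[R]_d) :
  (forall i, measurable_fun setT (fun x => Y x ord0 i)) -> open A ->
  measurable (Y @^-1` A).
Proof.
move=> mY oA.
pose box (c : 'rV[rat]_d * nat) : set 'rV[R]_d :=
  [set y | forall i, `|y ord0 i - rat_vec c.1 ord0 i| < c.2.+1%:R^-1].
pose F (c : 'rV[rat]_d * nat) : set X :=
  [set x | box c `<=` A /\ box c (Y x)].
have -> : Y @^-1` A = \bigcup_c F c.
  apply/seteqP; split => x /=; last first.
    by move=> [c _ [cA]]; exact: cA.
  move=> Ax.
  have /nbhs_ballP[e /= e0 eA] : nbhs (Y x) A by apply: open_nbhs_nbhs.
  have [k ke] : exists k : nat, (k.+1%:R^-1 : R) < e / 2.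
    have [k _ /(_ k (leqnn k)) H] := near_infty_natSinv_lt (PosNum (divr_gt0 e0 (ltr0n R 2))).
    by exists k.
  have k0 : (0 : R) < k.+1%:R^-1 by rewrite invr_gt0 ltr0n.
  have [q qx] := rat_vec_dense (Y x) k0.
  exists (q, k) => //; split; last first.
    move=> i /=; rewrite -normrN opprB; apply: le_lt_trans qx.
    by have := coord_le_norm (rat_vec q - Y x) i; rewrite !mxE.
  move=> y /= yq; apply: eA; rewrite mx_norm_ball /ball_/=.
  have E : Y x - y = - ((rat_vec q - Y x) + (y - rat_vec q)).
    by apply/rowP => i; rewrite !mxE; ring.
  rewrite E normrN (le_lt_trans (ler_normD _ _))//.
  have : `|y - rat_vec q| < k.+1%:R^-1.
    by apply: norm_lt_coord => // i; have := yq i; rewrite !mxE.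
  by move=> yk; rewrite [e]splitr ltrD// (lt_trans _ ke).
apply: countable_bigcupT_measurable; first exact: countableP.
move=> c; have [cA|cA] := pselect (box c `<=` A); last first.
  by rewrite (_ : F c = set0)//; apply/seteqP; split => // x [].
have -> : F c = Y @^-1` box c by apply/seteqP; split => [x []|x].
have -> : Y @^-1` box c = \bigcap_(i in [set: 'I_d])
    ((fun x => Y x ord0 i) @^-1` ball (rat_vec c.1 ord0 i) (c.2.+1%:R^-1)).
  apply/seteqP; split => x /=.
    by move=> H i _ /=; rewrite /ball/= distrC; exact: H.
  by move=> H i; have := H i I; rewrite /= /ball/= distrC.
apply: fin_bigcap_measurable => // i _.
rewrite -[X in measurable X]setTI; apply: mY => //.
by apply: open_measurable; exact: ball_open.
Qed.

Lemma measurable_closed_preimage dX (X : measurableType dX) (Y : X -> 'rV[R]_d)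
    (A : set 'rV[R]_d) :
  (forall i, measurable_fun setT (fun x => Y x ord0 i)) -> closed A ->
  measurable (Y @^-1` A).
Proof.
move=> mY cA; rewrite -[A]setCK preimage_setC; apply: measurableC.
exact: (measurable_open_preimage mY (closed_openC cA)).
Qed.

End rational_vectors.
(** * Large deviations from exponential moments *)

Section large_deviations.
Variables (R : realType) (dX : measure_display) (X : measurableType dX).
Variables (m : probability X R) (d : nat) (v : X -> R).
Variables (S : nat -> X -> 'rV[R]_d) (M : R).
Hypothesis mv : measurable_fun setT v.
Hypothesis v0 : forall x, 0 <= v x.
Hypothesis mS : forall n i, measurable_fun setT (fun x => S n x ord0 i).
Hypothesis M0 : 0 <= M.
Hypothesis SM : forall n, {ae m, forall x, forall i, `|S n x ord0 i| <= n%:R * M}.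

Lemma measurable_dotp (Y : X -> 'rV[R]_d) (t : 'rV[R]_d) :
  (forall i, measurable_fun setT (fun x => Y x ord0 i)) ->
  measurable_fun setT (fun x => dotp t (Y x)).
Proof.
move=> mY; rewrite /dotp; apply: measurable_sum => i.
by apply: measurable_funM => //; exact: measurable_cst.
Qed.

Lemma measurable_expdotp (Y : X -> 'rV[R]_d) (t : 'rV[R]_d) (c : R) :
  (forall i, measurable_fun setT (fun x => Y x ord0 i)) ->
  measurable_fun setT (fun x => expR (dotp t (Y x) + c)).
Proof.
move=> mY; apply: measurableT_comp => //.
by apply: measurable_funD; [exact: measurable_dotp|exact: measurable_cst].
Qed.

Let mexp n t c : measurable_fun setT (fun x => (expR (dotp t (S n x) + c) * v x)%:E).
Proof. by apply/measurable_EFinP/measurable_funM => //; exact: measurable_expdotp. Qed.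

Let exp0 n t c x : (0 <= (expR (dotp t (S n x) + c) * v x)%:E)%E.
Proof. by rewrite lee_fin mulr_ge0// expR_ge0. Qed.

Definition mgf n t : \bar R := (\int[m]_x (expR (dotp t (S n x)) * v x)%:E)%E.

Definition prob n (A : set 'rV[R]_d) : \bar R :=
  (\int[m]_(x in [set x | A (n%:R^-1 *: S n x)]) (v x)%:E)%E.

Lemma mgf_shift n t c :
  (\int[m]_x (expR (dotp t (S n x) + c) * v x)%:E = (expR c)%:E * mgf n t)%E.
Proof.
rewrite /mgf -ge0_integralZl_EFin ?expR_ge0//.
- by apply: eq_integral => x _; rewrite expRD -EFinM mulrAC mulrC.
- by move=> x _; have := exp0 n t 0 x; rewrite addr0.
- by apply: eq_measurable_fun (mexp n t 0) => x _; rewrite addr0.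
Qed.

Lemma mgf_Lipschitz n t u :
  (mgf n t <= (expR (n%:R * (M * nrm1 (t - u))))%:E * mgf n u)%E.
Proof.
rewrite -mgf_shift; apply: ae_ge0_le_integral => //.
- by move=> x _; have := exp0 n t 0 x; rewrite addr0.
- by apply: eq_measurable_fun (mexp n t 0) => x _; rewrite addr0.
- apply: filterS (SM n) => x Sx _; rewrite lee_fin ler_wpM2r// ler_expR.
  rewrite addrC -lerBlDr.
  have -> : dotp t (S n x) - dotp u (S n x) = dotp (t - u) (S n x).
    by rewrite dotpBl.
  rewrite (le_trans (ler_norm _))// (le_trans (dotp_le _ Sx))//.
  by rewrite mulrC -mulrA.
Qed.

Let mY n i : measurable_fun setT (fun x => (n%:R^-1 *: S n x) ord0 i).
Proof.
under eq_fun do rewrite mxE.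
by apply: measurable_funM => //; exact: measurable_cst.
Qed.

Let measurable_prob_set n A : open A \/ closed A ->
  measurable [set x | A (n%:R^-1 *: S n x)].
Proof.
case=> [oA|cA]; first exact: (measurable_open_preimage (mY n) oA).
exact: (measurable_closed_preimage (mY n) cA).
Qed.

Let prob_indic n A : open A \/ closed A ->
  prob n A = (\int[m]_x (\1_[set x | A (n%:R^-1 *: S n x)] x * v x)%:E)%E.
Proof.
move=> oc; rewrite /prob integral_mkcond; apply: eq_integral => x _.
rewrite patchE indicE; case: ifPn => _; first by rewrite mul1r.
by rewrite mul0r.
Qed.

Let mindic n A : open A \/ closed A ->
  measurable_fun setT (fun x => (\1_[set x | A (n%:R^-1 *: S n x)] x * v x)%:E).
Proof.
move=> oc; apply/measurable_EFinP/measurable_funM => //.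
by apply: measurable_indic; exact: measurable_prob_set.
Qed.

Let indic0 n A x : (0 <= (\1_[set x | A (n%:R^-1 *: S n x)] x * v x)%:E)%E.
Proof. by rewrite lee_fin mulr_ge0. Qed.

(** Chernoff: a compact set is covered by finitely many half-spaces
    [c < dotp t y - Lam t]; the indicator of their union is at most the sum of
    the exponentials of [n (dotp t y - Lam t - c)]. *)
Lemma ldp_upper (Lam : 'rV[R]_d -> R) (B A : set 'rV[R]_d) :
  (forall t, B t -> forall e : R, 0 < e ->
    \forall n \near \oo, (mgf n t <= (expR (n%:R * (Lam t + e)))%:E)%E) ->
  closed A ->
  (limn_esup (fun n : nat => (n%:R^-1 : R)%:E * lne (prob n A)) <=
   - ereal_inf [set ereal_sup [set (dotp t x - Lam t)%:E | t in B] | x in A])%E.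
Proof.
move=> H cA; rewrite leeNr; apply: le_ereal_real => c cI.
rewrite leeNr.
pose K : set 'rV[R]_d := A `&` [set y | `|y| <= M].
have cK : compact K.
  apply: bounded_closed_compact.
    exists M; split; first exact: num_real.
    by move=> z Mz y [_ /= yM]; rewrite (le_trans yM)// ltW.
  apply: closedI => //.
  apply: (@closed_comp _ _ (fun y : 'rV[R]_d => `|y|) [set z | z <= M]).
    by move=> y _; exact: norm_continuous.
  exact: closed_le.
pose G (t : 'rV[R]_d) : set 'rV[R]_d := [set y | c < dotp t y - Lam t].
move: cK; rewrite compact_cover => /(_ 'rV[R]_d B G)[t Bt|y [Ay yM]|D DB KD].
- apply: (@open_comp _ _ (fun y : 'rV[R]_d => dotp t y - Lam t) [set z | c < z]).
    move=> y _; apply: continuousB; last exact: cst_continuous.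
    exact: dotp_continuousr.
  exact: open_gt.
- have : (c%:E < ereal_sup [set (dotp t y - Lam t)%:E | t in B])%E.
    by apply: lt_le_trans cI _; apply: ereal_inf_lbound; exists y.
  by move=> /ereal_sup_gt[_ [t Bt <-]]; rewrite lte_fin => ct; exists t.
have le1 n : (0 < n)%N -> (prob n A <= \sum_(t <- D)
    (expR (- (n%:R * (Lam t + c))))%:E * mgf n t)%E.
  move=> n0; rewrite prob_indic; last by right.
  under eq_bigr do rewrite -mgf_shift.
  rewrite -ge0_integral_sum//; apply: ae_ge0_le_integral => //.
  - by apply: mindic; right.
  - by move=> x _; apply: sume_ge0 => t _.
  - exact: emeasurable_sum.
  apply: filterS (SM n) => x Sx _.
  rewrite indicE; case: (boolP (x \in _)) => [|_]; last first.
    by rewrite mul0r; apply: sume_ge0 => t _.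
  rewrite inE /= => Ax.
  have n0R : 0 < n%:R :> R by rewrite ltr0n.
  have [t /= tD Gt] : cover [set` D] G (n%:R^-1 *: S n x).
    apply: KD; split => //=; apply: norm_le_coord => // i.
    by rewrite mxE normrM (ger0_norm (_ : 0 <= n%:R^-1)) ?invr_ge0// ler_pdivrMl.
  rewrite mul1r (big_rem t)//= -[leLHS]adde0 leeD//; last first.
    by apply: sume_ge0 => u _.
  rewrite lee_fin ler_peMl// -[leLHS]expR0 ler_expR.
  move: Gt; rewrite /G/= dotpZr ltrBrDr mulrC ltr_pdivlMr// => Gt.
  by rewrite subr_ge0 mulrC addrC ltW.
apply: (@growth_esup_le _ _ (size D).+1%:R) => //.
move=> e e0.
have ev : \forall n \near \oo, forall t, t \in D ->
    (mgf n t <= (expR (n%:R * (Lam t + e)))%:E)%E.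
  have fD : finite_set [set` D] by exact: finite_fset.
  have := @filter_bigI _ _ D (fun t => [set n | (mgf n t <= (expR (n%:R * (Lam t + e)))%:E)%E])
     \oo eventually_filter.
  move=> F; have /F : forall t, t \in D ->
      \forall n \near \oo, (mgf n t <= (expR (n%:R * (Lam t + e)))%:E)%E.
    by move=> t tD; apply: H => //; have := DB t tD; rewrite inE.
  by apply: filterS => n nF t tD; exact: nF.
near=> n.
have n0 : (0 < n)%N by near: n; exact: nbhs_infty_gt.
have evn : forall t, t \in D -> (mgf n t <= (expR (n%:R * (Lam t + e)))%:E)%E by near: n.
apply: (le_trans (le1 n n0)).
apply: (@le_trans _ _ (\sum_(t <- D) (expR (n%:R * (- c + e)))%:E)%E).
  rewrite [leLHS]big_seq_cond [leRHS]big_seq_cond; apply: lee_sum => t /andP[tD _].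
  apply: (@le_trans _ _ ((expR (- (n%:R * (Lam t + c))))%:E *
      (expR (n%:R * (Lam t + e)))%:E)%E).
    by apply: lee_wpmul2l; [rewrite lee_fin expR_ge0|exact: evn].
  by rewrite -EFinM -expRD lee_fin ler_expR; lra.
rewrite sumEFin lee_fin big_const_seq count_predT iter_addr_0 -[leLHS]mulr_natl.
by rewrite ler_wpM2r ?expR_ge0// ler_nat.
Unshelve. all: by end_near. Qed.

(** Tilting by [t0], whose gradient is [x0]: off the box of radius [dl] around
    [x0] one of the [2 d] exponentials with [t0 + s e_i], [t0 - s e_i] dominates
    that with [t0], and their integrals are exponentially smaller since the
    derivative of [Lam] at [t0] along [e_i] is the [i]-th coordinate of [x0].  So
    the integral with [t0] is carried by the box. *)
Lemma ldp_lower_point (Lam : 'rV[R]_d -> R) (B A : set 'rV[R]_d) (t0 x0 : 'rV[R]_d) :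
  (forall t, B t -> forall e : R, 0 < e ->
    \forall n \near \oo, (mgf n t <= (expR (n%:R * (Lam t + e)))%:E)%E) ->
  (forall e : R, 0 < e ->
    \forall n \near \oo, ((expR (n%:R * (Lam t0 - e)))%:E <= mgf n t0)%E) ->
  nbhs t0 B ->
  (forall i, derivable Lam t0 (delta_mx ord0 i)) ->
  (forall i, partial i Lam t0 = x0 ord0 i) ->
  open A -> A x0 ->
  ((- (dotp t0 x0 - Lam t0))%:E <=
   limn_einf (fun n : nat => (n%:R^-1 : R)%:E * lne (prob n A)))%E.
Proof.
move=> HU HL BI dLam gLam oA Ax0.
apply: growth_einf_ge => e e0.
(* a box around x0 inside A, on which n (dotp t0 y) is close to n (dotp t0 x0) *)
have [dl dl0 [dlA dle]] : exists2 dl : R, 0 < dl &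
    (forall y : 'rV[R]_d, (forall i, `|y ord0 i - x0 ord0 i| < dl) -> A y) /\
    dl * nrm1 t0 <= e / 4.
  have /nbhs_ballP[e1 /= e10 e1A] : nbhs x0 A by apply: open_nbhs_nbhs.
  have nt : 0 < nrm1 t0 + 1 by rewrite ltr_wpDl// nrm1_ge0.
  exists (Num.min e1 (e / 4 / (nrm1 t0 + 1))).
    by rewrite lt_min e10/= !divr_gt0.
  split.
    move=> y yx; apply: e1A; rewrite mx_norm_ball /ball_/= distrC.
    apply: norm_lt_coord => // i; rewrite !mxE.
    by apply: lt_le_trans (yx i) _; rewrite ge_min lexx.
  apply: (@le_trans _ _ (e / 4 / (nrm1 t0 + 1) * nrm1 t0)).
    by rewrite ler_wpM2r ?nrm1_ge0// ge_min lexx orbT.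
  rewrite mulrAC ler_pdivrMr// ler_pM2l ?divr_gt0//; lra.
pose u (s : R) i : 'rV[R]_d := s *: delta_mx ord0 i + t0.
(* a step s at which the first-order expansion of Lam holds up to s * dl / 2, in all
   coordinate directions and both signs *)
have [s s0 [us Ls]] : exists2 s : R, 0 < s & (forall b i, B (u ((-1) ^+ (b : bool) * s) i)) /\
   forall b i, Lam (u ((-1) ^+ (b : bool) * s) i) <=
     Lam t0 + (-1) ^+ b * s * x0 ord0 i + s * dl / 2.
  have P1 : \forall s \near (0 : R), forall i, B (u s i).
    apply: (@filter_forall _ _ (fun i s => B (u s i)) (nbhs (0 : R))) => i.
    have cu : {for 0, continuous (fun s : R => u s i)}.
      by apply: continuousD; [exact: scalel_continuous|exact: cst_continuous].
    by apply: cu; rewrite /u scale0r add0r.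
  have P2 : \forall s \near (0 : R), forall i, s != 0 ->
      `|s^-1 * (Lam (u s i) - Lam t0) - x0 ord0 i| <= dl / 2.
    apply: (@filter_forall _ _ (fun i (s : R) => s != 0 ->
      `|s^-1 * (Lam (u s i) - Lam t0) - x0 ord0 i| <= dl / 2) (nbhs (0 : R))) => i.
    have := dLam i; rewrite /derivable => /cvgrPdist_le/(_ (dl / 2)).
    rewrite -[lim _]/(partial i Lam t0) gLam => /(_ (divr_gt0 dl0 _)).
    rewrite ltr0n => /(_ isT) /=; rewrite near_withinE /=; apply: filterS => h hh h0.
    by rewrite distrC; exact: hh.
  have [P3 /= P30 P3P] := (@nbhs_ballP _ _ _ _).1 (filterI P1 P2).
  have PP b : ball (0 : R) P3 ((-1) ^+ (b : bool) * (P3 / 2)).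
    rewrite /ball/= sub0r normrN normrMsign ger0_norm; last by rewrite ltW// divr_gt0.
    by rewrite ltr_pdivrMr// ltr_pMr// ltr1n.
  exists (P3 / 2); first exact: divr_gt0.
  split=> b i; have [Q1 Q2] := P3P _ (PP b); first exact: Q1.
  have s0 : (-1) ^+ b * (P3 / 2) != 0 by rewrite mulf_neq0 ?signr_eq0// gt_eqF// divr_gt0.
  have := Q2 i s0; set h := (-1) ^+ b * (P3 / 2) in s0 * => le.
  have ah : `|h| = P3 / 2 by rewrite /h normrMsign ger0_norm// ltW// divr_gt0.
  have : `|h| * `|h^-1 * (Lam (u h i) - Lam t0) - x0 ord0 i| <= `|h| * (dl / 2).
    by rewrite ler_wpM2l.
  rewrite -normrM mulrBr mulVKf// ah => /(le_trans (ler_norm _)); lra.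
pose sg (k : 'I_d * bool) : R := (-1) ^+ k.2 * s.
pose U k := u (sg k) k.1.
pose ck (n : nat) k : R := - (n%:R * (sg k * x0 ord0 k.1 + s * dl)).
have pw n : (0 < n)%N -> (mgf n t0 <=
    (expR (n%:R * (dotp t0 x0 + e / 4)))%:E * prob n A +
    \sum_(k <- index_enum ('I_d * bool)%type) (expR (ck n k))%:E * mgf n (U k))%E.
  move=> n0; have n0R : 0 < n%:R :> R by rewrite ltr0n.
  under eq_bigr do rewrite -mgf_shift.
  rewrite -ge0_integral_sum// prob_indic; last by left.
  rewrite -ge0_integralZl_EFin ?expR_ge0//; last by apply: mindic; left.
  rewrite -ge0_integralD//; last 4 first.
  - by move=> x _; rewrite mule_ge0// lee_fin expR_ge0.
  - by apply: measurable_funeM; apply: mindic; left.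
  - by move=> x _; apply: sume_ge0 => k _.
  - exact: emeasurable_sum.
  have H0 x : (0 <= (expR (n%:R * (dotp t0 x0 + e / 4)))%:E *
      (\1_[set x | A (n%:R^-1 *: S n x)] x * v x)%:E)%E.
    by rewrite mule_ge0// lee_fin expR_ge0.
  apply: ge0_le_integral => //.
  - by move=> x _; have := exp0 n t0 0 x; rewrite addr0.
  - by apply: eq_measurable_fun (mexp n t0 0) => x _; rewrite addr0.
  - apply: emeasurable_funD; first by apply: measurable_funeM; apply: mindic; left.
    exact: emeasurable_sum.
  move=> x _; set y := n%:R^-1 *: S n x.
  have Sy : S n x = n%:R *: y by rewrite /y scalerA divff ?scale1r// gt_eqF.
  have [near|] := pselect (forall i, `|y ord0 i - x0 ord0 i| < dl).
    rewrite -[leLHS]adde0 leeD//; last by apply: sume_ge0 => k _.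
    rewrite indicE mem_set/=; last exact: dlA.
    rewrite mul1r -EFinM lee_fin ler_wpM2r// ler_expR Sy dotpZr ler_wpM2l//.
    rewrite -lerBlDl (le_trans _ dle)//.
    have -> : dotp t0 y - dotp t0 x0 = dotp t0 (y - x0).
      by rewrite dotpBr.
    rewrite (le_trans (ler_norm _))// mulrC; apply: dotp_le => i.
    by apply/ltW; have := near i; rewrite !mxE.
  move=> /existsNP[i /negP]; rewrite -leNgt => far.
  rewrite -[leLHS]add0e leeD//.
  have [b yb] : exists b : bool, dl <= (-1) ^+ b * (y ord0 i - x0 ord0 i).
    have [p|p] := leP 0 (y ord0 i - x0 ord0 i).
      by exists false; rewrite expr0 mul1r -(ger0_norm p).
    by exists true; rewrite expr1 mulN1r -(ltr0_norm p).
  rewrite (big_rem (i, b)) ?mem_index_enum//= -[leLHS]adde0 leeD//; last first.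
    by apply: sume_ge0 => k _.
  rewrite lee_fin ler_wpM2r// ler_expR /U /ck /= /u dotpDl dotpZl dotp_delta.
  have : 0 <= n%:R * (s * ((-1) ^+ b * (y ord0 i - x0 ord0 i) - dl)).
    by rewrite !mulr_ge0// ?(ltW s0)// subr_ge0.
  rewrite Sy !mxE dotpZr /sg /=; lra.
pose ee := Num.min (e / 4) (s * dl / 8).
have ee0 : 0 < ee by rewrite lt_min !divr_gt0// mulr_gt0.
have evU : \forall n \near \oo, forall k,
    (mgf n (U k) <= (expR (n%:R * (Lam (U k) + s * dl / 8)))%:E)%E.
  apply: (@filter_forall _ _ (fun k n =>
    (mgf n (U k) <= (expR (n%:R * (Lam (U k) + s * dl / 8)))%:E)%E) (nbhs \oo)) => k.
  by apply: HU; [exact: us|rewrite divr_gt0// mulr_gt0].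
pose N := size (index_enum ('I_d * bool)%type).
near=> n.
have n0 : (0 < n)%N by near: n; exact: nbhs_infty_gt.
have n0R : 0 < n%:R :> R by rewrite ltr0n.
have evn : forall k, (mgf n (U k) <= (expR (n%:R * (Lam (U k) + s * dl / 8)))%:E)%E.
  by near: n.
have Ln : ((expR (n%:R * (Lam t0 - ee)))%:E <= mgf n t0)%E by near: n; exact: HL.
have Nn : ln (2 * N.+1%:R : R) <= n%:R * (s * dl / 4).
  by near: n; apply: near_ln_div; rewrite divr_gt0// mulr_gt0.
have l2n : ln (2 : R) <= n%:R * (e / 4) by near: n; apply: near_ln_div; rewrite divr_gt0.
have sum_le : (\sum_(k <- index_enum ('I_d * bool)%type) (expR (ck n k))%:E * mgf n (U k)
    <= (expR (n%:R * (Lam t0 - ee)) / 2)%:E)%E.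
  apply: (@le_trans _ _ (\sum_(k <- index_enum ('I_d * bool)%type)
     (expR (n%:R * (Lam t0 - 3 * (s * dl / 8))))%:E)%E).
    apply: lee_sum => k _.
    apply: (@le_trans _ _ ((expR (ck n k))%:E *
        (expR (n%:R * (Lam (U k) + s * dl / 8)))%:E)%E).
      by apply: lee_wpmul2l; rewrite ?lee_fin ?expR_ge0.
    rewrite -EFinM -expRD lee_fin ler_expR /ck.
    have := Ls k.2 k.1; rewrite -/(sg k) -/(U k) => le.
    have : n%:R * Lam (U k) <= n%:R * (Lam t0 + sg k * x0 ord0 k.1 + s * dl / 2).
      by rewrite ler_wpM2l// ltW.
    lra.
  rewrite sumEFin lee_fin big_const_seq count_predT iter_addr_0 -/N.
  rewrite ler_pdivlMr// -[X in X * 2 <= _]mulr_natl.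
  apply: (@le_trans _ _ (expR (ln (2 * N.+1%:R : R)) *
      expR (n%:R * (Lam t0 - 3 * (s * dl / 8))))).
    rewrite lnK ?posrE ?mulr_gt0// mulrAC ler_wpM2r ?expR_ge0//.
    by rewrite mulrC ler_wpM2l// ler_nat.
  rewrite -expRD ler_expR.
  have : n%:R * ee <= n%:R * (s * dl / 8).
    by rewrite ler_wpM2l// /ee ge_min lexx orbT.
  lra.
have := le_trans Ln (pw n n0).
have P0 : (0 <= prob n A)%E by rewrite prob_indic; [exact: integral_ge0|left].
case: (prob n A) P0 => [p| |//]; last by move=> *; rewrite leey.
rewrite lee_fin => p0.
have : ((expR (n%:R * (dotp t0 x0 + e / 4)))%:E * p%:E +
    \sum_(k <- index_enum ('I_d * bool)%type) (expR (ck n k))%:E * mgf n (U k)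
    <= (expR (n%:R * (dotp t0 x0 + e / 4)))%:E * p%:E +
       (expR (n%:R * (Lam t0 - ee)) / 2)%:E)%E.
  exact: leeD.
move=> /[swap] /le_trans /[apply].
rewrite -EFinM -EFinD !lee_fin => le.
have le2 : expR (n%:R * (Lam t0 - ee)) / 2 <= expR (n%:R * (dotp t0 x0 + e / 4)) * p.
  by lra.
rewrite -(ler_pM2l (expR_gt0 (n%:R * (dotp t0 x0 + e / 4)))) (le_trans _ le2)//.
rewrite ler_pdivlMr// -[X in _ * X <= _](@lnK _ 2) ?posrE// -!expRD ler_expR.
have : n%:R * ee <= n%:R * (e / 4) by rewrite ler_wpM2l// /ee ge_min lexx.
have : 0 <= n%:R * e by rewrite mulr_ge0// ltW.
lra.
Unshelve. all: by end_near. Qed.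

End large_deviations.
(** * Densities transported by a nonsingular map *)

Section real_transfer.
Variables (R : realType) (dX : measure_display) (X : measurableType dX).
Variable m : probability X R.
Implicit Types (T : X -> X) (u w phi psi : X -> R).

Definition ess_bdd psi : Prop :=
  measurable_fun setT psi /\ exists b : R, {ae m, forall x, `|psi x| <= b}.

Definition rintegrable u : Prop := m.-integrable setT (fun x => (u x)%:E).

(** The graph of the transfer operator of [T] on real densities, tested against all
    essentially bounded functions.  A relation has the flexibility needed for
    compositions with weights, where [phi] is only determined up to null sets. *)
Definition rtransfer T phi u : Prop :=
  [/\ rintegrable phi, rintegrable u &
      forall psi, ess_bdd psi ->
        \int[m]_x (u x * psi x) = \int[m]_x (phi x * psi (T x))].

Lemma ae_comp T (Q : X -> Prop) : nonsingular m T ->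
  {ae m, forall x, Q x} -> {ae m, forall x, Q (T x)}.
Proof.
move=> [mT nT] [N [mN N0 QN]]; exists (T @^-1` N); split.
- by rewrite -[_ @^-1` _]setTI; exact: mT.
- exact: nT.
- by move=> x /= nQ; apply: QN.
Qed.

Lemma nonsingular_id : nonsingular m (@id X).
Proof. by split=> //; exact: measurable_id. Qed.

Lemma nonsingular_comp T T' : nonsingular m T -> nonsingular m T' ->
  nonsingular m (T' \o T).
Proof.
move=> [mT nT] [mT' nT']; split; first exact: measurableT_comp.
move=> A mA A0; rewrite comp_preimage; apply: nT; last exact: nT'.
by rewrite -[_ @^-1` _]setTI; exact: mT'.
Qed.

Lemma ess_bdd_cst (c : R) : ess_bdd (cst c).
Proof. by split; [exact: measurable_cst|exists `|c|; apply: aeW => x]. Qed.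

Lemma ess_bddM psi w : ess_bdd psi -> ess_bdd w -> ess_bdd (fun x => psi x * w x).
Proof.
move=> [mp [b pb]] [mw [c wc]]; split; first exact: measurable_funM.
exists (b * c); apply: filterS2 pb wc => x pb wc.
by rewrite normrM ler_pM.
Qed.

Lemma ess_bdd_comp T psi : nonsingular m T -> ess_bdd psi -> ess_bdd (psi \o T).
Proof.
move=> nT [mp [b pb]]; split; first by apply: measurableT_comp => //; case: nT.
by exists b; exact: (ae_comp nT pb).
Qed.

Lemma rintegrable_mul phi psi : rintegrable phi -> ess_bdd psi ->
  rintegrable (fun x => phi x * psi x).
Proof.
move=> /integrableP[mphi iphi] [mpsi [b pb]]; apply/integrableP.
have mphi' : measurable_fun setT phi by exact/measurable_EFinP.
split; first by apply/measurable_EFinP; exact: measurable_funM.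
have : (\int[m]_x ((`|b|)%:E * `|(phi x)%:E|) < +oo)%E.
  rewrite ge0_integralZl_EFin//; last by apply/measurable_EFinP/measurableT_comp.
  by rewrite lte_mul_pinfty// ?fin_numE//.
apply: le_lt_trans; apply: ae_ge0_le_integral => //.
- by apply/measurable_EFinP/measurableT_comp => //; exact: measurable_funM.
- by apply/measurable_funeM/measurable_EFinP/measurableT_comp.
- apply: filterS pb => x pb _; rewrite -EFinM lee_fin normrM mulrC ler_wpM2r//.
  exact: le_trans pb (ler_norm _).
Qed.

Lemma rintegrableB phi psi : rintegrable phi -> rintegrable psi ->
  rintegrable (fun x => phi x - psi x).
Proof.
move=> iphi ipsi; rewrite /rintegrable; under eq_fun do rewrite EFinB.
exact: integrableB.
Qed.

Lemma rintegrableD phi psi : rintegrable phi -> rintegrable psi ->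
  rintegrable (fun x => phi x + psi x).
Proof.
move=> iphi ipsi; rewrite /rintegrable; under eq_fun do rewrite EFinD.
exact: integrableD.
Qed.

Lemma rintegrable_bdd psi : ess_bdd psi -> rintegrable psi.
Proof.
move=> bp; have i1 : rintegrable (cst 1).
  by apply: finite_measure_integrable_cst.
have := rintegrable_mul i1 bp; rewrite /rintegrable.
by under eq_fun do rewrite mul1r.
Qed.

Lemma rintegrable_measurable phi : rintegrable phi -> measurable_fun setT phi.
Proof. by move=> /integrableP[/measurable_EFinP]. Qed.

Lemma integral_EFin phi : rintegrable phi ->
  (\int[m]_x (phi x)%:E)%E = (\int[m]_x phi x)%:E.
Proof. by move=> iphi; rewrite /Rintegral fineK//; exact: integrable_fin_num. Qed.

Lemma rintegrable_norm phi : rintegrable phi -> rintegrable (fun x => `|phi x|).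
Proof. exact: integrable_norm. Qed.

(** Testing against the sign of [u].  Since the relation is compatible with
    differences, this contraction gives uniqueness of the transported density, hence
    additivity of the operators up to null sets. *)
Lemma rtransfer_norm T phi u : nonsingular m T -> rtransfer T phi u ->
  \int[m]_x `|u x| <= \int[m]_x `|phi x|.
Proof.
move=> nT [iphi iu tr].
pose psi x : R := if 0 <= u x then 1 else -1.
have mu := rintegrable_measurable iu.
have bp : ess_bdd psi.
  split.
    apply: measurable_fun_ifT; [|exact: measurable_cst|exact: measurable_cst].
    apply: measurable_fun_ler => //; exact: measurable_cst.
  by exists 1; apply: aeW => x; rewrite /psi; case: ifP; rewrite ?normrN normr1.
have -> : \int[m]_x `|u x| = \int[m]_x (u x * psi x).
  apply: eq_Rintegral => x _; rewrite /psi; case: (lerP 0 (u x)) => ux.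
    by rewrite mulr1 ger0_norm.
  by rewrite mulrN1 ltr0_norm.
rewrite tr//.
have iM : rintegrable (fun x => phi x * psi (T x)).
  by apply: rintegrable_mul => //; exact: (ess_bdd_comp nT bp).
apply: le_Rintegral => //; first exact: rintegrable_norm.
move=> x _; rewrite (le_trans (ler_norm _))// normrM /psi.
by case: ifP => _; rewrite ?normrN normr1 mulr1.
Qed.

Lemma rtransferB T phi1 phi2 u1 u2 : nonsingular m T ->
  rtransfer T phi1 u1 -> rtransfer T phi2 u2 ->
  rtransfer T (fun x => phi1 x - phi2 x) (fun x => u1 x - u2 x).
Proof.
move=> nT [i1 j1 t1] [i2 j2 t2]; split; [exact: rintegrableB|exact: rintegrableB|].
move=> psi bp; under eq_Rintegral do rewrite mulrBl.
under [RHS]eq_Rintegral do rewrite mulrBl.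
have bT := ess_bdd_comp nT bp.
rewrite RintegralB//; try exact: rintegrable_mul.
by rewrite RintegralB ?t1 ?t2//; exact: (rintegrable_mul _ bT).
Qed.

Lemma rtransferD T phi1 phi2 u1 u2 : nonsingular m T ->
  rtransfer T phi1 u1 -> rtransfer T phi2 u2 ->
  rtransfer T (fun x => phi1 x + phi2 x) (fun x => u1 x + u2 x).
Proof.
move=> nT [i1 j1 t1] [i2 j2 t2]; split; [exact: rintegrableD|exact: rintegrableD|].
move=> psi bp; under eq_Rintegral do rewrite mulrDl.
under [RHS]eq_Rintegral do rewrite mulrDl.
have bT := ess_bdd_comp nT bp.
rewrite RintegralD//; try exact: rintegrable_mul.
by rewrite RintegralD ?t1 ?t2//; exact: (rintegrable_mul _ bT).
Qed.

Lemma ae_eq_Rintegral phi psi : rintegrable phi -> rintegrable psi ->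
  {ae m, forall x, phi x = psi x} -> \int[m]_x phi x = \int[m]_x psi x.
Proof.
move=> i1 i2 e; rewrite /Rintegral; congr fine; apply: ae_eq_integral => //.
- exact/measurable_EFinP/rintegrable_measurable.
- exact/measurable_EFinP/rintegrable_measurable.
- by apply: filterS e => x /= ->.
Qed.

Lemma ae_le_Rintegral phi psi : rintegrable phi -> rintegrable psi ->
  {ae m, forall x, phi x <= psi x} -> \int[m]_x phi x <= \int[m]_x psi x.
Proof.
move=> i1 i2 le; rewrite -subr_ge0 -RintegralB//.
have i3 := rintegrableB i2 i1.
rewrite (ae_eq_Rintegral i3 (rintegrable_norm i3)).
  by apply: Rintegral_ge0.
by apply: filterS le => x le; rewrite ger0_norm// subr_ge0.
Qed.

Lemma rintegrableZ (a : R) phi : rintegrable phi -> rintegrable (fun x => a * phi x).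
Proof.
move=> /rintegrable_mul /(_ (ess_bdd_cst a)); congr (integrable _ _ _).
by apply/funext => x; rewrite mulrC.
Qed.

Lemma rtransfer_unique T phi1 phi2 u1 u2 : nonsingular m T ->
  rtransfer T phi1 u1 -> rtransfer T phi2 u2 ->
  {ae m, forall x, phi1 x = phi2 x} -> {ae m, forall x, u1 x = u2 x}.
Proof.
move=> nT t1 t2 e; have t := rtransferB nT t1 t2.
have [iphi iu _] := t.
have := rtransfer_norm nT t.
have -> : \int[m]_x `|phi1 x - phi2 x| = 0.
  rewrite (@ae_eq_Rintegral _ (cst 0)).
  - by rewrite Rintegral_cst// mul0r.
  - exact: rintegrable_norm.
  - exact/rintegrable_bdd/ess_bdd_cst.
  - by apply: filterS e => x ->; rewrite subrr normr0.
move=> le0.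
have E : (\int[m]_x `|(u1 x - u2 x)%:E| = 0)%E.
  apply/eqP; rewrite eq_le integral_ge0// andbT.
  by have := integral_EFin (rintegrable_norm iu) => /= ->; rewrite lee_fin.
have /(ae_eq_integral_abs m measurableT) H :
    measurable_fun setT (fun x => (u1 x - u2 x)%:E).
  exact/measurable_EFinP/rintegrable_measurable.
by move/H: E; apply: filterS => x /(_ I) [] /eqP; rewrite subr_eq0 => /eqP.
Qed.

Lemma rtransfer_comp T T' phi u w u' : nonsingular m T -> nonsingular m T' ->
  ess_bdd w -> rtransfer T phi u -> rtransfer T' (fun x => w x * u x) u' ->
  rtransfer (T' \o T) (fun x => w (T x) * phi x) u'.
Proof.
move=> nT nT' bw [i1 j1 t1] [i2 j2 t2]; split => //.
  have := rintegrable_mul i1 (ess_bdd_comp nT bw); rewrite /rintegrable.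
  by under eq_fun do rewrite mulrC.
move=> psi bp; rewrite t2//.
have E : (fun x => w x * u x * psi (T' x)) = (fun x => u x * (w x * psi (T' x))).
  by apply/funext => x; rewrite mulrA (mulrC (w x)).
rewrite E t1; last exact: (ess_bddM bw (ess_bdd_comp nT' bp)).
by apply: eq_Rintegral => x _ /=; rewrite mulrCA mulrA.
Qed.

End real_transfer.

(** * The modulus of a complex number *)

Section modulus.
Variable R : realType.
Implicit Types z w : R[i].

Lemma cabs_norm z : cabs z = complex.Re `|z|.
Proof. by case: z. Qed.

Lemma cabs_ge0 z : 0 <= cabs z. Proof. exact: sqrtr_ge0. Qed.

Lemma cabsD z w : cabs (z + w) <= cabs z + cabs w.
Proof.
have := ler_normD z w; rewrite !cabs_norm; case: `|z + w| => a b; case: `|z| => c d.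
by case: `|w| => e f; rewrite lecE /= => /andP[].
Qed.

Lemma cabsM z w : cabs (z * w) = cabs z * cabs w.
Proof.
have E (y : R[i]) : `|y| = (cabs y)%:C by case: y.
by have := normrM z w; rewrite !E -rmorphM => /= -[].
Qed.

Lemma cabs_real (r : R) : cabs r%:C = `|r|.
Proof. by rewrite /cabs /= expr0n addr0 sqrtr_sqr. Qed.

Lemma Re_le_cabs z : `|complex.Re z| <= cabs z.
Proof. by rewrite -sqrtr_sqr ler_wsqrtr// lerDl sqr_ge0. Qed.

Lemma Im_le_cabs z : `|complex.Im z| <= cabs z.
Proof. by rewrite -sqrtr_sqr ler_wsqrtr// lerDr sqr_ge0. Qed.

Lemma cabs_le_ReIm z : cabs z <= `|complex.Re z| + `|complex.Im z|.
Proof.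
rewrite -[leRHS]ger0_norm ?addr_ge0// -sqrtr_sqr ler_wsqrtr// sqrrD.
by rewrite !real_normK ?num_real// addrAC lerDl mulrn_wge0// mulr_ge0.
Qed.

Lemma complex_ReD z w : complex.Re (z + w) = complex.Re z + complex.Re w.
Proof. by case: z; case: w. Qed.

Lemma complex_ImD z w : complex.Im (z + w) = complex.Im z + complex.Im w.
Proof. by case: z; case: w. Qed.

Lemma complex_Re_scale (r : R) z : complex.Re (r%:C * z) = r * complex.Re z.
Proof. by case: z => a b /=; rewrite mul0r subr0. Qed.

Lemma complex_Im_scale (r : R) z : complex.Im (r%:C * z) = r * complex.Im z.
Proof. by case: z => a b /=; rewrite mul0r addr0. Qed.

Lemma ReIm_eq z w : complex.Re z = complex.Re w -> complex.Im z = complex.Im w -> z = w.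
Proof. by case: z => a b; case: w => c d /= -> ->. Qed.

End modulus.
(** * Functions of bounded variation *)

Section variation_space.
Variables (R : realType) (dX : measure_display) (X : measurableType dX).
Variables (m : probability X R) (d : nat) (var : (X -> R[i]) -> \bar R).
Hypothesis hvar : is_variation m d var.
Implicit Types (f h : X -> R[i]) (w : X -> R).

Lemma L1_rintegrable f : L1 m f ->
  rintegrable m (fun x => complex.Re (f x)) /\ rintegrable m (fun x => complex.Im (f x)).
Proof. by []. Qed.

Lemma L1_cmeasurable f : L1 m f -> cmeasurable f.
Proof. by move=> [/rintegrable_measurable ? /rintegrable_measurable]. Qed.

Lemma cmeasurable_cabs f : cmeasurable f -> measurable_fun setT (fun x => cabs (f x)).
Proof.
move=> [mr mi]; apply: (@measurableT_comp _ _ _ _ _ _ (@Num.sqrt R)).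
  by apply: continuous_measurable_fun; exact: sqrt_continuous.
by apply: measurable_funD; apply: measurable_funX.
Qed.

(** Real-valued versions of the L1 norm, of the variation and of the norm of the
    space; they agree with the extended ones on functions of bounded variation. *)
Definition n1 f : R := \int[m]_x cabs (f x).

Lemma rintegrable_cabs f : L1 m f -> rintegrable m (fun x => cabs (f x)).
Proof.
move=> f1; have [ir ii] := L1_rintegrable f1.
have := rintegrableD (rintegrable_norm ir) (rintegrable_norm ii).
apply: le_integrable => //.
  exact/measurable_EFinP/cmeasurable_cabs/L1_cmeasurable.
move=> x _ /=; rewrite lee_fin ger0_norm ?cabs_ge0// ger0_norm ?addr_ge0//.
exact: cabs_le_ReIm.
Qed.

Lemma L1normE f : L1 m f -> L1norm m f = (n1 f)%:E.
Proof. by move=> f1; rewrite /L1norm integral_EFin//; exact: rintegrable_cabs. Qed.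

Lemma n1_ge0 f : 0 <= n1 f.
Proof. by apply: Rintegral_ge0 => x _; exact: cabs_ge0. Qed.

Lemma n1_le_ReIm f : L1 m f ->
  n1 f <= \int[m]_x `|complex.Re (f x)| + \int[m]_x `|complex.Im (f x)|.
Proof.
move=> f1; have [/rintegrable_norm ir /rintegrable_norm ii] := L1_rintegrable f1.
rewrite -RintegralD//; apply: le_Rintegral => //.
- exact: rintegrable_cabs.
- exact: rintegrableD.
- by move=> x _; exact: cabs_le_ReIm.
Qed.

Lemma Re_integral_le_n1 f : L1 m f -> `|\int[m]_x complex.Re (f x)| <= n1 f.
Proof.
move=> f1; have [ir ii] := L1_rintegrable f1.
apply: le_trans (le_normr_Rintegral measurableT ir) _.
apply: le_Rintegral => //; first exact: rintegrable_norm.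
  exact: rintegrable_cabs.
by move=> x _; exact: Re_le_cabs.
Qed.

Lemma cintegral_le_n1 f : L1 m f -> cabs (cintegral m f) <= 2 * n1 f.
Proof.
move=> f1; have [ir ii] := L1_rintegrable f1.
rewrite (le_trans (cabs_le_ReIm _))//= mulr2n mulrDl mul1r lerD ?Re_integral_le_n1//.
apply: le_trans (le_normr_Rintegral measurableT ii) _.
apply: le_Rintegral => //; first exact: rintegrable_norm.
  exact: rintegrable_cabs.
by move=> x _; exact: Im_le_cabs.
Qed.

Lemma L1D f h : L1 m f -> L1 m h -> L1 m (f \+ h).
Proof.
move=> [fr fi] [hr hi]; split.
  have := rintegrableD fr hr; rewrite /rintegrable.
  by under eq_fun do rewrite -complex_ReD.
have := rintegrableD fi hi; rewrite /rintegrable.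
by under eq_fun do rewrite -complex_ImD.
Qed.

Lemma L1_scale (w : X -> R) f : ess_bdd m w -> L1 m f ->
  L1 m (fun x => (w x)%:C * f x).
Proof.
move=> bw [fr fi]; split.
  have := rintegrable_mul fr bw; congr (integrable _ _ _).
  by apply/funext => x; rewrite complex_Re_scale mulrC.
have := rintegrable_mul fi bw; congr (integrable _ _ _).
by apply/funext => x; rewrite complex_Im_scale mulrC.
Qed.

Lemma L1_cst (c : R[i]) : L1 m (fun _ => c).
Proof. by split; exact: finite_measure_integrable_cst. Qed.

Lemma L1Z (c : R[i]) f : L1 m f -> L1 m (fun x => c * f x).
Proof.
move=> [fr fi]; split.
  have := rintegrableB (rintegrableZ (complex.Re c) fr) (rintegrableZ (complex.Im c) fi).
  by congr (integrable _ _ _); apply/funext => x; case: c => a b; case: (f x).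
have := rintegrableD (rintegrableZ (complex.Re c) fi) (rintegrableZ (complex.Im c) fr).
by congr (integrable _ _ _); apply/funext => x; case: c => a b; case: (f x).
Qed.

Lemma L1B f h : L1 m f -> L1 m h -> L1 m (f \- h).
Proof.
move=> f1 h1; have -> : f \- h = f \+ (fun x => -1 * h x).
  by apply/funext => x /=; rewrite mulN1r.
by apply: L1D => //; exact: L1Z.
Qed.

Lemma n1D f h : L1 m f -> L1 m h -> n1 (f \+ h) <= n1 f + n1 h.
Proof.
move=> f1 h1; rewrite -RintegralD//; try exact: rintegrable_cabs.
apply: le_Rintegral => //; first exact: (rintegrable_cabs (L1D f1 h1)).
  exact: (rintegrableD (rintegrable_cabs f1) (rintegrable_cabs h1)).
by move=> x _; exact: cabsD.
Qed.

Lemma n1_ae f h : L1 m f -> L1 m h -> cae_eq m f h -> n1 f = n1 h.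
Proof.
move=> f1 h1 e; apply: ae_eq_Rintegral; try exact: rintegrable_cabs.
by apply: filterS e => x ->.
Qed.

Definition vr f : R := fine (var f).
Definition bn f : R := n1 f + vr f.

Lemma inB_L1 f : inB m var f -> L1 m f. Proof. by case. Qed.

Lemma varE f : inB m var f -> var f = (vr f)%:E.
Proof.
move=> [f1 fv]; rewrite /vr fineK// ge0_fin_numE//.
exact: (var_ge0 hvar).
Qed.

Lemma vr_ge0 f : inB m var f -> 0 <= vr f.
Proof. by move=> fB; rewrite -lee_fin -varE//; exact: (var_ge0 hvar (inB_L1 fB)). Qed.

Lemma BnormE f : inB m var f -> Bnorm m var f = (bn f)%:E.
Proof. by move=> fB; rewrite /Bnorm varE// L1normE//; case: fB. Qed.

Lemma bn_ge0 f : inB m var f -> 0 <= bn f.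
Proof. by move=> fB; rewrite addr_ge0 ?n1_ge0 ?vr_ge0. Qed.

Lemma inB_Bnorm_le f (c : R) : L1 m f -> (Bnorm m var f <= c%:E)%E ->
  inB m var f /\ bn f <= c.
Proof.
move=> f1 le; have fB : inB m var f.
  split=> //; move: le; rewrite /Bnorm L1normE// => /le_lt_trans /(_ (ltry c)).
  by case: (var f) => //= r _; rewrite ltry.
by split=> //; rewrite -lee_fin -BnormE.
Qed.

Lemma inB_le_var f (c : R) : L1 m f -> (var f <= c%:E)%E ->
  inB m var f /\ vr f <= c.
Proof.
move=> f1 le; have fB : inB m var f by split=> //; exact: le_lt_trans le (ltry c).
by split=> //; rewrite -lee_fin -varE.
Qed.

Lemma inBD f h : inB m var f -> inB m var h ->
  inB m var (f \+ h) /\ bn (f \+ h) <= bn f + bn h.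
Proof.
move=> fB hB; have [f1 _] := fB; have [h1 _] := hB.
have := var_triangle hvar f1 h1; rewrite (varE fB) (varE hB) -EFinD.
move=> /(inB_le_var (L1D f1 h1))[fhB le]; split=> //.
by have := n1D f1 h1; rewrite /bn; lra.
Qed.

Lemma inBZ (c : R[i]) f : inB m var f ->
  inB m var (fun x => c * f x) /\ bn (fun x => c * f x) = cabs c * bn f.
Proof.
move=> fB; have f1 := inB_L1 fB; have := var_scale hvar c f1.
rewrite (varE fB) -EFinM => E; split.
  by split; [exact: L1Z|rewrite E ltry].
rewrite /bn {1}/vr E /= mulrDr; congr (_ + _).
rewrite /n1 -RintegralZl//; last exact: rintegrable_cabs.
by apply: eq_Rintegral => x _; rewrite cabsM.
Qed.

Lemma cabsN1 : cabs (-1 : R[i]) = 1.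
Proof. by rewrite /cabs /= oppr0 expr0n addr0 sqrtr_sqr normrN1. Qed.

Lemma inBN f : inB m var f ->
  inB m var (fun x => -1 * f x) /\ bn (fun x => -1 * f x) = bn f.
Proof. by move=> /(inBZ (-1)); rewrite cabsN1 mul1r. Qed.

Lemma inBB f h : inB m var f -> inB m var h ->
  inB m var (f \- h) /\ bn (f \- h) <= bn f + bn h.
Proof.
move=> fB hB; have -> : f \- h = f \+ (fun x => -1 * h x).
  by apply/funext => x /=; rewrite mulN1r.
by have [hN <-] := inBN hB; exact: inBD.
Qed.

Lemma inB_ae f h : inB m var f -> L1 m h -> cae_eq m f h ->
  inB m var h /\ bn h = bn f.
Proof.
move=> fB h1 e; have f1 := inB_L1 fB.
have ve := var_ae_eq hvar f1 h1 e.
split; first by split => //; rewrite -ve; case: fB.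
by rewrite /bn /vr ve (n1_ae f1 h1 e).
Qed.

Lemma inB_cst (c : R[i]) : inB m var (fun _ => c) /\
  bn (fun _ => c) = cabs c * bn (fun _ => 1).
Proof.
have oneB : inB m var (fun _ => 1) by split; [exact: L1_cst|exact: (var_one hvar)].
by have := inBZ c oneB; under eq_fun do rewrite mulr1.
Qed.

(** The embedding constant into L^infty, chosen once and for all functions *)
Definition CV : R := xget 1 [set C : R | 1 <= C /\ forall h, L1 m h ->
    (Linfnorm m h <= C%:E * (L1norm m h + var h))%E].

Lemma CVP : 1 <= CV /\ forall h, L1 m h ->
  (Linfnorm m h <= CV%:E * (L1norm m h + var h))%E.
Proof.
by rewrite /CV; case: xgetP => [C _ []//|]; have [C C1 H] := var_Linf hvar => /(_ C)[].
Qed.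

Lemma CV_gt0 : 0 < CV. Proof. by have [/(lt_le_trans ltr01)] := CVP. Qed.

Lemma Linfnorm_le f : inB m var f -> (Linfnorm m f <= (CV * bn f)%:E)%E.
Proof.
move=> fB; have [_ /(_ f (inB_L1 fB))] := CVP.
by rewrite -/(Bnorm m var f) BnormE// -EFinM.
Qed.

Lemma inB_bounded f : inB m var f -> {ae m, forall x, cabs (f x) <= CV * bn f}.
Proof.
move=> /Linfnorm_le /ess_supP; apply: filterS => x.
by rewrite lee_fin.
Qed.

Lemma inB_Linf f : inB m var f -> Linf m f.
Proof.
move=> fB; split; first exact: L1_cmeasurable (inB_L1 fB).
by apply: le_lt_trans (Linfnorm_le fB) (ltry _).
Qed.

(** Multiplication by a real weight [w], uniformly small together with its
    variation *)
Lemma inB_weight w f (a b : R) : measurable_fun setT w -> 0 <= a -> 0 <= b ->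
  {ae m, forall x, `|w x| <= a} -> (var (fun x => (w x)%:C) <= b%:E)%E ->
  inB m var f ->
  inB m var (fun x => (w x)%:C * f x) /\
  bn (fun x => (w x)%:C * f x) <= (a + CV * b) * bn f.
Proof.
move=> mw a0 b0 wa wb fB; have f1 := inB_L1 fB.
have bw : ess_bdd m w by split=> //; exists a.
have wL : (Linfnorm m (fun x => (w x)%:C) <= a%:E)%E.
  by apply/ess_supP; apply: filterS wa => x wa; rewrite lee_fin cabs_real.
have wLi : Linf m (fun x => (w x)%:C).
  split; last exact: le_lt_trans wL (ltry a).
  by split => //=; exact: measurable_cst.
have wf1 := L1_scale bw f1.
have /(inB_le_var wf1)[wfB le] : (var (fun x => (w x)%:C * f x)%R <=
    (a * vr f + CV * bn f * b)%:E)%E.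
  apply: le_trans (var_mul hvar wLi (inB_Linf fB)) _.
  rewrite EFinD EFinM EFinM (varE fB); apply: leeD.
    by apply: lee_wpmul2r => //; rewrite lee_fin vr_ge0.
  apply: le_trans (_ : (CV * bn f)%:E * var (fun x => (w x)%:C) <= _)%E.
    apply: lee_wpmul2r; last exact: Linfnorm_le.
    apply: (var_ge0 hvar).
    have := L1_scale bw (L1_cst 1).
    by under eq_fun do rewrite mulr1.
  by apply: lee_wpmul2l => //; rewrite lee_fin mulr_ge0 ?bn_ge0// ltW// CV_gt0.
split=> //.
have : n1 (fun x => (w x)%:C * f x) <= a * n1 f.
  rewrite /n1 -RintegralZl//; last exact: rintegrable_cabs.
  have i1 := rintegrable_cabs wf1.
  have i2 := rintegrableZ a (rintegrable_cabs f1).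
  apply: ae_le_Rintegral => //.
  by apply: filterS wa => x wa; rewrite cabsM cabs_real ler_wpM2r// cabs_ge0.
rewrite /bn; move: le; rewrite /bn; lra.
Qed.

Lemma Bnorm_opnorm_le (A : (X -> R[i]) -> X -> R[i]) f : inB m var f -> bn f <= 1 ->
  (Bnorm m var (A f) <= opnorm m var A)%E.
Proof.
move=> fB f1; apply: ereal_sup_ubound; exists f => //=; split => //.
by rewrite BnormE// lee_fin.
Qed.

End variation_space.
(** * Iterates and Birkhoff sums *)

Section iteration.
Variables (W : Type) (sigma : W -> W).

Lemma cocycle_iter_add (Y : Type) (A : W -> Y -> Y) (k n : nat) w y :
  cocycle_iter sigma A (k + n) w y =
  cocycle_iter sigma A k (iter n sigma w) (cocycle_iter sigma A n w y).
Proof.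
elim: k => [|k IH]; first by rewrite add0n.
by rewrite addSn /= IH iterD.
Qed.

Variables (R : realType) (X : Type) (T : W -> X -> X) (d : nat) (g : W * X -> 'rV[R]_d).

Lemma birkhoff_sum0 w x : birkhoff_sum sigma T g 0 w x = 0.
Proof. exact: big_ord0. Qed.

Lemma birkhoff_sumS n w x : birkhoff_sum sigma T g n.+1 w x =
  birkhoff_sum sigma T g n w x + g (iter n sigma w, cocycle_iter sigma T n w x).
Proof. exact: big_ord_recr. Qed.

Lemma birkhoff_sum_add k n w x : birkhoff_sum sigma T g (k + n) w x =
  birkhoff_sum sigma T g n w x +
  birkhoff_sum sigma T g k (iter n sigma w) (cocycle_iter sigma T n w x).
Proof.
elim: k => [|k IH]; first by rewrite add0n birkhoff_sum0 addr0.
by rewrite addSn !birkhoff_sumS IH addrA iterD cocycle_iter_add.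
Qed.

End iteration.

(** * The twisted transfer cocycle *)

Section transfer_cocycle.
Variables (R : realType) (W : Type) (sigma : W -> W).
Variables (dX : measure_display) (X : measurableType dX) (m : probability X R).
Variables (T : W -> X -> X) (L : W -> (X -> R[i]) -> (X -> R[i])).
Hypothesis hT : forall w, nonsingular m (T w).
Hypothesis hL : forall w, is_transfer m (T w) (L w).
Variables (d : nat) (g : W * X -> 'rV[R]_d).
Hypothesis mg : forall w i, measurable_fun setT (fun x => g (w, x) ord0 i).
Implicit Types (f h : X -> R[i]) (t : 'rV[R]_d).

Local Notation S := (birkhoff_sum sigma T g).
Local Notation Tn := (cocycle_iter sigma T).

Lemma transfer_L1 w f : L1 m f -> L1 m (L w f).
Proof. by move=> /(hL w)[]. Qed.

(** Real test functions separate the real and imaginary parts. *)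
Lemma transfer_rtransfer w f : L1 m f ->
  rtransfer m (T w) (fun x => complex.Re (f x)) (fun x => complex.Re (L w f x)) /\
  rtransfer m (T w) (fun x => complex.Im (f x)) (fun x => complex.Im (L w f x)).
Proof.
move=> f1; have [Lf1 tr] := hL w f1.
have [fr fi] := f1; have [Lr Li] := Lf1.
have key (psi : X -> R) : ess_bdd m psi ->
    \int[m]_x (complex.Re (L w f x) * psi x) =
      \int[m]_x (complex.Re (f x) * psi (T w x)) /\
    \int[m]_x (complex.Im (L w f x) * psi x) =
      \int[m]_x (complex.Im (f x) * psi (T w x)).
  move=> [mpsi [b pb]].
  have /tr : Linf m (fun x => (psi x)%:C).
    split; first by split => //=; exact: measurable_cst.
    apply: (@le_lt_trans _ _ b%:E); last exact: ltry.
    by apply/ess_supP; apply: filterS pb => x pb; rewrite lee_fin cabs_real.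
  move=> [E1 E2].
  have ReE (z : R[i]) (r : R) : complex.Re (z * r%:C) = complex.Re z * r.
    by rewrite mulrC complex_Re_scale mulrC.
  have ImE (z : R[i]) (r : R) : complex.Im (z * r%:C) = complex.Im z * r.
    by rewrite mulrC complex_Im_scale mulrC.
  split.
    transitivity (\int[m]_x complex.Re (L w f x * (psi x)%:C)).
      by apply: eq_Rintegral => x _; rewrite ReE.
    by rewrite E1; apply: eq_Rintegral => x _; rewrite ReE.
  transitivity (\int[m]_x complex.Im (L w f x * (psi x)%:C)).
    by apply: eq_Rintegral => x _; rewrite ImE.
  by rewrite E2; apply: eq_Rintegral => x _; rewrite ImE.
by split; split=> // psi /key[].
Qed.

Lemma transfer_congr w f h : L1 m f -> L1 m h -> cae_eq m f h ->
  cae_eq m (L w f) (L w h).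
Proof.
move=> f1 h1 e.
have [fr fi] := transfer_rtransfer w f1; have [hr hi] := transfer_rtransfer w h1.
have er : {ae m, forall x, complex.Re (f x) = complex.Re (h x)}.
  by apply: filterS e => x ->.
have ei : {ae m, forall x, complex.Im (f x) = complex.Im (h x)}.
  by apply: filterS e => x ->.
have := rtransfer_unique (hT w) fr hr er; have := rtransfer_unique (hT w) fi hi ei.
by apply: filterS2 => x *; exact: ReIm_eq.
Qed.

Lemma transferD w f h : L1 m f -> L1 m h ->
  cae_eq m (L w (f \+ h)) (L w f \+ L w h).
Proof.
move=> f1 h1; have fh1 := L1D f1 h1.
have [fr fi] := transfer_rtransfer w f1; have [hr hi] := transfer_rtransfer w h1.
have [fhr fhi] := transfer_rtransfer w fh1.
have ar : {ae m, forall x, complex.Re ((f \+ h) x) = complex.Re (f x) + complex.Re (h x)}.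
  by apply: aeW => x; rewrite complex_ReD.
have ai : {ae m, forall x, complex.Im ((f \+ h) x) = complex.Im (f x) + complex.Im (h x)}.
  by apply: aeW => x; rewrite complex_ImD.
have := rtransfer_unique (hT w) fhr (rtransferD (hT w) fr hr) ar.
have := rtransfer_unique (hT w) fhi (rtransferD (hT w) fi hi) ai.
by apply: filterS2 => x ei er; apply: ReIm_eq; rewrite ?complex_ReD ?complex_ImD.
Qed.

Lemma transferB w f h : L1 m f -> L1 m h ->
  cae_eq m (L w (f \- h)) (L w f \- L w h).
Proof.
move=> f1 h1; have fh1 := L1B f1 h1.
have := transferD w fh1 h1.
have -> : (f \- h) \+ h = f by apply/funext => x /=; rewrite subrK.
by apply: filterS => x /= ->; rewrite addrK.
Qed.

Lemma cocycle_nonsingular n w : nonsingular m (Tn n w).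
Proof.
elim: n => [|n IH]; first exact: nonsingular_id.
exact: (nonsingular_comp IH (hT (iter n sigma w))).
Qed.

Lemma measurable_birkhoff n w i : measurable_fun setT (fun x => S n w x ord0 i).
Proof.
elim: n => [|n IH].
  under eq_fun do rewrite birkhoff_sum0 mxE; exact: measurable_cst.
under eq_fun do rewrite birkhoff_sumS mxE.
apply: measurable_funD => //.
apply: (@measurableT_comp _ _ _ _ _ _ (fun x => g (iter n sigma w, x) ord0 i)) => //.
by have [] := cocycle_nonsingular n w.
Qed.

Lemma birkhoff_bounded (M : R) w :
  (forall k, {ae m, forall x, forall i, `|g (iter k sigma w, x) ord0 i| <= M}) ->
  forall n, {ae m, forall x, forall i, `|S n w x ord0 i| <= n%:R * M}.
Proof.
move=> gM; elim=> [|n IH].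
  by apply: aeW => x i; rewrite birkhoff_sum0 mxE normr0 mul0r.
have := ae_comp (cocycle_nonsingular n w) (gM n).
move: IH; apply: filterS2 => x Sx gx i.
rewrite birkhoff_sumS mxE (le_trans (ler_normD _ _))// -natr1 mulrDl mul1r.
by rewrite lerD.
Qed.

Lemma ess_bdd_exp (Y : X -> 'rV[R]_d) t (b : R) :
  (forall i, measurable_fun setT (fun x => Y x ord0 i)) ->
  {ae m, forall x, forall i, `|Y x ord0 i| <= b} ->
  ess_bdd m (fun x => expR (dotp t (Y x))).
Proof.
move=> mY Yb; split.
  by apply: measurableT_comp => //; exact: measurable_dotp.
exists (expR (nrm1 t * b)); apply: filterS Yb => x Yb.
rewrite ger0_norm ?expR_ge0// ler_expR (le_trans (ler_norm _))//.
exact: dotp_le.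
Qed.

Lemma ess_bdd_exp_birkhoff (M : R) w :
  (forall k, {ae m, forall x, forall i, `|g (iter k sigma w, x) ord0 i| <= M}) ->
  forall n t, ess_bdd m (fun x => expR (dotp t (S n w x))).
Proof.
move=> gM n t; apply: (ess_bdd_exp t _ (birkhoff_bounded gM n)) => i.
exact: measurable_birkhoff.
Qed.

Variables (M : R) (w : W).
Hypothesis gM : forall k, {ae m, forall x, forall i, `|g (iter k sigma w, x) ord0 i| <= M}.

Lemma twisted_real t w' f : twisted L g (rV_complex t) w' f =
  L w' (fun x => (expR (dotp t (g (w', x))))%:C * f x).
Proof.
rewrite /twisted; congr (L w' _); apply/funext => x; congr (_ * _).
have -> : dotp (rV_complex t) (rV_complex (g (w', x))) = (dotp t (g (w', x)))%:C.
  rewrite /dotp rmorph_sum; apply: eq_bigr => i _.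
  by rewrite !mxE rmorphM.
by rewrite /cexp /= cos0 sin0 mulr1 mulr0.
Qed.

Local Notation Lt t := (cocycle_iter sigma (twisted L g (rV_complex t))).

(** Real twists act separately on the real and imaginary parts, and the weights of
    successive steps multiply to the exponential of the Birkhoff sum. *)
Lemma twisted_rtransfer n t f : L1 m f ->
  [/\ L1 m (Lt t n w f),
      rtransfer m (Tn n w) (fun x => expR (dotp t (S n w x)) * complex.Re (f x))
        (fun x => complex.Re (Lt t n w f x)) &
      rtransfer m (Tn n w) (fun x => expR (dotp t (S n w x)) * complex.Im (f x))
        (fun x => complex.Im (Lt t n w f x))].
Proof.
move=> f1; elim: n => [|n [IH1 IHr IHi]].
  have E (F : X -> R) : (fun x => expR (dotp t (S 0 w x)) * F x) = F.
    by apply/funext => x; rewrite birkhoff_sum0 dotp0 expR0 mul1r.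
  by rewrite !E; have [? ?] := L1_rintegrable f1; split => //=; split.
set wn := fun x => expR (dotp t (g (iter n sigma w, x))).
have bw : ess_bdd m wn by apply: ess_bdd_exp (gM n).
have wf1 := L1_scale bw IH1.
rewrite /= twisted_real; split; first exact: transfer_L1.
- have [+ _] := transfer_rtransfer (iter n sigma w) wf1.
  under eq_fun do rewrite complex_Re_scale.
  move=> /(rtransfer_comp (cocycle_nonsingular n w) (hT _) bw IHr).
  congr (rtransfer _ _ _ _); apply/funext => x.
  by rewrite birkhoff_sumS dotpDr expRD mulrA (mulrC (wn _)).
- have [_] := transfer_rtransfer (iter n sigma w) wf1.
  under eq_fun do rewrite complex_Im_scale.
  move=> /(rtransfer_comp (cocycle_nonsingular n w) (hT _) bw IHi).
  congr (rtransfer _ _ _ _); apply/funext => x.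
  by rewrite birkhoff_sumS dotpDr expRD mulrA (mulrC (wn _)).
Qed.

Lemma rtransfer_integral (T' : X -> X) (phi u : X -> R) : rtransfer m T' phi u ->
  \int[m]_x u x = \int[m]_x phi x.
Proof.
move=> [_ _ /(_ _ (ess_bdd_cst m 1))].
by under eq_Rintegral do rewrite mulr1; under [RHS]eq_Rintegral do rewrite mulr1.
Qed.

(** Exponential moments for the reference measure *)
Definition rmgf n t : R := \int[m]_x expR (dotp t (S n w x)).

Lemma rintegrable_exp n t : rintegrable m (fun x => expR (dotp t (S n w x))).
Proof. by apply: rintegrable_bdd; exact: (ess_bdd_exp_birkhoff gM). Qed.

(** Positivity of the weights: the twisted iterate of a bounded function is dominated
    by that of a constant. *)
Lemma n1_twisted n t f (b : R) : L1 m f -> {ae m, forall x, cabs (f x) <= b} ->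
  n1 m (Lt t n w f) <= 2 * b * rmgf n t.
Proof.
move=> f1 fb; have [Lf1 tr ti] := twisted_rtransfer n t f1.
have nT := cocycle_nonsingular n w.
have key (F : X -> R) (u : X -> R) : {ae m, forall x, `|F x| <= b} ->
    rtransfer m (Tn n w) (fun x => expR (dotp t (S n w x)) * F x) u ->
    \int[m]_x `|u x| <= b * rmgf n t.
  move=> Fb tru; apply: le_trans (rtransfer_norm nT tru) _.
  have [iF _ _] := tru.
  have i2 := rintegrableZ b (rintegrable_exp n t).
  rewrite /rmgf -RintegralZl//; last exact: rintegrable_exp.
  apply: ae_le_Rintegral => //; first exact: rintegrable_norm.
  apply: filterS Fb => x Fb; rewrite normrM ger0_norm ?expR_ge0// mulrC.
  by rewrite ler_wpM2r// expR_ge0.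
apply: le_trans (n1_le_ReIm Lf1) _.
have kr := key _ _ _ tr; have ki := key _ _ _ ti.
have : \int[m]_x `|complex.Re (Lt t n w f x)| <= b * rmgf n t.
  by apply: kr; apply: filterS fb => x; apply: le_trans; exact: Re_le_cabs.
have : \int[m]_x `|complex.Im (Lt t n w f x)| <= b * rmgf n t.
  by apply: ki; apply: filterS fb => x; apply: le_trans; exact: Im_le_cabs.
lra.
Qed.

Lemma rmgf0 t : rmgf 0 t = 1.
Proof.
rewrite /rmgf; under eq_Rintegral do rewrite birkhoff_sum0 dotp0 expR0.
rewrite (Rintegral_cst m measurableT 1) mul1r.
have /(congr1 fine) := @probability_setT _ _ _ m.
exact.
Qed.

(** Each summand of the Birkhoff sum is bounded, so the moment cannot drop by more
    than a fixed factor per step. *)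
Lemma rmgf_step k n t :
  expR (- (k%:R * (nrm1 t * M))) * rmgf n t <= rmgf (k + n) t.
Proof.
elim: k => [|k IH]; first by rewrite mul0r oppr0 expR0 mul1r add0n.
rewrite -natr1 mulrDl mul1r opprD expRD mulrAC.
apply: (@le_trans _ _ (rmgf (k + n) t * expR (- (nrm1 t * M)))).
  by rewrite ler_wpM2r// expR_ge0.
rewrite mulrC /rmgf -RintegralZl//; last exact: rintegrable_exp.
apply: ae_le_Rintegral; first exact: rintegrableZ (rintegrable_exp _ _).
  exact: rintegrable_exp.
have := ae_comp (cocycle_nonsingular (k + n) w) (gM (k + n)).
apply: filterS => x gx; rewrite addSn birkhoff_sumS dotpDr expRD mulrC.
rewrite ler_wpM2l ?expR_ge0// ler_expR.
by have := dotp_le t gx; rewrite ler_norml => /andP[].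
Qed.

Lemma twisted0 : twisted L g (rV_complex 0) = L.
Proof.
apply/funext => w'; apply/funext => f; rewrite twisted_real; congr (L w' _).
by apply/funext => x; rewrite dot0p expR0 mul1r.
Qed.

Lemma cocycle_rtransfer n f : L1 m f ->
  L1 m (cocycle_iter sigma L n w f) /\
  rtransfer m (Tn n w) (fun x => complex.Re (f x))
    (fun x => complex.Re (cocycle_iter sigma L n w f x)).
Proof.
move=> /(twisted_rtransfer n 0); rewrite twisted0 => -[? tr _]; split=> //; move: tr.
by congr (rtransfer _ _ _ _); apply/funext => x; rewrite dot0p expR0 mul1r.
Qed.

Lemma cocycleD n f h : L1 m f -> L1 m h ->
  cae_eq m (cocycle_iter sigma L n w (f \+ h))
    (cocycle_iter sigma L n w f \+ cocycle_iter sigma L n w h).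
Proof.
move=> f1 h1; elim: n => [|n IH] /=; first by apply: aeW.
have [L1f _] := cocycle_rtransfer n f1; have [L1h _] := cocycle_rtransfer n h1.
have [L1fh _] := cocycle_rtransfer n (L1D f1 h1).
have := transfer_congr (iter n sigma w) L1fh (L1D L1f L1h) IH.
have := transferD (iter n sigma w) L1f L1h.
by apply: filterS2 => x -> ->.
Qed.

Variable v0 : W * X -> R.
Hypothesis v0_ge0 : forall z, 0 <= v0 z.
Hypothesis v0_L1 : forall k, L1 m (fun x => (v0 (iter k sigma w, x))%:C).
Hypothesis v0_int : forall k, \int[m]_x v0 (iter k sigma w, x) = 1.
Hypothesis v0_eqv : forall k, cae_eq m
  (L (iter k sigma w) (fun x => (v0 (iter k sigma w, x))%:C))
  (fun x => (v0 (iter k.+1 sigma w, x))%:C).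

Lemma v0_rintegrable k : rintegrable m (fun x => v0 (iter k sigma w, x)).
Proof. by have [] := v0_L1 k. Qed.

Lemma cocycle_density n : cae_eq m
  (cocycle_iter sigma L n w (fun x => (v0 (w, x))%:C))
  (fun x => (v0 (iter n sigma w, x))%:C).
Proof.
elim: n => [|n IH] /=; first by apply: aeW.
have [L1v _] := cocycle_rtransfer n (v0_L1 0).
have := transfer_congr (iter n sigma w) L1v (v0_L1 n) IH.
by move: (v0_eqv n); apply: filterS2 => x -> ->.
Qed.

Lemma density_rtransfer n : rtransfer m (Tn n w) (fun x => v0 (w, x))
  (fun x => v0 (iter n sigma w, x)).
Proof.
have [_ [i1 i2 tr]] := cocycle_rtransfer n (v0_L1 0).
split=> //; first exact: v0_rintegrable.
move=> psi bp; rewrite -(tr _ bp); apply: ae_eq_Rintegral.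
- by apply: rintegrable_mul => //; exact: v0_rintegrable.
- exact: rintegrable_mul.
- by apply: filterS (cocycle_density n) => x ->.
Qed.

(** Exponential moments for the equivariant measure *)
Definition vmgf n t : R := \int[m]_x (expR (dotp t (S n w x)) * v0 (w, x)).

Lemma rintegrable_expv n t :
  rintegrable m (fun x => expR (dotp t (S n w x)) * v0 (w, x)).
Proof.
have := rintegrable_mul (v0_rintegrable 0) (ess_bdd_exp_birkhoff gM n t).
by congr (integrable _ _ _); apply/funext => x; rewrite mulrC.
Qed.

Lemma mgf_vmgf n t : mgf m (fun x => v0 (w, x)) (fun n x => S n w x) n t = (vmgf n t)%:E.
Proof. by rewrite /mgf /vmgf integral_EFin//; exact: rintegrable_expv. Qed.

(** [expR s >= 1 + s], and the Birkhoff sums are centered by equivariance. *)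
Lemma vmgf_ge1 n t :
  (forall k i, \int[m]_x (g (iter k sigma w, x) ord0 i * v0 (iter k sigma w, x)) = 0) ->
  1 <= vmgf n t.
Proof.
move=> g0.
have ess_g k i : ess_bdd m (fun x => g (iter k sigma w, x) ord0 i).
  by split=> //; exists M; apply: filterS (gM k).
have bS k i : ess_bdd m (fun x => S k w x ord0 i).
  split; first exact: measurable_birkhoff.
  by exists (k%:R * M); apply: filterS (birkhoff_bounded gM k).
have S0 k i : \int[m]_x (v0 (w, x) * S k w x ord0 i) = 0.
  elim: k => [|k IH].
    under eq_Rintegral do rewrite birkhoff_sum0 mxE mulr0.
    by rewrite Rintegral_cst// mul0r.
  under eq_Rintegral do rewrite birkhoff_sumS mxE mulrDr.
  rewrite RintegralD//.
  - rewrite IH add0r; have [_ _ /(_ _ (ess_g k i)) <-] := density_rtransfer k.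
    by rewrite -[RHS](g0 k i); apply: eq_Rintegral => x _; rewrite mulrC.
  - by apply: rintegrable_mul => //; exact: v0_rintegrable 0.
  - apply: rintegrable_mul; first exact: v0_rintegrable 0.
    exact: (ess_bdd_comp (cocycle_nonsingular k w) (ess_g k i)).
have iv := v0_rintegrable 0.
have Sdot : (fun x => v0 (w, x) * dotp t (S n w x)) =
    (fun x => \sum_(i < d) t ord0 i * (v0 (w, x) * S n w x ord0 i)).
  apply/funext => x; rewrite /dotp mulr_sumr; apply: eq_bigr => i _.
  by rewrite mulrCA.
have sum0 : forall s : seq 'I_d,
    rintegrable m (fun x => \sum_(i <- s) t ord0 i * (v0 (w, x) * S n w x ord0 i)) /\
    \int[m]_x (\sum_(i <- s) t ord0 i * (v0 (w, x) * S n w x ord0 i)) = 0.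
  elim=> [|i s [IHi IH0]].
    have -> : (fun x => \sum_(i <- [::]) t ord0 i * (v0 (w, x) * S n w x ord0 i)) = cst 0.
      by apply/funext => x; rewrite big_nil.
    split; first exact: rintegrable_bdd (ess_bdd_cst m 0).
    by rewrite Rintegral_cst// mul0r.
  have -> : (fun x => \sum_(i <- i :: s) t ord0 i * (v0 (w, x) * S n w x ord0 i)) =
     (fun x => t ord0 i * (v0 (w, x) * S n w x ord0 i) +
        \sum_(i <- s) t ord0 i * (v0 (w, x) * S n w x ord0 i)).
    by apply/funext => x; rewrite big_cons.
  have iS := rintegrable_mul iv (bS n i).
  split; first exact: rintegrableD (rintegrableZ _ iS) IHi.
  by rewrite RintegralD//; [rewrite IH0 addr0 RintegralZl// S0 mulr0|exact: rintegrableZ].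
have [iS0 iS1] := sum0 (index_enum 'I_d); rewrite -Sdot in iS0 iS1.
have -> : 1 = \int[m]_x (v0 (w, x) + v0 (w, x) * dotp t (S n w x)).
  by rewrite RintegralD// iS1 addr0 (v0_int 0).
apply: le_Rintegral => //; first exact: rintegrableD.
  exact: rintegrable_expv.
by move=> x _; rewrite -[X in X + _]mulr1 -mulrDr mulrC ler_wpM2r// expR_ge1Dx.
Qed.

(** Once the density is bounded below at time [j], the exponential moments of
    [v0_w] dominate those of the reference measure from time [j] on: transport [v0_w]
    to time [j] and bound the first [j] summands. *)
Lemma vmgf_ge_rmgf (c : R) j n t : 0 <= c ->
  {ae m, forall x, c <= v0 (iter j sigma w, x)} ->
  expR (- (j%:R * (nrm1 t * M))) * c *
    \int[m]_x expR (dotp t (S n (iter j sigma w) x)) <= vmgf (n + j) t.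
Proof.
move=> c0 cv.
have bS' : ess_bdd m (fun x => expR (dotp t (S n (iter j sigma w) x))).
  have gMj k : {ae m, forall x, forall i, `|g (iter k sigma (iter j sigma w), x) ord0 i| <= M}.
    by rewrite -iterD; exact: gM.
  exact: (ess_bdd_exp_birkhoff gMj).
have iE := rintegrable_bdd bS'.
have le1 : c * \int[m]_x expR (dotp t (S n (iter j sigma w) x)) <=
    \int[m]_x (v0 (iter j sigma w, x) * expR (dotp t (S n (iter j sigma w) x))).
  rewrite -RintegralZl//; apply: ae_le_Rintegral.
  - exact: rintegrableZ.
  - by apply: rintegrable_mul => //; exact: v0_rintegrable.
  - by apply: filterS cv => x cv; rewrite ler_wpM2r// expR_ge0.
rewrite -mulrA (le_trans (ler_wpM2l (expR_ge0 _) le1))//.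
have [_ _ ->//] := density_rtransfer j.
have bT := ess_bdd_comp (cocycle_nonsingular j w) bS'.
rewrite -RintegralZl//; last by apply: rintegrable_mul => //; exact: v0_rintegrable 0.
apply: ae_le_Rintegral.
- by apply: rintegrableZ; apply: rintegrable_mul => //; exact: v0_rintegrable 0.
- exact: rintegrable_expv.
apply: filterS (birkhoff_bounded gM j) => x Sx.
rewrite birkhoff_sum_add dotpDr expRD /=.
set F := expR (dotp t (S n _ _)); set D := expR (dotp t (S j _ _)).
have -> : D * F * v0 (w, x) = D * (v0 (w, x) * F) by ring.
rewrite ler_wpM2r ?mulr_ge0 ?expR_ge0// ler_expR.
have := dotp_le t Sx; rewrite ler_norml => /andP[+ _].
by rewrite mulrCA.
Qed.

End transfer_cocycle.
(** * The exponential of a linear form *)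

Section exponential_weight.
Variables (R : realType) (d : nat).
Implicit Types (f : 'rV[R]_d -> R) (p t v : 'rV[R]_d).

Lemma is_derive_of_line f p v (l : R) :
  is_derive (0 : R) 1 (fun s : R => f (s *: v + p)) l -> is_derive p v f l.
Proof.
have E : (fun h : R => h^-1 *: (((fun s => f (s *: v + p)) \o shift 0) (h *: 1) -
                           f (0 *: v + p))) =
    (fun h => h^-1 *: ((f \o shift p) (h *: v) - f p)).
  by apply/funext => h /=; rewrite [h%:A]mulr1 addr0 scale0r add0r.
by move=> []; rewrite /derivable /derive E.
Qed.

Lemma is_derive_expdotp t p i :
  is_derive p (delta_mx ord0 i) (fun q => expR (dotp t q) - 1)
    (t ord0 i * expR (dotp t p)).
Proof.
apply: is_derive_of_line.
have -> : (fun s : R => expR (dotp t (s *: delta_mx ord0 i + p)) - 1) =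
    (fun s => expR (dotp t p) * expR (t ord0 i * s) - 1).
  have D : dotp t (delta_mx ord0 i) = t ord0 i.
    by rewrite -[RHS]dotp_delta /dotp; apply: eq_bigr => j _; rewrite mulrC.
  by apply/funext => s; rewrite -expRD dotpDr dotpZr D; congr (expR _ - 1); ring.
apply: is_derive_eq.
by rewrite /GRing.scale /= mulr0 expR0; ring.
Qed.

Lemma partial_expdotp t i : partial i (fun q => expR (dotp t q) - 1) =
  (fun p => t ord0 i * expR (dotp t p)).
Proof. by apply/funext => p; have [_] := is_derive_expdotp t p i. Qed.

Lemma continuous_expdotp t : continuous (fun q : 'rV[R]_d => expR (dotp t q)).
Proof.
move=> q; apply: (@continuous_comp _ _ _ (dotp t) expR).
  exact: dotp_continuousr.
exact: continuous_expR.
Qed.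

Lemma C1_on_expdotp t : C1_on setT (fun q => expR (dotp t q) - 1).
Proof.
split; first exact: openT.
  move=> q _; apply: continuousB; last exact: cst_continuous.
  exact: continuous_expdotp.
move=> i q _; split; first by have [] := is_derive_expdotp t q i.
rewrite partial_expdotp; apply: continuousM; first exact: cst_continuous.
exact: continuous_expdotp.
Qed.

Lemma expR_sub1_le (s a : R) : `|s| <= a -> `|expR s - 1| <= a * expR a.
Proof.
move=> sa; have a0 : 0 <= a := le_trans (normr_ge0 _) sa.
have /andP[s1 s2] : - a <= s <= a by rewrite -ler_norml.
have h1 := expR_ge1Dx s; have h2 := expR_ge1Dx (- s).
have h3 : expR s * expR (- s) = 1 by rewrite -expRD subrr expR0.
have p1 := expR_gt0 s; have p2 := expR_gt0 (- s).
have p3 : expR s <= expR a by rewrite ler_expR.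
have p4 : 1 <= expR a by rewrite -[leLHS]expR0 ler_expR.
have [s0|s0] := leP 0 s.
  rewrite ger0_norm; last by lra.
  have : expR s * (1 - s) <= 1 by rewrite -h3 ler_pM2l//; lra.
  have : s * expR s <= a * expR a by apply: ler_pM => //; apply: ltW.
  lra.
rewrite ltr0_norm; last by rewrite subr_lt0 -[ltRHS]expR0 ltr_expR.
have : a * 1 <= a * expR a by rewrite ler_wpM2l.
lra.
Qed.

End exponential_weight.

(** * Exponential weights of small variation *)

Section weights.
Variables (R : realType) (dX : measure_display) (X : measurableType dX).
Variables (m : probability X R) (d : nat) (var : (X -> R[i]) -> \bar R).
Hypothesis hvar : is_variation m d var.
Variables (M V : R).
Hypotheses (M0 : 0 <= M) (V0 : 0 <= V).

Lemma L1_real (u : X -> R) : ess_bdd m u -> L1 m (fun x => (u x)%:C).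
Proof.
move=> /rintegrable_bdd iu; split=> //.
exact: rintegrable_bdd (ess_bdd_cst m 0).
Qed.

(** The partial derivatives are [t_i expR (dotp t p)], and [dotp t p] is bounded on
    the ball. *)
Lemma Dnorm_expdotp (t p : 'rV[R]_d) (b : R) : enorm p <= b ->
  (Dnorm (fun q => (expR (dotp t q) - 1)%:C) p <= (nrm1 t * expR (nrm1 t * b))%:E)%E.
Proof.
move=> pb; apply: ge_ereal_sup => _ [u /= u1 <-]; rewrite lee_fin.
have -> : \sum_(i < d) u ord0 i * partial i (fun q : 'rV[R]_d => complex.Im (expR (dotp t q) - 1)%:C) p = 0.
  by rewrite big1// => i _; rewrite /partial derive_cst mulr0.
rewrite cabs_real (le_trans (ler_norm_sum _ _ _))// /nrm1 mulr_suml.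
apply: ler_sum => i _; rewrite partial_expdotp normrM normrM.
rewrite -[leRHS]mul1r ler_pM// ler_wpM2l// ger0_norm ?expR_ge0// ler_expR.
rewrite (le_trans (ler_norm _))//; apply: dotp_le => j.
exact: le_trans (coord_le_enorm _ _) pb.
Qed.

(** For small [t] the weight [expR (dotp t Y) - 1] is small both in sup norm and
    in variation, uniformly over observables [Y] with given bounds. *)
Lemma weight_small : exists2 C : R, 0 <= C & forall (t : 'rV[R]_d) (Y : X -> 'rV[R]_d),
  nrm1 t <= 1 -> (forall i, measurable_fun setT (fun x => Y x ord0 i)) ->
  {ae m, forall x, forall i, `|Y x ord0 i| <= M} ->
  (var_vec var Y <= V%:E)%E ->
  {ae m, forall x, `|expR (dotp t (Y x)) - 1| <= C * nrm1 t} /\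
  (var (fun x => (expR (dotp t (Y x)) - 1)%:C) <= (C * nrm1 t)%:E)%E.
Proof.
pose b := d%:R * M + 1.
have b0 : 0 < b by rewrite ltr_wpDl// mulr_ge0.
exists (M * expR M + expR b * V).
  by rewrite addr_ge0// mulr_ge0// expR_ge0.
move=> t Y t1 mY YM YV; have nt0 := nrm1_ge0 t.
split.
  apply: filterS YM => x Yx.
  have := expR_sub1_le (dotp_le t Yx) => /le_trans; apply.
  rewrite mulrC (mulrC _ M) mulrA [leRHS]mulrDl -[leLHS]addr0 lerD//; last first.
    by rewrite !mulr_ge0// expR_ge0.
  rewrite ler_wpM2r// mulrC ler_wpM2l// ler_expR.
  by rewrite -[leRHS]mul1r mulrC ler_wpM2r.
(* The bound on Y holds almost everywhere only; clipping makes it hold everywhere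
   and changes no variation. *)
pose Y' x : 'rV[R]_d := \row_i Num.max (- M) (Num.min M (Y x ord0 i)).
have Y'M x i : `|Y' x ord0 i| <= M.
  rewrite !mxE ler_norml le_max lexx/= ge_max ge_min lexx/= andbT.
  by rewrite (le_trans _ M0)// oppr_le0.
have YY' : {ae m, forall x, Y' x = Y x}.
  apply: filterS YM => x Yx; apply/rowP => i; rewrite !mxE.
  by have := Yx i; rewrite ler_norml => /andP[? ?]; rewrite min_r// max_r.
have mY' i : measurable_fun setT (fun x => Y' x ord0 i).
  under eq_fun do rewrite mxE.
  apply: measurable_maxr; first exact: measurable_cst.
  by apply: measurable_minr => //; exact: measurable_cst.
have bY' i : ess_bdd m (fun x => Y' x ord0 i).
  by split=> //; exists M; apply: aeW => x; exact: Y'M.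
have bY i : ess_bdd m (fun x => Y x ord0 i).
  by split=> //; exists M; apply: filterS YM.
have bE (Z : X -> 'rV[R]_d) : (forall i, measurable_fun setT (fun x => Z x ord0 i)) ->
    {ae m, forall x, forall i, `|Z x ord0 i| <= M} ->
    ess_bdd m (fun x => expR (dotp t (Z x)) - 1).
  move=> mZ ZM; split.
    apply: measurable_funB; last exact: measurable_cst.
    by apply: measurableT_comp => //; exact: measurable_dotp.
  exists (nrm1 t * M * expR (nrm1 t * M)); apply: filterS ZM => x Zx.
  exact: expR_sub1_le (dotp_le t Zx).
have vE : var_vec var Y' = var_vec var Y.
  rewrite /var_vec; apply: eq_bigr => i _.
  apply: (var_ae_eq hvar); [exact: L1_real|exact: L1_real|].
  by apply: filterS YY' => x ->.
have -> : var (fun x => (expR (dotp t (Y x)) - 1)%:C) =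
    var (fun x => (expR (dotp t (Y' x)) - 1)%:C).
  apply: (var_ae_eq hvar).
  - exact/L1_real/bE.
  - by apply/L1_real/bE => //; apply: aeW => x; exact: Y'M.
  - by apply: filterS YY' => x ->.
have v0 : (0 <= var_vec var Y)%E by rewrite /var_vec bigmax_ge_id.
have le : (var (fun x => (expR (dotp t (Y' x)) - 1)%:C)
      <= ereal_sup [set Dnorm (fun q => (expR (dotp t q) - 1)%:C) p | p in eucl_closed_ball b]
         * var_vec var Y')%E.
  apply: (@var_comp _ _ _ _ _ _ hvar b Y' (fun q => (expR (dotp t q) - 1)%:C) setT) => //;
    last 2 first.
  - exact: C1_on_expdotp.
  - split; [exact: openT|by move=> q _; exact: cst_continuous|].
  move=> i q _; split; first exact: derivable_cst.
  have -> : partial i (fun q : 'rV[R]_d => complex.Im (expR (dotp t q) - 1)%:C) = cst 0.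
    by apply/funext => p; rewrite /partial derive_cst.
  exact: cst_continuous.
  - move=> x; rewrite /eucl_closed_ball/= -/(enorm _).
    by rewrite (le_trans (enorm_le M0 (Y'M x)))// lerDl.
apply: (le_trans le); rewrite vE.
apply: (@le_trans _ _ ((nrm1 t * expR b)%:E * var_vec var Y)%E).
  apply: lee_wpmul2r => //; apply: ge_ereal_sup => _ [p pb <-].
  apply: le_trans (Dnorm_expdotp t pb) _; rewrite lee_fin ler_wpM2l// ler_expR.
  by rewrite -[leRHS]mul1r ler_wpM2r// ltW.
apply: (@le_trans _ _ ((nrm1 t * expR b)%:E * V%:E)%E).
  by apply: lee_wpmul2l => //; rewrite lee_fin mulr_ge0// expR_ge0.
rewrite -EFinM lee_fin.
have : 0 <= M * expR M * nrm1 t by rewrite !mulr_ge0// expR_ge0.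
lra.
Qed.

End weights.
(** * Growth of the twisted cocycle *)

(** The induction step of [opnorm_le_rmgf]: [b] and [x] are the norms before and after
    a block, [r] and [r'] the moments, [q] the factor lost by the moment, [n] the L1
    norm before the block. *)
Lemma block_arith (R : realType) (C c q r r' b x y z n : R) :
  0 <= C -> 0 <= c -> 0 <= r -> 1 <= 2 * q -> q * r <= r' ->
  b <= (1 + 8 * C * c) * r -> x <= y + z -> y <= 8^-1 * b ->
  z <= 8^-1 * b + C * n -> n <= 2 * c * r -> x <= (1 + 8 * C * c) * r'.
Proof.
move=> C0 c0 r0 q2 qr br xyz yb zb nr.
have D0 : 0 <= C * c by rewrite mulr_ge0.
have h1 : C * n <= C * (2 * c * r) by rewrite ler_wpM2l.
have h2 : r <= 2 * r'.
  apply: (@le_trans _ _ (2 * (q * r))); last by rewrite ler_wpM2l.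
  by rewrite mulrA -[leLHS]mul1r ler_wpM2r.
have h3 : (1 + 8 * C * c) * r <= (1 + 8 * C * c) * (2 * r').
  by rewrite ler_wpM2l// addr_ge0// -mulrA mulr_ge0.
lra.
Qed.

Section growth.
Variables (R : realType) (W : Type) (sigma : W -> W).
Variables (dX : measure_display) (X : measurableType dX) (m : probability X R).
Variables (d : nat) (var : (X -> R[i]) -> \bar R).
Hypothesis hvar : is_variation m d var.
Variables (T : W -> X -> X) (L : W -> (X -> R[i]) -> (X -> R[i])).
Hypothesis hT : forall w, nonsingular m (T w).
Hypothesis hL : forall w, is_transfer m (T w) (L w).
Variable (g : W * X -> 'rV[R]_d).
Hypothesis mg : forall w i, measurable_fun setT (fun x => g (w, x) ord0 i).
Variables (K M V : R) (N0 : nat).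
Hypotheses (K1 : 1 <= K) (M0 : 0 <= M) (V0 : 0 <= V).
Implicit Types (f h : X -> R[i]) (t : 'rV[R]_d) (w : W).

Local Notation S := (birkhoff_sum sigma T g).
Local Notation Ln := (cocycle_iter sigma L).
Local Notation Lt t := (cocycle_iter sigma (twisted L g (rV_complex t))).
Local Notation bn := (bn m var).
Local Notation n1 := (n1 m).
Local Notation inB := (inB m var).

(** Properties required along the whole orbit, so that they pass to every later base
    point, with constants uniform in the base point. *)
Record regular_point w : Prop := {
  reg_bounded : forall k f, inB f ->
    inB (L (iter k sigma w) f) /\ bn (L (iter k sigma w) f) <= K * bn f ;
  reg_contract : forall k f, inB f -> cintegral m f = 0 ->
    bn (Ln N0 (iter k sigma w) f) <= 8^-1 * bn f ;
  reg_obs : forall k, {ae m, forall x, forall i, `|g (iter k sigma w, x) ord0 i| <= M} ;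
  reg_obs_var : forall k, (var_vec var (fun x => g (iter k sigma w, x)) <= V%:E)%E }.

Lemma regular_iter k w : regular_point w -> regular_point (iter k sigma w).
Proof.
by move=> [h1 h2 h3 h4]; split=> j *; rewrite -?iterD; [apply: h1|apply: h2|apply: h3|apply: h4];
  rewrite ?iterD.
Qed.

Lemma cocycle_inB w n f : regular_point w -> inB f ->
  inB (Ln n w f) /\ bn (Ln n w f) <= K ^+ n * bn f.
Proof.
move=> rw fB; elim: n => [|n [IHB IH]] /=; first by rewrite expr0 mul1r.
have [h1 h2] := reg_bounded rw n IHB; split=> //.
by rewrite (le_trans h2)// exprS -mulrA ler_wpM2l// (le_trans ler01).
Qed.

(** Splitting off the mean: decay on mean-zero functions gives a Lasota-Yorke
    inequality with respect to the L1 norm. *)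
Lemma lasota_yorke : exists2 C : R, 0 <= C & forall w f, regular_point w -> inB f ->
  bn (Ln N0 w f) <= 8^-1 * bn f + C * n1 f.
Proof.
have [oneB _] := inB_cst hvar 1.
have b1 := bn_ge0 hvar oneB.
have KN : 0 <= K ^+ N0 by rewrite exprn_ge0// (le_trans ler01).
exists (2 * (8^-1 + K ^+ N0) * bn (fun _ => 1)).
  by rewrite !mulr_ge0// addr_ge0// invr_ge0.
move=> w f rw fB; have f1 := inB_L1 fB.
pose c := cintegral m f.
have [cB cb] := inB_cst hvar c.
have c1 := inB_L1 cB.
have [fcB fcb] := inBB hvar fB cB.
have c2 : cabs c <= 2 * n1 f := cintegral_le_n1 f1.
have [fr fi] := f1.
have cint0 : cintegral m (f \- (fun _ => c)) = 0.
  have mean (u : X -> R) (a : R) : rintegrable m u -> a = \int[m]_x u x ->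
      \int[m]_x (u x - a) = 0.
    move=> iu ->; rewrite RintegralB//; last by exact: rintegrable_bdd (ess_bdd_cst m _).
    rewrite (Rintegral_cst m measurableT); have /(congr1 fine) /= E := @probability_setT _ _ _ m.
    by rewrite E mulr1 subrr.
  apply: ReIm_eq => /=.
    rewrite -[RHS](mean _ (complex.Re c) fr erefl); apply: eq_Rintegral => x _.
    by case: (f x) => a b; case: (c).
  rewrite -[RHS](mean _ (complex.Im c) fi erefl); apply: eq_Rintegral => x _.
  by case: (f x) => a b; case: (c).
have h1 := reg_contract rw 0 fcB cint0; rewrite /= in h1.
have [LcB h2] := cocycle_inB N0 rw cB.
have [LfcB _] := cocycle_inB N0 rw fcB.
have [sB h3] := inBD hvar LfcB LcB.
have [LfB _] := cocycle_inB N0 rw fB.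
have e := cocycleD hT hL mg (reg_obs rw) N0 (inB_L1 fcB) c1.
have fE : (f \- (fun _ => c)) \+ (fun _ => c) = f.
  by apply/funext => x /=; rewrite subrK.
rewrite fE in e.
have e' : cae_eq m (Ln N0 w (f \- (fun _ => c)) \+ Ln N0 w (fun _ => c)) (Ln N0 w f).
  by apply: filterS e => x ->.
have [_ ->] := inB_ae hvar sB (inB_L1 LfB) e'.
rewrite cb in h2 fcb.
have h5 : cabs c * bn (fun _ => 1) <= 2 * n1 f * bn (fun _ => 1) by rewrite ler_wpM2r.
have : K ^+ N0 * (cabs c * bn (fun _ => 1)) <= K ^+ N0 * (2 * n1 f * bn (fun _ => 1)).
  by rewrite ler_wpM2l.
lra.
Qed.

(** The product rule for the variation turns smallness of the weight in sup norm and
    in variation into smallness as a multiplier. *)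
Lemma multiplier_small : exists2 C : R, 0 <= C & forall w k t f, regular_point w ->
  nrm1 t <= 1 -> inB f ->
  let u x := (expR (dotp t (g (iter k sigma w, x))) - 1)%:C * f x in
  inB u /\ bn u <= C * nrm1 t * bn f.
Proof.
have [C C0 H] := weight_small hvar M0 V0.
have cv := CV_gt0 hvar.
exists (C + CV m var * C); first by rewrite addr_ge0// mulr_ge0// ltW.
move=> w k t f rw t1 fB /=.
have [h1 h2] := H t (fun x => g (iter k sigma w, x)) t1 (mg _) (reg_obs rw k) (reg_obs_var rw k).
have Ct : 0 <= C * nrm1 t by rewrite mulr_ge0// nrm1_ge0.
have [|uB ub] := inB_weight hvar _ Ct Ct h1 h2 fB.
  apply: measurable_funB; last exact: measurable_cst.
  by apply: measurableT_comp => //; exact: measurable_dotp.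
by split=> //; move: ub; rewrite mulrA -mulrDl.
Qed.

(** One twisted step differs from the untwisted one by a small multiplier followed by
    a bounded operator; over [n] steps the errors add up to a constant [E] that
    depends on [n] only. *)
Lemma twisted_perturbation : exists2 C : R, 0 <= C & forall n, exists2 E : R, 0 <= E &
  forall w t f, regular_point w -> nrm1 t <= 1 -> C * nrm1 t <= 1 -> inB f ->
  [/\ inB (Lt t n w f), bn (Lt t n w f) <= (2 * K) ^+ n * bn f &
      bn (Lt t n w f \- Ln n w f) <= E * (C * nrm1 t) * bn f].
Proof.
have [C C0 H] := multiplier_small; exists C => //.
have K0 : 0 <= K := le_trans ler01 K1.
elim=> [|n [E E0 IH]].
  exists 0 => // w t f rw t1 Ct fB; split => //=; first by rewrite expr0 mul1r.
  rewrite !mul0r.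
  have -> : f \- f = (fun _ => 0) by apply/funext => x /=; rewrite subrr.
  have [_ ->] := inB_cst hvar 0.
  by rewrite (_ : cabs 0 = 0) ?mul0r// /cabs /= expr0n addr0 sqrtr0.
exists (K * (E + (2 * K) ^+ n)).
  by rewrite mulr_ge0// addr_ge0// exprn_ge0// mulr_ge0.
move=> w t f rw t1 Ct fB; have [BB Bb Db] := IH w t f rw t1 Ct fB.
set B := Lt t n w f in BB Bb Db *.
have [AB _] := cocycle_inB n rw fB.
set A := Ln n w f in AB Db *.
have [uB ub] := H w n t B rw t1 BB.
set u := (fun x => _) in uB ub.
have [wB wb] := inBD hvar BB uB.
have wE : (fun x => (expR (dotp t (g (iter n sigma w, x))))%:C * B x) = B \+ u.
  apply/funext => x; rewrite /u /=.
  by rewrite rmorphB rmorph1 mulrBl mul1r addrC subrK.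
have LtE : Lt t n.+1 w f = L (iter n sigma w) (B \+ u) by rewrite /= twisted_real wE.
have ALE : Ln n.+1 w f = L (iter n sigma w) A by [].
rewrite LtE ALE.
have [h1 h2] := reg_bounded rw n wB.
have b0 := bn_ge0 hvar BB.
have ub1 : bn u <= bn B.
  by apply: (le_trans ub); rewrite -[leRHS]mul1r ler_wpM2r.
split=> //.
  apply: (le_trans h2); rewrite exprS -mulrA -(mulrA 2) mulrCA ler_wpM2l//.
  lra.
have [dB db] := inBB hvar BB AB.
have [duB dub] := inBD hvar dB uB.
have dE : (B \+ u) \- A = (B \- A) \+ u by apply/funext => x /=; rewrite addrAC.
have e := transferB hT hL (iter n sigma w) (inB_L1 wB) (inB_L1 AB).
rewrite dE in e.
have [k1 k2] := reg_bounded rw n duB.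
have [LB _] := inBB hvar h1 (reg_bounded rw n AB).1.
have [_ ->] := inB_ae hvar k1 (inB_L1 LB) e.
apply: (le_trans k2).
have : K * bn ((B \- A) \+ u) <= K * (E * (C * nrm1 t) * bn f + C * nrm1 t * ((2 * K) ^+ n * bn f)).
  rewrite ler_wpM2l// (le_trans dub)// lerD// (le_trans ub)// ler_wpM2l//.
  by rewrite mulr_ge0// nrm1_ge0.
move=> /le_trans; apply; lra.
Qed.

(** Each block of length [N0] contracts the norm up to a multiple of the L1 norm,
    which is at most a multiple of [rmgf]; and [rmgf] decreases per block at most
    by a factor 2, less than the contraction gains. *)
Lemma opnorm_le_rmgf : exists tau C : R, [/\ 0 < tau, 0 < C &
  forall w t j, regular_point w -> nrm1 t <= tau ->
    (opnorm m var (Lt t (j * N0) w) <=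
      (C * rmgf sigma m T g w (j * N0) t)%:E)%E].
Proof.
have [C7 C70 LY] := lasota_yorke.
have [C6 C60 /(_ N0) [E E0 PT]] := twisted_perturbation.
have cv := CV_gt0 hvar.
have N0R : (0 : R) <= N0%:R by [].
(* The inverse of D is a threshold for nrm1 t below which the perturbation costs at
   most 1/8 per block and a block divides the moment by at most 2. *)
pose D := 1 + C6 + 8 * E * C6 + N0%:R * M / ln 2.
have l2 : 0 < ln 2 :> R by rewrite ln_gt0// ltr1n.
have D1 : 1 <= D.
  have q0 : 0 <= N0%:R * M / ln 2 by rewrite divr_ge0 ?mulr_ge0// ltW.
  have q1 : 0 <= 8 * E * C6 by rewrite !mulr_ge0.
  by rewrite /D; lra.
have D0 : 0 < D by rewrite (lt_le_trans ltr01).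
pose C3 := 1 + 8 * C7 * CV m var.
have C30 : 1 <= C3 by rewrite lerDl !mulr_ge0// ltW.
exists D^-1, C3; split; [by rewrite invr_gt0|by rewrite (lt_le_trans ltr01)|].
move=> w t j rw tt.
have nt0 := nrm1_ge0 t.
have tD : nrm1 t * D <= 1 by rewrite -ler_pdivlMr// mul1r.
have p1 : 0 <= nrm1 t * C6 by rewrite mulr_ge0.
have p2 : 0 <= nrm1 t * (8 * E * C6) by rewrite !mulr_ge0.
have p3 : 0 <= nrm1 t * (N0%:R * M / ln 2).
  by rewrite !mulr_ge0// invr_ge0 ltW.
have tD' : nrm1 t + nrm1 t * C6 + nrm1 t * (8 * E * C6) + nrm1 t * (N0%:R * M / ln 2) <= 1.
  by move: tD; rewrite /D !mulrDr mulr1.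
have t1 : nrm1 t <= 1 by lra.
have tC6 : C6 * nrm1 t <= 1 by lra.
have tE : E * (C6 * nrm1 t) <= 8^-1 by lra.
have tq : N0%:R * (nrm1 t * M) <= ln 2.
  have : nrm1 t * (N0%:R * M / ln 2) <= 1 by lra.
  by rewrite mulrA ler_pdivrMr// mul1r mulrCA.
have half : 1 <= 2 * expR (- (N0%:R * (nrm1 t * M))).
  rewrite -[X in X * _](@lnK _ 2) ?posrE// -expRD -[leLHS]expR0 ler_expR; lra.
apply: ge_ereal_sup => _ [f /= [fB f1] <-].
rewrite (BnormE hvar fB) lee_fin in f1.
have rmgf0' n : 0 <= rmgf sigma m T g w n t.
  by apply: Rintegral_ge0 => x _; exact: expR_ge0.
suff [LB Lb] : inB (Lt t (j * N0) w f) /\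
    bn (Lt t (j * N0) w f) <= C3 * rmgf sigma m T g w (j * N0) t.
  by rewrite (BnormE hvar LB) lee_fin.
elim: j => [|j [IHB IH]].
  by rewrite mul0n /= (rmgf0 sigma m T g w t) mulr1; split => //; exact: le_trans f1 C30.
rewrite mulSn cocycle_iter_add.
set B := Lt t (j * N0) w f in IHB IH *.
have rj := regular_iter (j * N0) rw.
have [LB _ P] := PT _ t B rj t1 tC6 IHB.
split; first exact: LB.
have [AB _] := cocycle_inB N0 rj IHB.
have [dB _] := inBB hvar LB AB.
have [_ tri] := inBD hvar dB AB.
have tE2 : (Lt t N0 (iter (j * N0) sigma w) B \- Ln N0 (iter (j * N0) sigma w) B) \+
    Ln N0 (iter (j * N0) sigma w) B = Lt t N0 (iter (j * N0) sigma w) B.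
  by apply/funext => x /=; rewrite subrK.
rewrite tE2 in tri.
have ly := LY _ _ rj IHB.
have bB := bn_ge0 hvar IHB.
have P' : E * (C6 * nrm1 t) * bn B <= 8^-1 * bn B by rewrite ler_wpM2r.
have nB : n1 B <= 2 * CV m var * rmgf sigma m T g w (j * N0) t.
  have fb : {ae m, forall x, cabs (f x) <= CV m var}.
    apply: filterS (inB_bounded hvar fB) => x /le_trans; apply.
    by rewrite -[leRHS]mulr1 ler_wpM2l// ltW.
  exact: (n1_twisted hT hL mg (reg_obs rw) (j * N0) t (inB_L1 fB) fb).
have st := rmgf_step hT mg (reg_obs rw) N0 (j * N0) t.
exact: (block_arith C70 (ltW cv) (rmgf0' (j * N0)%N) half st IH tri (le_trans P P') ly nB).
Qed.

End growth.
(** * Lyapunov exponents and exponential moments *)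

Section exponential_rate.
Variable R : realType.
Implicit Types (p : (\bar R)^nat) (l e : R).

Lemma log_rate_bounds p l :
  (fun n : nat => ((n%:R^-1 : R)%:E * lne (p n))%E) @ \oo --> l%:E ->
  forall e, 0 < e -> \forall n \near \oo,
    ((expR (n%:R * (l - e)))%:E <= p n)%E /\ (p n <= (expR (n%:R * (l + e)))%:E)%E.
Proof.
move=> /fine_cvgP[fin cv] e e0.
have /cvgrPdist_le/(_ e e0) cvn := cv.
near=> n.
have n0 : 0 < n%:R :> R by rewrite ltr0n; near: n; exact: nbhs_infty_gt.
have i0 : 0 < n%:R^-1 :> R by rewrite invr_gt0.
have finn : ((n%:R^-1 : R)%:E * lne (p n))%E \is a fin_num by near: n; exact: fin.
have : `|l - fine ((n%:R^-1 : R)%:E * lne (p n))%E| <= e by near: n; exact: cvn.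
case: (p n) finn => [r| |].
- have [r0|r0] := leP r 0.
    rewrite le0_lneNy ?lee_fin// mulrNy gtr0_sg// mul1e//.
  move=> _; rewrite lne_EFin//= ler_norml => /andP[h1 h2].
  have h3 : ln r <= n%:R * (l + e).
    have : n%:R * (n%:R^-1 * ln r) <= n%:R * (l + e) by rewrite ler_pM2l//; lra.
    by rewrite mulVKf// gt_eqF.
  have h4 : n%:R * (l - e) <= ln r.
    have : n%:R * (l - e) <= n%:R * (n%:R^-1 * ln r) by rewrite ler_pM2l//; lra.
    by rewrite mulVKf// gt_eqF.
  by rewrite !lee_fin -[X in _ <= X /\ X <= _]lnK ?posrE// !ler_expR.
- by rewrite /= mulry gtr0_sg// mul1e.
- by rewrite /= mulrNy gtr0_sg// mul1e.
Unshelve. all: by end_near. Qed.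

End exponential_rate.

Section moment_growth.
Variables (R : realType) (W : Type) (sigma : W -> W).
Variables (dX : measure_display) (X : measurableType dX) (m : probability X R).
Variables (d : nat) (var : (X -> R[i]) -> \bar R).
Hypothesis hvar : is_variation m d var.
Variables (T : W -> X -> X) (L : W -> (X -> R[i]) -> (X -> R[i])).
Hypothesis hT : forall w, nonsingular m (T w).
Hypothesis hL : forall w, is_transfer m (T w) (L w).
Variable (g : W * X -> 'rV[R]_d).
Hypothesis mg : forall w i, measurable_fun setT (fun x => g (w, x) ord0 i).
Variables (M : R) (v0 : W * X -> R).
Hypothesis v0_ge0 : forall z, 0 <= v0 z.
Implicit Types (w : W) (t : 'rV[R]_d).

Local Notation Lt t := (cocycle_iter sigma (twisted L g (rV_complex t))).
Local Notation rm w n t := (rmgf sigma m T g w n t).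
Local Notation vm w n t := (vmgf sigma m T g w v0 n t).

Definition lyap w t (l : R) : Prop :=
  (fun n : nat => ((n%:R^-1 : R)%:E * lne (opnorm m var (Lt t n w)))%E) @ \oo --> l%:E.

Record density_point w : Prop := {
  dens_obs : forall k, {ae m, forall x, forall i, `|g (iter k sigma w, x) ord0 i| <= M} ;
  dens_B : forall k, inB m var (fun x => (v0 (iter k sigma w, x))%:C) ;
  dens_int : forall k, \int[m]_x v0 (iter k sigma w, x) = 1 ;
  dens_eqv : forall k, cae_eq m
    (L (iter k sigma w) (fun x => (v0 (iter k sigma w, x))%:C))
    (fun x => (v0 (iter k.+1 sigma w, x))%:C) }.

(** The moment is the integral of the twisted iterate of the density, normalised to
    lie in the unit ball. *)
Lemma vmgf_le_opnorm w n t : density_point w ->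
  (((bn m var (fun x => (v0 (w, x))%:C) + 1)^-1 * vm w n t)%:E <=
    opnorm m var (Lt t n w))%E.
Proof.
move=> dw; have vB := dens_B dw 0; rewrite /= in vB.
have b0 := bn_ge0 hvar vB.
set b := bn m var _ in b0 *.
have c0 : 0 <= (b + 1)^-1 by rewrite invr_ge0 addr_ge0.
have [fB fb] := inBZ hvar ((b + 1)^-1)%:C vB.
set f := (fun x => _) in fB fb.
have f1 : bn m var f <= 1.
  rewrite fb cabs_real ger0_norm// -/b mulrC ler_pdivrMr ?mul1r; first by rewrite lerDl.
  by rewrite ltr_wpDl.
apply: le_trans (Bnorm_opnorm_le hvar (Lt t n w) fB f1).
have [Lf1 tr _] := twisted_rtransfer hT hL mg (dens_obs dw) n t (inB_L1 fB).
have E : \int[m]_x complex.Re (Lt t n w f x) = (b + 1)^-1 * vm w n t.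
  rewrite (rtransfer_integral tr) /vmgf -RintegralZl//; last first.
    exact: (rintegrable_expv hT mg (dens_obs dw) (fun k => inB_L1 (dens_B dw k))).
  by apply: eq_Rintegral => x _; rewrite /f complex_Re_scale /= mulrCA.
apply: (@le_trans _ _ (n1 m (Lt t n w f))%:E).
  by rewrite lee_fin -E (le_trans (ler_norm _))//; exact: Re_integral_le_n1.
rewrite /Bnorm L1normE// -[leLHS]adde0 leeD//.
exact: (var_ge0 hvar).
Qed.

Lemma vmgf_upper w t l : density_point w -> lyap w t l ->
  forall e : R, 0 < e -> \forall n \near \oo, vm w n t <= expR (n%:R * (l + e)).
Proof.
move=> dw ly e e0.
have vB := dens_B dw 0; rewrite /= in vB.
have b0 := bn_ge0 hvar vB.
have e2 : 0 < e / 2 by rewrite divr_gt0.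
have ev := log_rate_bounds ly e2.
near=> n.
have [_ up] : ((expR (n%:R * (l - e / 2)))%:E <= opnorm m var (Lt t n w))%E /\
  (opnorm m var (Lt t n w) <= (expR (n%:R * (l + e / 2)))%:E)%E by near: n.
have lnb : ln (bn m var (fun x => (v0 (w, x))%:C) + 1) <= n%:R * (e / 2).
  by near: n; exact: near_ln_div.
have := le_trans (vmgf_le_opnorm n t dw) up; rewrite lee_fin.
have bp : 0 < bn m var (fun x => (v0 (w, x))%:C) + 1 by rewrite ltr_wpDl.
rewrite ler_pdivrMl// => /le_trans; apply.
rewrite -[X in X * _]lnK ?posrE// -expRD ler_expR; lra.
Unshelve. all: by end_near. Qed.

Lemma vmgf_lower w j t l (c : R) : density_point w -> 0 < c ->
  {ae m, forall x, c <= v0 (iter j sigma w, x)} ->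
  (forall e : R, 0 < e ->
     \forall n \near \oo, expR (n%:R * (l - e)) <= rm (iter j sigma w) n t) ->
  forall e : R, 0 < e -> \forall n \near \oo, expR (n%:R * (l - e)) <= vm w n t.
Proof.
move=> dw c0 cv lo e e0.
have e2 : 0 < e / 2 by rewrite divr_gt0.
have [k0 _ ev] := lo _ e2.
set q := nrm1 t * M.
pose D := j%:R * q - ln c + j%:R * (l - e / 2).
near=> n.
have nk : (k0 + j <= n)%N by near: n; exact: nbhs_infty_ge.
have nD : ln (expR D) <= n%:R * (e / 2) by near: n; exact: near_ln_div.
rewrite expRK in nD.
have nE : n = (n - j + j)%N by lia.
have kj : (k0 <= n - j)%N by lia.
have := vmgf_ge_rmgf hT hL mg (dens_obs dw) v0_ge0 (fun k => inB_L1 (dens_B dw k))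
  (dens_eqv dw) (n - j) t (ltW c0) cv.
rewrite -nE -/q; apply: le_trans.
apply: (@le_trans _ _ (expR (- (j%:R * q)) * c * expR ((n - j)%N%:R * (l - e / 2)))).
  have -> : expR (- (j%:R * q)) * c = expR (- (j%:R * q) + ln c).
    by rewrite expRD lnK// posrE.
  rewrite -expRD ler_expR natrB; last by lia.
  rewrite /D in nD; lra.
apply: ler_wpM2l; last exact: ev.
by rewrite mulr_ge0 ?expR_ge0// ltW.
Unshelve. all: by end_near. Qed.

Variables (C : R) (N0 : nat).
Hypotheses (C0 : 0 < C) (N00 : (0 < N0)%N).

(** The comparison with the operator norm is available at multiples of [N0] only; in
    between, the moment loses a bounded factor. *)
Lemma rmgf_lower w t l :
  (forall k, {ae m, forall x, forall i, `|g (iter k sigma w, x) ord0 i| <= M}) ->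
  0 <= M ->
  (forall j, (opnorm m var (Lt t (j * N0) w) <= (C * rm w (j * N0) t)%:E)%E) ->
  lyap w t l ->
  forall e : R, 0 < e -> \forall n \near \oo, expR (n%:R * (l - e)) <= rm w n t.
Proof.
move=> gM M0 opC ly e e0.
have e2 : 0 < e / 2 by rewrite divr_gt0.
have [k0 _ ev] := log_rate_bounds ly e2.
set q := nrm1 t * M.
have q0 : 0 <= q by rewrite mulr_ge0// nrm1_ge0.
pose a := l - e / 2.
(* logarithm of the constant, and of the loss over the remaining s < N0 steps *)
pose D := ln C + N0%:R * q + N0%:R * `|a|.
near=> n.
have nk : (k0 + N0 <= n)%N by near: n; exact: nbhs_infty_ge.
have nD : ln (expR D) <= n%:R * (e / 2) by near: n; exact: near_ln_div.
rewrite expRK in nD.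
pose j := (n %/ N0)%N; pose s := (n %% N0)%N.
have nE : n = (s + j * N0)%N by rewrite addnC -divn_eq.
have sN : (s < N0)%N by rewrite ltn_mod.
have kj : (k0 <= j * N0)%N by lia.
have [lo _] := ev _ kj.
have := le_trans lo (opC j); rewrite lee_fin => lo'.
have st := rmgf_step hT mg gM s (j * N0) t.
rewrite -nE -/q in st.
apply: le_trans st.
have h1 : expR (- (s%:R * q)) * (C^-1 * expR ((j * N0)%N%:R * a)) <=
    expR (- (s%:R * q)) * rm w (j * N0) t.
  by rewrite ler_wpM2l ?expR_ge0// ler_pdivrMl.
apply: le_trans h1.
rewrite -[C^-1]lnK ?posrE ?invr_gt0// lnV ?posrE// -!expRD ler_expR.
have nR : n%:R = s%:R + (j * N0)%N%:R :> R by rewrite -natrD -nE.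
have h2 : s%:R * q <= N0%:R * q by rewrite ler_wpM2r// ler_nat ltnW.
have h3 : s%:R * a <= N0%:R * `|a|.
  apply: (@le_trans _ _ (s%:R * `|a|)); first by rewrite ler_wpM2l// ler_norm.
  by rewrite ler_wpM2r// ler_nat ltnW.
have -> : l - e = a - e / 2 by rewrite /a; lra.
have -> : (j * N0)%N%:R = n%:R - s%:R :> R by rewrite nR; lra.
rewrite /D in nD; lra.
Unshelve. all: by end_near. Qed.

End moment_growth.
(** * Almost everywhere statements *)

Section almost_everywhere.
Variable R : realType.

Lemma ae_iter dO (Omega : measurableType dO) (P : probability Omega R)
    (sigma : Omega -> Omega) (Q : Omega -> Prop) :
  measurable_fun setT sigma ->
  (forall A, measurable A -> P (sigma @^-1` A) = P A) ->
  {ae P, forall w, Q w} -> {ae P, forall w, forall k, Q (iter k sigma w)}.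
Proof.
move=> ms pres aeQ; apply/ae_foralln => k.
elim: k => [//|k [N [mN N0 QN]]].
exists (sigma @^-1` N); split.
- by rewrite -[_ @^-1` _]setTI; exact: ms.
- exact: etrans (pres _ mN) N0.
- by move=> w /= nQ; apply: QN => /=; rewrite -iterSr.
Qed.

Lemma ae_product dO (Omega : measurableType dO) (P : probability Omega R)
    dX (X : measurableType dX) (m : probability X R) (Q : Omega * X -> Prop) :
  {ae (P \x m)%E, forall z, Q z} ->
  {ae P, forall w, {ae m, forall x, Q (w, x)}}.
Proof.
move=> [N [mN N0 QN]].
have mf : measurable_fun setT (fun w => m (xsection N w)).
  exact: measurable_fun_xsection.
have E : (\int[P]_w `|m (xsection N w)| = 0)%E.
  rewrite -[RHS]N0 /product_measure1 /=.
  by apply: eq_integral => w _; rewrite gee0_abs.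
have := (ae_eq_integral_abs P measurableT mf).1 E.
apply: filterS => w /(_ I) /= Nw.
exists (xsection N w); split => //; first exact: measurable_xsection.
by move=> x /= nQ; apply/mem_set; exact: QN.
Qed.

Lemma ess_sup_real_bound dO (Omega : measurableType dO)
    (P : {measure set Omega -> \bar R}) (f : Omega -> \bar R) :
  (ess_sup P f < +oo)%E -> exists2 b : R, 0 <= b & {ae P, forall w, (f w <= b%:E)%E}.
Proof.
move=> lt; exists `|fine (ess_sup P f)| => //; apply/ess_supP.
by case: (ess_sup P f) lt => //= [r|] _; rewrite ?leNye// lee_fin ler_norm.
Qed.

End almost_everywhere.

(** * Approximation by rational parameters *)

Section rational_approximation.
Variables (R : realType) (d : nat).
Implicit Types (t u : 'rV[R]_d).

Lemma nbhs_rat_vec t (N : set 'rV[R]_d) : nbhs t N -> exists q, N (rat_vec R q).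
Proof.
move=> /nbhs_ballP[e /= e0 eN]; have [q qt] := rat_vec_dense t e0.
by exists q; apply: eN; rewrite mx_norm_ball /ball_/= distrC.
Qed.

Lemma nbhs_enorm_lt t (r : R) : enorm t < r -> nbhs t [set u | enorm u < r].
Proof. by move=> tr; apply: (cvgr_lt _ (@enorm_continuous R d t)). Qed.

(** Rational points of the closed ball itself, including near its sphere *)
Lemma closed_ball_rat_vec t (r : R) (N : set 'rV[R]_d) : 0 < r -> enorm t <= r ->
  nbhs t N -> exists q, enorm (rat_vec R q) <= r /\ N (rat_vec R q).
Proof.
move=> r0 tr tN.
(* shrink [t] a little to enter the open ball *)
have [s [s0 s1 Ns]] : exists s : R, [/\ 0 <= s, s < 1 & nbhs (s *: t) N].
  have cs : {for 1, continuous (fun s : R => s *: t)} by exact: scalel_continuous.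
  have tN' : nbhs t (fun u => nbhs u N) by exact: nbhs_interior.
  have : nbhs (1 : R) [set s | nbhs (s *: t) N] by have := cs (fun u => nbhs u N); rewrite /= scale1r; apply.
  move=> /nbhs_ballP[e /= e0 eN].
  have e'0 : 0 < Num.min e 1 by rewrite lt_min e0/=.
  have e'e : Num.min e 1 <= e by rewrite ge_min lexx.
  have e'1 : Num.min e 1 <= 1 by rewrite ge_min lexx orbT.
  exists (1 - Num.min e 1 / 2); split; [lra|lra|].
  apply: eN; rewrite /ball/= opprB addrCA subrr addr0 gtr0_norm ?divr_gt0//; lra.
have str : enorm (s *: t) < r.
  rewrite enormZ ger0_norm//.
  have [->|sn0] := eqVneq s 0; first by rewrite mul0r.
  by rewrite (le_lt_trans (ler_wpM2l s0 tr))// -[ltRHS]mul1r ltr_pM2r.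
have [q [qr qN]] := nbhs_rat_vec (filterI (nbhs_enorm_lt str) Ns).
by exists q; split=> //; exact: ltW.
Qed.

Lemma near_nrm1 t (M e : R) : 0 <= M -> 0 < e ->
  nbhs t [set u | M * nrm1 (t - u) <= e].
Proof.
move=> M0 e0.
have D0 : 0 < M * d%:R + 1 by rewrite ltr_wpDl// mulr_ge0.
apply/nbhs_ballP; exists (e / (M * d%:R + 1)) => /=; first exact: divr_gt0.
move=> u; rewrite mx_norm_ball /ball_/= => tu.
apply: (@le_trans _ _ ((M * d%:R + 1) * `|t - u|)).
  rewrite mulrDl mul1r -mulrA (le_trans (ler_wpM2l M0 (nrm1_le_norm _)))//.
  by rewrite lerDl.
by rewrite mulrC -ler_pdivlMr// ltW.
Qed.

Lemma nrm1_le_enorm t : nrm1 t <= d%:R * enorm t.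
Proof.
apply: (@le_trans _ _ (\sum_(i < d) enorm t)).
  by apply: ler_sum => i _; exact: coord_le_enorm.
by rewrite sumr_const card_ord mulr_natl.
Qed.

End rational_approximation.

Section extension.
Variables (R : realType) (dX : measure_display) (X : measurableType dX).
Variables (m : probability X R) (d : nat) (v : X -> R).
Variables (S : nat -> X -> 'rV[R]_d) (M : R).
Hypothesis mv : measurable_fun setT v.
Hypothesis v0 : forall x, 0 <= v x.
Hypothesis mS : forall n i, measurable_fun setT (fun x => S n x ord0 i).
Hypothesis M0 : 0 <= M.
Hypothesis SM : forall n, {ae m, forall x, forall i, `|S n x ord0 i| <= n%:R * M}.
Variable Lam : 'rV[R]_d -> R.
Implicit Types t u : 'rV[R]_d.

Local Notation mgf := (mgf m v S).

(** The exponential rates depend on [t] in a Lipschitz way, so they are determined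
    by a dense set of parameters wherever [Lam] is continuous. *)
Lemma mgf_upper_extend t :
  {for t, continuous Lam} ->
  (forall N, nbhs t N -> exists u, N u /\ forall e : R, 0 < e ->
    \forall n \near \oo, (mgf n u <= (expR (n%:R * (Lam u + e)))%:E)%E) ->
  forall e : R, 0 < e -> \forall n \near \oo, (mgf n t <= (expR (n%:R * (Lam t + e)))%:E)%E.
Proof.
move=> cL H e e0; have e3 : 0 < e / 3 by rewrite divr_gt0.
have nL : nbhs t [set u | `|Lam t - Lam u| <= e / 3].
  by move/cvgrPdist_le: cL => /(_ _ e3).
have [u [[Lu nu] Hu]] := H _ (filterI nL (near_nrm1 t M0 e3)).
apply: filterS (Hu _ e3) => n up.
apply: le_trans (mgf_Lipschitz mv v0 mS SM n t u) _.
apply: le_trans (lee_wpmul2l _ up) _; first by rewrite lee_fin expR_ge0.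
rewrite -EFinM lee_fin -expRD ler_expR -mulrDr ler_wpM2l//.
by move: Lu nu; rewrite /= ler_norml => /andP[? ?] ?; lra.
Qed.

Lemma mgf_lower_extend t :
  {for t, continuous Lam} ->
  (forall N, nbhs t N -> exists u, N u /\ forall e : R, 0 < e ->
    \forall n \near \oo, ((expR (n%:R * (Lam u - e)))%:E <= mgf n u)%E) ->
  forall e : R, 0 < e -> \forall n \near \oo, ((expR (n%:R * (Lam t - e)))%:E <= mgf n t)%E.
Proof.
move=> cL H e e0; have e3 : 0 < e / 3 by rewrite divr_gt0.
have nL : nbhs t [set u | `|Lam t - Lam u| <= e / 3].
  by move/cvgrPdist_le: cL => /(_ _ e3).
have [u [[Lu nu] Hu]] := H _ (filterI nL (near_nrm1 t M0 e3)).
apply: filterS (Hu _ e3) => n lo.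
have := le_trans lo (mgf_Lipschitz mv v0 mS SM n u t).
have -> : nrm1 (u - t) = nrm1 (t - u).
  by apply: eq_bigr => i _; rewrite !mxE distrC.
set c := n%:R * (M * _) => le.
have c0 : (0 <= (expR (- c))%:E)%E by rewrite lee_fin expR_ge0.
have := lee_wpmul2l c0 le.
have -> : ((expR (- c))%:E * ((expR c)%:E * mgf n t) = mgf n t)%E.
  by rewrite muleA -EFinM -expRD addNr expR0 mul1e.
rewrite -EFinM -expRD; apply: le_trans.
rewrite lee_fin ler_expR /c [leRHS]addrC -mulrBr ler_wpM2l//.
by move: Lu nu; rewrite /= ler_norml => /andP[? ?] ?; lra.
Qed.

End extension.
(** * Quenched exponential moments *)

Section exponential_moments.
Variables (R : realType) (dO : measure_display) (Omega : measurableType dO).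
Variables (E : metricType R) (iota : Omega -> E) (P : probability Omega R).
Variables (sigma : Omega -> Omega) (hsigma : ergodic_homeo iota P sigma).
Variables (dX : measure_display) (X : measurableType dX) (m : probability X R).
Variables (d : nat) (var : (X -> R[i]) -> \bar R) (hvar : is_variation m d var).
Variables (T : Omega -> X -> X) (hT : forall w, nonsingular m (T w)).
Variables (L : Omega -> (X -> R[i]) -> (X -> R[i])).
Hypothesis hL : forall w, is_transfer m (T w) (L w).
Hypothesis hadm : admissible iota P sigma m var L.
Variables (v0 : Omega * X -> R) (hv0 : equivariant_density P sigma m var L v0).
Variables (g : Omega * X -> 'rV[R]_d) (hg : observable P m var v0 g).
Variable Lam : 'rV[R[i]]_d -> \bar R.
Hypothesis hLam : is_top_lyapunov P sigma m var L g Lam.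

Let mg w i : measurable_fun setT (fun x => g (w, x) ord0 i).
Proof. exact: (measurableT_comp (obs_measurable hg i) (pair1_measurable w)). Qed.

Let ms : measurable_fun setT sigma.
Proof. by have [[? _ [_ _ ? _]] _ _] := hsigma. Qed.

Let ae_orbit (Q : Omega -> Prop) : {ae P, forall w, Q w} ->
  {ae P, forall w, forall k, Q (iter k sigma w)}.
Proof. by apply: ae_iter => //; exact: preserving hsigma. Qed.

Lemma ae_obs_bounded : exists2 M : R, 0 <= M &
  {ae P, forall w, {ae m, forall x, forall i, `|g (w, x) ord0 i| <= M}}.
Proof.
have [M M0 gM] := ess_sup_real_bound (obs_bounded hg); exists M => //.
apply: filterS (ae_product gM) => w; apply: filterS => x; rewrite lee_fin => gx i.
exact: le_trans (coord_le_norm _ _) gx.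
Qed.

(** [N0] is a time by which the decay on functions of mean zero reaches the factor
    1/8. *)
Lemma ae_regular : exists M K V : R, exists N0 : nat,
  [/\ 0 <= M, 1 <= K, 0 <= V, (0 < N0)%N &
   {ae P, forall w, regular_point sigma m var L g K M V N0 w}].
Proof.
have [M M0 aeM] := ae_obs_bounded.
have [V V0 aeV] := ess_sup_real_bound (obs_var hg).
have [K K0 aeK] := adm_bounded hadm.
have [K' [la [K'0 la0 aeD]]] := adm_decay hadm.
have [N0 N00 N08] : exists2 N0 : nat, (0 < N0)%N & K' * expR (- la * N0%:R) <= 8^-1.
  have p8 : (0 : R) < 8^-1 / K' by rewrite divr_gt0.
  have [n ndist] : exists n : nat, - ln (8^-1 / K') <= n%:R * la.
    have := near_ln_div (expR (- ln (8^-1 / K'))) la0; rewrite expRK => -[n _ nP].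
    by exists n; apply: nP => /=.
  exists n.+1 => //; rewrite mulrC -ler_pdivlMr// -[leRHS]lnK ?posrE// ler_expR.
  rewrite -natr1 mulrDr mulr1; lra.
exists M, (Num.max K 1), V, N0; split => //; first by rewrite le_max lexx orbT.
have H1 := ae_orbit aeM; have H2 := ae_orbit aeV; have H3 := ae_orbit aeK.
have H4 := ae_orbit aeD.
near=> w.
have gM : forall k, {ae m, forall x, forall i, `|g (iter k sigma w, x) ord0 i| <= M}.
  by near: w.
have Kw : forall k f, inB m var f ->
    (Bnorm m var (L (iter k sigma w) f) <= K%:E * Bnorm m var f)%E by near: w.
have Dw : forall k n f, inB m var f -> cintegral m f = 0 ->
   (Bnorm m var (cocycle_iter sigma L n (iter k sigma w) f)
            <= (K' * expR (- la * n%:R))%:E * Bnorm m var f)%E by near: w.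
have Vw : forall k, (var_vec var (fun x => g (iter k sigma w, x)) <= V%:E)%E by near: w.
split=> //.
- move=> k f fB; have := Kw k f fB; rewrite (BnormE hvar fB) -EFinM.
  move=> /(inB_Bnorm_le hvar (transfer_L1 hL _ (inB_L1 fB)))[LB Lb].
  by split=> //; rewrite (le_trans Lb)// ler_wpM2r ?(bn_ge0 hvar)// le_max lexx.
- move=> k f fB f0; have := Dw k N0 f fB f0; rewrite (BnormE hvar fB) -EFinM.
  have gMk j : {ae m, forall x, forall i, `|g (iter j sigma (iter k sigma w), x) ord0 i| <= M}.
    by rewrite -iterD; exact: gM.
  have [L1n _] := cocycle_rtransfer hT hL mg gMk N0 (inB_L1 fB).
  move=> /(inB_Bnorm_le hvar L1n)[_ le].
  by rewrite (le_trans le)// ler_wpM2r ?(bn_ge0 hvar).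
Unshelve. all: by end_near. Qed.

Lemma ae_density (M : R) :
  {ae P, forall w, {ae m, forall x, forall i, `|g (w, x) ord0 i| <= M}} ->
  {ae P, forall w, density_point sigma m var L g M v0 w}.
Proof.
move=> /ae_orbit aeM; have aeD := ae_orbit (density_equivariant hv0).
move: aeM aeD; apply: filterS2 => w gM D; split=> //.
- by move=> k; have [] := D k.
- by move=> k; have [_ + _] := D k; rewrite /Rintegral => ->.
- by move=> k; have [_ _] := D k.
Qed.

(** Positivity of the density at some later time, from the mixing condition applied
    to the density itself; the time depends on the base point *)
Lemma ae_density_lower (M : R) :
  {ae P, forall w, {ae m, forall x, forall i, `|g (w, x) ord0 i| <= M}} ->
  exists2 c : R, 0 < c &
  {ae P, forall w, exists j, {ae m, forall x, c <= v0 (iter j sigma w, x)}}.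
Proof.
move=> aeM.
have [N [c [N0 c0 mix]]] := adm_min_expanding hadm; exists c => //.
have [n0 mixn] := choice (fun a : nat => mix a.+1%:R (ltr0Sn _ a)).
have aemix := ae_foralln (fun a => mixn a (n0 a) (leqnn _)).
near=> w.
have dw : density_point sigma m var L g M v0 w by near: w; exact: ae_density.
have vB := dens_B dw 0; rewrite /= in vB.
have [a va] : exists a : nat, vr var (fun x => (v0 (w, x))%:C) <= a.+1%:R.
  exists (Num.bound (vr var (fun x => (v0 (w, x))%:C))).
  by rewrite ltW// (lt_trans (archi_boundP (vr_ge0 hvar vB)))// ltr_nat.
exists (N * n0 a)%N.
have mixw : forall a f, inB m var f -> {ae m, forall x, 0 <= f x} ->
    (var f <= (a.+1%:R * \int[m]_x complex.Re (f x))%:E)%E ->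
    (c%:E * L1norm m f <= ess_inf m (fun x =>
          (complex.Re (cocycle_iter sigma L (N * n0 a) w f x))%:E))%E.
  by near: w.
have v1 := dens_int dw 0; rewrite /= in v1.
have := mixw a _ vB.
rewrite (varE hvar vB) lee_fin /= v1 mulr1.
have -> : L1norm m (fun x => (v0 (w, x))%:C) = 1%E.
  rewrite (L1normE (inB_L1 vB)) /n1 -v1; congr (_%:E); apply: eq_Rintegral => x _.
  by rewrite cabs_real ger0_norm// (density_ge0 hv0).
rewrite mule1 => /(_ _ va) le.
have {}le : (c%:E <= ess_inf m (fun x =>
          (complex.Re (cocycle_iter sigma L (N * n0 a) w (fun x => (v0 (w, x))%:C) x))%:E))%E.
  by apply: le; apply: aeW => x; rewrite lecR (density_ge0 hv0).
have cd := cocycle_density hT hL mg (dens_obs dw) (fun k => inB_L1 (dens_B dw k))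
  (dens_eqv dw) (N * n0 a).
move/ess_infP: le; move: cd; apply: filterS2 => x -> /=.
by rewrite lee_fin.
Unshelve. all: by end_near. Qed.

(** The exponent is a limit outside a null set that depends on the parameter; for
    countably many parameters one null set suffices. *)
Lemma ae_lyap : {ae P, forall w, forall q : 'rV[rat]_d,
  (fun n : nat => ((n%:R^-1 : R)%:E *
     lne (opnorm m var (cocycle_iter sigma (twisted L g (rV_complex (rat_vec R q))) n w)))%E)
  @ \oo --> Lam (rV_complex (rat_vec R q))}.
Proof.
pose Q (k : nat) w := if @choice.unpickle 'rV[rat]_d k is Some q then
  (fun n : nat => ((n%:R^-1 : R)%:E *
     lne (opnorm m var (cocycle_iter sigma (twisted L g (rV_complex (rat_vec R q))) n w)))%E)
  @ \oo --> Lam (rV_complex (rat_vec R q)) else True.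
have : {ae P, forall w, forall k, Q k w}.
  apply/ae_foralln => k; rewrite /Q; case: choice.unpickle => [q|]; last exact: aeW.
  exact: hLam.
by apply: filterS => w Qw q; have := Qw (choice.pickle q); rewrite /Q choice.pickleK.
Qed.

Lemma ae_vmgf_ge1 (M : R) :
  {ae P, forall w, {ae m, forall x, forall i, `|g (w, x) ord0 i| <= M}} ->
  {ae P, forall w, forall n t, 1 <= vmgf sigma m T g w v0 n t}.
Proof.
move=> aeM; have aeC := ae_orbit (obs_centered hg).
move: (ae_density aeM) aeC; apply: filterS2 => w dw cw n t.
exact: (vmgf_ge1 hT hL mg (dens_obs dw) (density_ge0 hv0) (fun k => inB_L1 (dens_B dw k))
  (dens_int dw) (dens_eqv dw)).
Qed.

Variables (r : R) (hr : 0 < r) (hB : posdef_hessian_ball Lam r).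

Local Notation Lm := (Lam_real Lam).

Lemma Lam_real_continuous t : eucl_closed_ball r t -> {for t, continuous Lm}.
Proof. by move=> rt; have [[U [rU _ [[_ cf _] _]]] _] := hB; exact: cf (rU _ rt). Qed.

Lemma Lam_realE t : eucl_closed_ball r t -> Lam (rV_complex t) = (Lm t)%:E.
Proof. by move=> rt; have [[U [rU finU _]] _] := hB; rewrite fineK//; exact: finU (rU _ rt). Qed.

(** The upper rate holds on the whole ball, the lower one only for twists small enough
    to be perturbations.  Both are known at rational parameters, along the orbit of
    [w]: the lower one is obtained at the time [j] when the density is bounded below. *)
Lemma moment_rates : exists M rho : R, [/\ 0 <= M, 0 < rho, rho <= r &
  {ae P, forall w,
    let S := (fun n => birkhoff_sum sigma T g n w) in
    let mgf := mgf m (fun x => v0 (w, x)) S in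
    [/\ forall n, {ae m, forall x, forall i, `|S n x ord0 i| <= n%:R * M},
        forall t, eucl_closed_ball r t -> forall e : R, 0 < e ->
          \forall n \near \oo, (mgf n t <= (expR (n%:R * (Lm t + e)))%:E)%E,
        forall t, enorm t < rho -> forall e : R, 0 < e ->
          \forall n \near \oo, ((expR (n%:R * (Lm t - e)))%:E <= mgf n t)%E,
        forall n t, (1 <= mgf n t)%E &
        forall n, mgf n 0 = 1%E]}].
Proof.
have [M [K [V [N0 [M0 K1 V0 N00 aeR]]]]] := ae_regular.
have [tau [C [tau0 C0 grow]]] := opnorm_le_rmgf sigma hvar hT hL mg N0 K1 M0 V0.
have aeM : {ae P, forall w, {ae m, forall x, forall i, `|g (w, x) ord0 i| <= M}}.
  by apply: filterS aeR => w rw; exact: (reg_obs rw 0%N).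
have [c c0 aeL] := ae_density_lower aeM.
pose rho := Num.min r (tau / (d%:R + 1)).
have d1 : 0 < d%:R + 1 :> R by rewrite ltr_wpDl.
have rho0 : 0 < rho by rewrite lt_min hr divr_gt0.
have rhor : rho <= r by rewrite ge_min lexx.
have rhot (t : 'rV[R]_d) : enorm t < rho -> nrm1 t <= tau.
  move=> tr; apply: le_trans (nrm1_le_enorm t) _.
  apply: (@le_trans _ _ ((d%:R + 1) * (tau / (d%:R + 1)))); last first.
    by rewrite mulrC divfK// gt_eqF.
  apply: ler_pM => //; [exact: enorm_ge0|by rewrite lerDl|].
  by rewrite (le_trans (ltW tr))// ge_min lexx orbT.
exists M, rho; split => //.
have aeLy := ae_orbit ae_lyap.
have aeR' := ae_orbit aeR.
have aeD := ae_density aeM.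
have aeV := ae_vmgf_ge1 aeM.
near=> w.
pose S n := birkhoff_sum sigma T g n w.
pose mgf n t := mgf m (fun x => v0 (w, x)) S n t.
have rw : forall k, regular_point sigma m var L g K M V N0 (iter k sigma w) by near: w.
have dw : density_point sigma m var L g M v0 w by near: w.
have lw : forall k (q : 'rV[rat]_d),
  (fun n : nat => ((n%:R^-1 : R)%:E *
     lne (opnorm m var (cocycle_iter sigma (twisted L g (rV_complex (rat_vec R q))) n (iter k sigma w))))%E)
  @ \oo --> Lam (rV_complex (rat_vec R q)) by near: w.
have [j vj] : exists j, {ae m, forall x, c <= v0 (iter j sigma w, x)} by near: w.
have vw : forall n t, 1 <= vmgf sigma m T g w v0 n t by near: w.
have gM := dens_obs dw.
have v1 k := inB_L1 (dens_B dw k).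
have mE n t : mgf n t = (vmgf sigma m T g w v0 n t)%:E.
  exact: (mgf_vmgf hT mg gM v1).
have SM := birkhoff_bounded hT gM.
have mS n i : measurable_fun setT (fun x => S n x ord0 i).
  exact: (measurable_birkhoff sigma hT mg).
have mv : measurable_fun setT (fun x => v0 (w, x)).
  exact: (measurableT_comp (density_measurable hv0) (pair1_measurable w)).
have vge0 x : 0 <= v0 (w, x) := density_ge0 hv0 (w, x).
have lyq k q : eucl_closed_ball r (rat_vec R q) ->
    lyap sigma m var L g (iter k sigma w) (rat_vec R q) (Lm (rat_vec R q)).
  by move=> rq; rewrite /lyap -Lam_realE//; exact: lw.
split => //.
- move=> t rt; apply: (mgf_upper_extend mv vge0 mS M0 SM (Lam_real_continuous rt)).
  move=> N tN; have [q [qr qN]] := closed_ball_rat_vec hr rt tN.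
  exists (rat_vec R q); split => // e e0.
  have := vmgf_upper hvar hT hL mg dw (lyq 0 q qr) e0.
  by apply: filterS => n le; rewrite -/(mgf n _) mE lee_fin.
- move=> t rt.
  have rt' : eucl_closed_ball r t by exact: ltW (lt_le_trans rt rhor).
  apply: (mgf_lower_extend mv vge0 mS M0 SM (Lam_real_continuous rt')).
  move=> N tN; have [q [qr qN]] := nbhs_rat_vec (filterI (nbhs_enorm_lt rt) tN).
  exists (rat_vec R q); split => // e e0.
  have qr' : eucl_closed_ball r (rat_vec R q) by exact: ltW (lt_le_trans qr rhor).
  have lo := rmgf_lower hT mg C0 N00 (reg_obs (rw j)) M0
    (fun i => grow _ _ i (rw j) (rhot _ qr)) (lyq j q qr').
  have := vmgf_lower hT hL mg (density_ge0 hv0) dw c0 vj lo e0.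
  by apply: filterS => n le; rewrite -/(mgf n _) mE lee_fin.
- by move=> n t; rewrite -/(mgf n t) mE lee_fin.
- move=> n; rewrite -/(mgf n 0) mE /vmgf; congr (_%:E); rewrite -[RHS](dens_int dw 0).
  by apply: eq_Rintegral => x _; rewrite dot0p expR0 mul1r.
Unshelve. all: by end_near. Qed.

End exponential_moments.
(** * The large deviation principle *)

Theorem theorem4p2 (R : realType)
    (dO : measure_display) (Omega : measurableType dO)
    (E : metricType R) (iota : Omega -> E)
    (hOmega : borel_sample_space iota)
    (P : probability Omega R)
    (sigma : Omega -> Omega) (hsigma : ergodic_homeo iota P sigma)
    (dX : measure_display) (X : measurableType dX) (m : probability X R)
    (d : nat) (hd : (0 < d)%N)
    (var : (X -> R[i]) -> \bar R) (hvar : is_variation m d var)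
    (T : Omega -> X -> X) (hT : forall w, nonsingular m (T w))
    (L : Omega -> (X -> R[i]) -> (X -> R[i]))
    (hL : forall w, is_transfer m (T w) (L w))
    (hadm : admissible iota P sigma m var L)
    (v0 : Omega * X -> R) (hv0 : equivariant_density P sigma m var L v0)
    (g : Omega * X -> 'rV[R]_d) (hg : observable P m var v0 g)
    (Sigma2 : 'M[R]_d)
    (hSigma2 : is_asymptotic_covariance P sigma m T v0 g Sigma2)
    (Lam : 'rV[R[i]]_d -> \bar R)
    (hLam : is_top_lyapunov P sigma m var L g Lam)
    (hpos : posdef Sigma2)
    (r : R) (hr : 0 < r) (hB : posdef_hessian_ball Lam r) :
  exists2 r0 : R, 0 < r0 &
    {ae P, forall w,
      (forall A : set 'rV[R]_d, closed A ->
        (limn_esup (fun n : nat => (n%:R^-1 : R)%:E *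
           lne (mu_of m v0 w
             [set x | A (n%:R^-1 *: birkhoff_sum sigma T g n w x)]))
         <= - ereal_inf [set rate Lam r x | x in A])%E)
      /\
      (forall A : set 'rV[R]_d, open A -> A `<=` eucl_closed_ball r0 ->
        (- ereal_inf [set rate Lam r x | x in A]
         <= limn_einf (fun n : nat => (n%:R^-1 : R)%:E *
           lne (mu_of m v0 w
             [set x | A (n%:R^-1 *: birkhoff_sum sigma T g n w x)])))%E)}.
Proof.
have [U [[rU finU C2U] Hpos]] : exists U : set 'rV[R]_d,
    [/\ eucl_closed_ball r `<=` U,
        forall t, U t -> Lam (rV_complex t) \is a fin_num & C2_on U (Lam_real Lam)] /\
    forall t, eucl_closed_ball r t -> posdef (hessian (Lam_real Lam) t).
  by have [[U ?] ?] := hB; exists U.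
have [M [rho [M0 rho0 rhor rates]]] :=
  moment_rates hsigma hvar hT hL hadm hv0 hg hLam hr hB.
have zr : eucl_closed_ball r (0 : 'rV[R]_d).
  by rewrite /eucl_closed_ball/= dotp0 sqrtr0 ltW.
have z_rho : enorm (0 : 'rV[R]_d) < rho by rewrite /enorm dotp0 sqrtr0.
(* Lam is deterministic: its minimum at 0 is read off from the moments at a single
   typical base point. *)
have [Lam0 Lam_ge0] : Lam_real Lam 0 = 0 /\
    forall t, eucl_closed_ball r t -> 0 <= Lam_real Lam t.
  have P1 : (0 < P setT)%E by rewrite probability_setT.
  have PF := ae_properfilter_algebraOfSetsType P1.
  have [w [SM up lo ge1 at0]] := filter_ex rates.
  have ge0 t : eucl_closed_ball r t -> 0 <= Lam_real Lam t.
    move=> rt; apply/ler_addgt0Pr => e e0.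
    have [k _ /(_ k.+1 (leqnSn k)) le] := up t rt e e0.
    have := le_trans (ge1 k.+1 t) le; rewrite lee_fin -[leLHS]expR0 ler_expR.
    by rewrite pmulr_rge0// ltr0n.
  split; last exact: ge0.
  apply/eqP; rewrite eq_le ge0// andbT; apply/ler_addgt0Pr => e e0.
  have [k _ /(_ k.+1 (leqnSn k)) /=] := lo 0 z_rho e e0.
  rewrite at0 lee_fin -[leRHS]expR0 ler_expR pmulr_rle0 ?ltr0n//.
  by rewrite subr_le0 add0r.
have rho2 : 0 < rho / 2 by rewrite divr_gt0.
have rho2r : rho / 2 <= r by lra.
have [r0 r00 grad] := gradient_onto_ball C2U rU Hpos Lam0 Lam_ge0 rho2 rho2r.
exists r0 => //.
apply: filterS rates => w [SM up lo _ _].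
have mS n i : measurable_fun setT (fun x => birkhoff_sum sigma T g n w x ord0 i).
  apply: (measurable_birkhoff sigma hT) => w' j.
  exact: (measurableT_comp (obs_measurable hg j) (pair1_measurable w')).
have mv : measurable_fun setT (fun x => v0 (w, x)).
  exact: (measurableT_comp (density_measurable hv0) (pair1_measurable w)).
have vge0 x : 0 <= v0 (w, x) := density_ge0 hv0 (w, x).
split; first by move=> A cA; exact: (ldp_upper mv vge0 mS M0 SM up cA).
move=> A oA Ar0.
rewrite leeNl; apply: le_ereal_inf_tmp => _ [x Ax <-].
have [t0 t0r gt0] := grad x (Ar0 x Ax).
have t0rho : enorm t0 < rho by lra.
have t0B : nbhs t0 (eucl_closed_ball r : set 'rV[R]_d).
  apply: filterS (nbhs_enorm_lt t0rho) => u /= ur.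
  exact: ltW (lt_le_trans ur rhor).
have dL i : derivable (Lam_real Lam) t0 (delta_mx ord0 i).
  have [[_ _ /(_ i t0 (rU _ (nbhs_singleton t0B)))[]]] := C2U.
  by [].
have := ldp_lower_point mv vge0 mS up (lo t0 t0rho) t0B dL gt0 oA Ax.
move=> le; rewrite leeNl; apply: le_trans le.
rewrite EFinN leeN2; apply: ereal_sup_ubound; exists t0 => //.
exact: (nbhs_singleton t0B).
Qed.
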